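(* Let $\rho:SL_2(\mathbb{Z})\rightarrow GL_3(\mathbb{C})$ be irreducible, with $\rho(T)=\mathrm{diag}\left(e^{2\pi iA/N},e^{2\pi iB/N},e^{2\pi iC/N}\right)$ of finite order $N$, where $A,B,C$ are distinct integers satisfying $0\leq A,B,C\leq N-1$ and $\gcd(A,B,C,N)=1$; let $\rho$ be normalized so that its minimal weight vector $F_0$ has the form given in the context. Suppose that $N=2M$ and $C=B+M$ for some integer $M\geq2$. Then $\rho$ has finite image. If, furthermore, there is a prime $p$ dividing $\frac{N}{\gcd(N,\,2^8\cdot3^4\cdot5^2\cdot7^2)}$, then $\ker\rho$ is a noncongruence subgroup of $SL_2(\mathbb{Z})$, and $F_0$ has a component which is a modular form for $\ker\rho$ and is $p$-unbounded.
   Context: Let $\Gamma=SL_2(\mathbb{Z})$, $T=\begin{pmatrix}1&1\\0&1\end{pmatrix}$, $q=e^{2\pi i\tau}$ with $\tau$ in the upper half-plane $\mathbb{H}$, and $(f|_k\gamma)(\tau)=(c\tau+d)^{-k}f(\gamma\tau)$ for $\gamma=\begin{pmatrix}a&b\\c&d\end{pmatrix}\in\Gamma$. A vector-valued modular form of weight $k\in\mathbb{Z}$ for $\rho:\Gamma\to GL_m(\mathbb{C})$ is a holomorphic $F=(f_1,\ldots,f_m)^t:\mathbb{H}\to\mathbb{C}^m$ with $F|_k\gamma=\rho(\gamma)F$ for all $\gamma\in\Gamma$ (componentwise action), and of moderate growth at infinity (there is an integer $K$ such that for each $j$, $|f_j(x+iy)|<y^K$ for fixed $x\in\mathbb{R}$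 and $y\gg0$). The space of these is $\mathcal{H}(k,\rho)$. For $\rho$ as in the claim, it is known that the smallest weight $k_0$ with $\mathcal{H}(k_0,\rho)\neq0$ is the integer $k_0=\frac{4(A+B+C)}{N}-2$ and that $\mathcal{H}(k_0,\rho)$ is spanned by a single vector $F_0$; after conjugating $\rho$ by a diagonal matrix (which does not affect $\rho(T)$) one may and does assume that $$F_0=\begin{pmatrix}q^{A/N}+\sum_{n\geq1}a(n)q^{A/N+n}\\ q^{B/N}+\sum_{n\geq1}b(n)q^{B/N+n}\\ q^{C/N}+\sum_{n\geq1}c(n)q^{C/N+n}\end{pmatrix}.$$ It is known that $a(n),b(n),c(n)\in\mathbb{Q}$. A component with rational Fourier coefficients is $p$-unbounded (for a prime $p$) if $p$ occurs to an arbitrarily high power in the denominators of its Fourier coefficients. A subgroup of $\Gamma$ is noncongruence if it contains no principal congruence subgroup $\Gamma(n)=\ker\left(SL_2(\mathbb{Z})\to SL_2(\mathbb{Z}/n\mathbb{Z})\right)$. *)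

(* Defs.v *)
(* The field of complex numbers is R[i], for an arbitrary R : realType. *)
From HB Require Import structures.
From mathcomp Require Import all_boot all_order all_algebra complex.
From mathcomp Require Import all_classical all_reals all_analysis.

Set Implicit Arguments.
Unset Strict Implicit.
Unset Printing Implicit Defensive.

Import Order.TTheory GRing.Theory Num.Theory.
Import numFieldNormedType.Exports.

Local Open Scope classical_set_scope.
Local Open Scope ring_scope.
Local Open Scope complex_scope.

Record SL2Z := MkSL2Z { slmx :> 'M[int]_2; slmx_det : \det slmx == 1 }.

HB.instance Definition _ := [isSub for slmx].
HB.instance Definition _ := [Choice of SL2Z by <:].

Lemma sl2_one_subproof : \det (1%:M : 'M[int]_2) == 1.
Proof. by rewrite det1. Qed.
Definition sl2_one := MkSL2Z sl2_one_subproof.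

Lemma sl2_mul_subproof (g h : SL2Z) : \det (slmx g *m slmx h) == 1.
Proof. by rewrite det_mulmx (eqP (slmx_det g)) (eqP (slmx_det h)) mulr1. Qed.
Definition sl2_mul (g h : SL2Z) := MkSL2Z (sl2_mul_subproof g h).

Lemma sl2_adjV (g : SL2Z) : \adj (slmx g) *m slmx g = 1%:M.
Proof. by rewrite mul_adj_mx (eqP (slmx_det g)). Qed.

Lemma sl2_adjVr (g : SL2Z) : slmx g *m \adj (slmx g) = 1%:M.
Proof. by rewrite mul_mx_adj (eqP (slmx_det g)). Qed.

Lemma sl2_inv_subproof (g : SL2Z) : \det (\adj (slmx g)) == 1.
Proof.
have := congr1 determinant (sl2_adjV g).
by rewrite det_mulmx (eqP (slmx_det g)) mulr1 det1 => ->.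
Qed.
Definition sl2_inv (g : SL2Z) := MkSL2Z (sl2_inv_subproof g).

Lemma sl2_mulA : associative sl2_mul.
Proof. by move=> x y z; apply: val_inj; rewrite /= mulmxA. Qed.
Lemma sl2_mul1 : left_id sl2_one sl2_mul.
Proof. by move=> x; apply: val_inj; rewrite /= mul1mx. Qed.
Lemma sl2_mulr1 : right_id sl2_one sl2_mul.
Proof. by move=> x; apply: val_inj; rewrite /= mulmx1. Qed.
Lemma sl2_mulV : left_inverse sl2_one sl2_inv sl2_mul.
Proof. by move=> x; apply: val_inj; rewrite /= sl2_adjV. Qed.
Lemma sl2_mulrV : right_inverse sl2_one sl2_inv sl2_mul.
Proof. by move=> x; apply: val_inj; rewrite /= sl2_adjVr. Qed.

HB.instance Definition _ :=
  isGroup.Build SL2Z sl2_mulA sl2_mul1 sl2_mulr1 sl2_mulV sl2_mulrV.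

(* T = (1 1; 0 1) *)
Lemma sl2_T_subproof :
  \det (\matrix_(i < 2, j < 2) (i <= j)%N%:R : 'M[int]_2) == 1.
Proof.
rewrite (expand_det_row _ ord0) !big_ord_recl big_ord0 /cofactor !det_mx11.
by rewrite !mxE.
Qed.
Definition sl2_T := MkSL2Z sl2_T_subproof.

Definition principal_congruence (n : nat) : set SL2Z :=
  [set g | forall i j : 'I_2, (g i j = (1%:M : 'M[int]_2) i j %[mod n%:Z])%Z].

Definition noncongruence (G : set SL2Z) : Prop :=
  ~ exists n : nat, (0 < n)%N /\ principal_congruence n `<=` G.

(* Group homomorphisms SL_2(Z) -> GL_m(K): invertibility of the rho g follows
   from the two equations. *)
Definition is_representation (K : fieldType) (m : nat) (rho : SL2Z -> 'M[K]_m)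
    : Prop :=
  rho 1%g = 1%:M /\ forall g h : SL2Z, rho (g * h)%g = rho g *m rho h.

(* rho acts on column vectors whereas the subspaces of mxalgebra are row
   spaces: the row space of U, transposed, ranges over the subspaces of K^m. *)
Definition irreducible_representation (K : fieldType) (m : nat)
    (rho : SL2Z -> 'M[K]_m) : Prop :=
  [/\ is_representation rho, (0 < m)%N &
      forall U : 'M[K]_m, (forall g, stablemx U (rho g)^T) ->
        \rank U = 0%N \/ \rank U = m].

Definition rep_kernel (K : fieldType) (m : nat) (rho : SL2Z -> 'M[K]_m)
    : set SL2Z := [set g | rho g = 1%:M].

(* Functions on the upper half-plane are represented by functions on R[i] of
   which only the values on upper_half are ever used. *)
Definition upper_half (R : realType) : set R[i] := [set t | 0 < complex.Im t].

Definition holomorphic_upper (R : realType) (f : R[i] -> R[i]) : Prop :=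
  forall t : R[i], upper_half t -> derivable (f : R[i]^o -> R[i]^o) t 1.

Definition cexp (R : realType) (z : R[i]) : R[i] :=
  (expR (complex.Re z))%:C * (cos (complex.Im z) +i* sin (complex.Im z)).

Definition e2pi (R : realType) (z : R[i]) : R[i] :=
  cexp ((2%:R * pi : R)%:C * 'i * z).

(* q^r for a rational exponent r *)
Definition qpow (R : realType) (r : rat) (t : R[i]) : R[i] := e2pi (ratr r * t).

Definition autfactor (R : realType) (g : SL2Z) (t : R[i]) : R[i] :=
  (g 1 0)%:~R * t + (g 1 1)%:~R.

Definition moebius (R : realType) (g : SL2Z) (t : R[i]) : R[i] :=
  ((g 0 0)%:~R * t + (g 0 1)%:~R) / autfactor g t.

Definition slash (R : realType) (k : int) (g : SL2Z) (f : R[i] -> R[i])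
    (t : R[i]) : R[i] := autfactor g t ^ (- k) * f (moebius g t).

(* The bound is uniform for x in bounded intervals. With a threshold depending
   on each single x the notion would be too weak to exclude essential
   singularities in q, as there are nonconstant entire functions that are
   bounded on every ray. *)
Definition growth_le (R : realType) (K : int) (f : R[i] -> R[i]) : Prop :=
  forall x0 x1 : R, exists Y : R, forall x y : R,
    x0 <= x <= x1 -> Y < y -> `|f (x +i* y)| < (y ^ K)%:C.

(* H(k, rho) *)
Definition vvmf (R : realType) (m : nat) (k : int) (rho : SL2Z -> 'M[R[i]]_m)
    : set (R[i] -> 'cV[R[i]]_m) :=
  [set F : R[i] -> 'cV[R[i]]_m |
    [/\ forall j, holomorphic_upper (fun t => F t j 0),
        forall (g : SL2Z) (t : R[i]), upper_half t -> forall j,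
          slash k g (fun t' => F t' j 0) t = (rho g *m F t) j 0 &
        exists K : int, forall j, growth_le K (fun t => F t j 0)]].

Definition vvmf_nonzero (R : realType) (m : nat) (k : int)
    (rho : SL2Z -> 'M[R[i]]_m) : Prop :=
  exists2 F, vvmf k rho F & exists2 t : R[i], upper_half t & F t != 0.

Definition minimal_weight (R : realType) (m : nat)
    (rho : SL2Z -> 'M[R[i]]_m) (k0 : int) : Prop :=
  vvmf_nonzero k0 rho /\ forall k : int, vvmf_nonzero k rho -> k0 <= k.

Definition spans_vvmf (R : realType) (m : nat) (k : int)
    (rho : SL2Z -> 'M[R[i]]_m) (F0 : R[i] -> 'cV[R[i]]_m) : Prop :=
  vvmf k rho F0 /\
  forall G, vvmf k rho G ->
    exists c : R[i], forall t, upper_half t -> G t = c *: F0 t.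

(* f = \sum_(n >= 0) a n * q^(r + n) *)
Definition has_qexp (R : realType) (f : R[i] -> R[i]) (r : rat)
    (a : nat -> R[i]) : Prop :=
  forall t : R[i], upper_half t ->
    series (fun n : nat => a n * qpow (r + n%:R) t : R[i]^o) @ \oo -->
      (f t : R[i]^o).

(* Growth of every f|_k g at infinity is holomorphy of f at every cusp. *)
Definition modular_form (R : realType) (G : set SL2Z) (k : int)
    (f : R[i] -> R[i]) : Prop :=
  [/\ holomorphic_upper f,
      forall g t, G g -> upper_half t -> slash k g f t = f t &
      forall g : SL2Z, exists K : int, growth_le K (slash k g f)].

Definition p_unbounded (R : realType) (p : nat) (a : nat -> R[i]) : Prop :=
  exists2 r : nat -> rat, (forall n, a n = ratr (r n)) &
    forall e : nat, exists n : nat, (p ^ e %| `|denq (r n)|)%N.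

(* Main.v *)
(* The relations S^2 = +-1 and STS = T^-1 S T^-1 with T = diag(a, b, -b) force the
   (0, 0) entry of rho(S) to vanish, so that rho is monomial, with roots of unity
   as entries, in the basis e, eS, eST of row vectors. Hence the image is finite,
   and the images of two matrices congruent to 1 mod 2 commute.

   If ker rho contained Gamma(n), conjugating T^2 by a matrix congruent to
   diag(u, u^-1) mod n would give N | 2 (u^2 - 1) for all u prime to 2 n, which
   bounds the prime powers dividing N.

   Put x = (4 B - A) / (3 N) and y = 2 (A - B) / (3 N). By the transformation law
   of E_2 the function E(t) = Delta(t)^x Delta(2 t)^y is multiplied by a constant
   under T and its translates under SL_2(Z) span a copy of rho, so E is the first
   component of a vector-valued form of weight k = 12 (x + y) >= k_0. If k > k_0,
   the quotient of the first component of F_0 by E would tend to 0 uniformly on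
   low horizontal lines, whereas its mean on each of them is 1. So k = k_0 and the
   first component of F_0 is E. A power of q^(-A/N) E has integral coefficients,
   but its logarithmic derivative is -24 x q + ..., where p divides the denominator
   of 24 x; by multiplicativity of the Gauss norm E is then p-unbounded. *)
Require Import Defs.
From HB Require Import structures.
From mathcomp Require Import all_boot all_order all_algebra complex.
From mathcomp Require Import all_classical all_reals all_analysis.
From mathcomp Require Import ring lra zify.

Set Implicit Arguments.
Unset Strict Implicit.
Unset Printing Implicit Defensive.

Import Order.TTheory GRing.Theory Num.Theory.
Import numFieldNormedType.Exports.

Local Open Scope classical_set_scope.
Local Open Scope ring_scope.
Local Open Scope complex_scope.

(** * Complex sequences and series *)
Section ComplexSeries.
Variable R : realType.
Implicit Types (z w : R[i]) (u v : nat -> R[i]) (x y : R).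

(** The vector e of the overview is an eigenvector of Gamma_0(2), so the first component of any form
    for [rho] is a scalar form with character on Gamma_0(2), a group with two cusps. The exponents x
    and y give E the leading exponent A / N at one cusp and B / N at the other: x + 2 y = A / N and
    x + y / 2 = B / N. The relations between S and T force N | 4 (A + 2 B), which makes the weight
    12 (x + y) an integer.

    Rational powers of Delta are defined with no logarithm: Delta^x is q^x times the formal
    exponential of x times the logarithmic derivative of Delta / q. Hence Delta^x has the inverse
    Delta^(-x), never vanishes, and its logarithmic derivative is 2 pi i x E_2. The law of E_2 comes
    from a conditionally convergent double sum, made absolutely convergent by subtracting
    telescoping terms.

    Contour integrals are avoided: means over roots of unity extract coefficients, and dominated
    convergence of series ([tannery]) justifies the interchanges of limits. *)

Definition cnorm z : R := complex.Re `|z|.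

Lemma cnormE z : `|z| = (cnorm z)%:C.
Proof. by rewrite /cnorm normc_def. Qed.

Lemma cnorm_sqrt z :
  cnorm z = Num.sqrt (complex.Re z ^+ 2 + complex.Im z ^+ 2).
Proof. by rewrite /cnorm normc_def. Qed.

Lemma cnorm_ge0 z : 0 <= cnorm z.
Proof. by rewrite cnorm_sqrt sqrtr_ge0. Qed.

Lemma cnorm_sq z : cnorm z ^+ 2 = complex.Re z ^+ 2 + complex.Im z ^+ 2.
Proof. by rewrite cnorm_sqrt sqr_sqrtr // addr_ge0 ?sqr_ge0. Qed.

Lemma cnorm0 : cnorm 0 = 0.
Proof. by rewrite /cnorm normr0. Qed.

Lemma cnorm1 : cnorm 1 = 1.
Proof. by rewrite /cnorm normr1. Qed.

Lemma cnormN z : cnorm (- z) = cnorm z.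
Proof. by rewrite /cnorm normrN. Qed.

Lemma cnormBC z w : cnorm (z - w) = cnorm (w - z).
Proof. by rewrite /cnorm distrC. Qed.

Lemma cnormM z w : cnorm (z * w) = cnorm z * cnorm w.
Proof.
by apply: (@complexI R); rewrite -cnormE normrM !cnormE -rmorphM.
Qed.

Lemma cnormX z n : cnorm (z ^+ n) = cnorm z ^+ n.
Proof.
by elim: n => [|n IH]; rewrite ?expr0 ?cnorm1 // !exprS cnormM IH.
Qed.

Lemma cnorm_eq0 z : (cnorm z == 0) = (z == 0).
Proof.
rewrite -[RHS]normr_eq0 cnormE; apply/eqP/eqP => [-> // | /eqP].
by rewrite -(rmorph0 (real_complex R)) => /eqP/complexI.
Qed.

Lemma cnorm_gt0 z : (0 < cnorm z) = (z != 0).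
Proof. by rewrite lt_def cnorm_ge0 andbT cnorm_eq0. Qed.

Lemma cnormV z : cnorm z^-1 = (cnorm z)^-1.
Proof.
have [->|nz] := eqVneq z 0; first by rewrite invr0 cnorm0 invr0.
have h : cnorm z != 0 by rewrite cnorm_eq0.
by apply: (mulfI h); rewrite -cnormM !divff // cnorm1.
Qed.

Lemma cnormD z w : cnorm (z + w) <= cnorm z + cnorm w.
Proof. by rewrite -lecR rmorphD -!cnormE ler_normD. Qed.

Lemma cnormB z w : cnorm (z - w) <= cnorm z + cnorm w.
Proof. by rewrite -(cnormN w) cnormD. Qed.

Lemma cnorm_subr z w : cnorm z - cnorm w <= cnorm (z - w).
Proof. by have := cnormD (z - w) w; rewrite subrK; lra. Qed.

Lemma cnorm_real x : cnorm x%:C = `|x|.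
Proof. by rewrite cnorm_sqrt /= expr0n addr0 sqrtr_sqr. Qed.

Lemma cnorm_nat n : cnorm n%:R = n%:R.
Proof. by rewrite -(rmorph_nat (real_complex R)) cnorm_real ger0_norm. Qed.

Lemma cnorm_Re z : `|complex.Re z| <= cnorm z.
Proof.
rewrite cnorm_sqrt -sqrtr_sqr ler_sqrt ?addr_ge0 ?sqr_ge0 //.
by rewrite lerDl sqr_ge0.
Qed.

Lemma cnorm_Im z : `|complex.Im z| <= cnorm z.
Proof.
rewrite cnorm_sqrt -sqrtr_sqr ler_sqrt ?addr_ge0 ?sqr_ge0 //.
by rewrite lerDr sqr_ge0.
Qed.

Lemma cnorm_ReIm z : cnorm z <= `|complex.Re z| + `|complex.Im z|.
Proof.
rewrite -(@ler_pXn2r _ 2) ?nnegrE ?cnorm_ge0 ?addr_ge0 //.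
rewrite cnorm_sq sqrrD !real_normK ?num_real //.
by rewrite lerD2r lerDl mulrn_wge0 // mulr_ge0.
Qed.

Lemma cnorm_sum (I : Type) (s : seq I) (P : pred I) (f : I -> R[i]) :
  cnorm (\sum_(i <- s | P i) f i) <= \sum_(i <- s | P i) cnorm (f i).
Proof.
elim/big_rec2: _ => [|i y x _ h]; first by rewrite cnorm0.
exact: le_trans (cnormD _ _) (lerD _ _).
Qed.

(** The epsilons of the topology of [R[i]] are themselves complex numbers; real ones keep the
    estimates inside an ordered field. *)
Definition cvC u z := forall e : R, 0 < e ->
  exists n0, forall n, (n0 <= n)%N -> cnorm (u n - z) < e.

Lemma cvCP u z : cvC u z <-> (u @ \oo --> (z : R[i]^o)).
Proof.
split=> [h|h e e0].
  apply/(@cvgrPdist_lt R[i] R[i]^o) => e; rewrite ltcE => /andP[/eqP /= ie re].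
  have [n0 hn] := h _ re; exists n0 => // n /= /hn.
  by rewrite cnormBC cnormE ltcE /= ie eqxx.
have e0' : 0 < e%:C by rewrite ltcR.
move/(@cvgrPdist_lt R[i] R[i]^o): h => /(_ _ e0') [n0 _ hn]; exists n0 => n /hn /=.
by rewrite cnormBC cnormE ltcR.
Qed.

Lemma cvC_cst z : cvC (fun=> z) z.
Proof. by move=> e e0; exists 0%N => n _; rewrite subrr cnorm0. Qed.

Lemma cvC_ext u v z : (forall n, u n = v n) -> cvC u z -> cvC v z.
Proof. by move=> h; have -> : u = v by apply/funext. Qed.

Lemma cvC_near u v z n1 :
  (forall n, (n1 <= n)%N -> u n = v n) -> cvC u z -> cvC v z.
Proof.
move=> h cu e /cu[n0 hn]; exists (maxn n0 n1) => n; rewrite geq_max => /andP[a b].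
by rewrite -h //; apply: hn.
Qed.

Lemma cvC_sub u z (s : nat -> nat) :
  (forall n, (n <= s n)%N) -> cvC u z -> cvC (u \o s) z.
Proof.
move=> h cu e /cu[n0 hn]; exists n0 => n le; apply: hn; exact: leq_trans (h n).
Qed.

Lemma cvCD u v z w : cvC u z -> cvC v w -> cvC (fun n => u n + v n) (z + w).
Proof.
by move=> /cvCP h1 /cvCP h2; apply/cvCP; exact: (@cvgD R[i] R[i]^o nat _ _ u v z w h1 h2).
Qed.

Lemma cvCN u z : cvC u z -> cvC (fun n => - u n) (- z).
Proof. by move=> h e /h[n0 hn]; exists n0 => n /hn; rewrite -opprD cnormN. Qed.

Lemma cvCB u v z w : cvC u z -> cvC v w -> cvC (fun n => u n - v n) (z - w).
Proof. by move=> h1 h2; apply: cvCD => //; exact: cvCN. Qed.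

Lemma cvCM u v z w : cvC u z -> cvC v w -> cvC (fun n => u n * v n) (z * w).
Proof.
by move=> /cvCP h1 /cvCP h2; apply/cvCP; exact: (@cvgM R[i] nat _ _ u v z w h1 h2).
Qed.

Lemma cvCZ u z w : cvC u z -> cvC (fun n => w * u n) (w * z).
Proof. by move=> h; apply: cvCM => //; exact: cvC_cst. Qed.

Lemma cvCV u z : z != 0 -> cvC u z -> cvC (fun n => (u n)^-1) z^-1.
Proof.
move=> nz /cvCP h; apply/cvCP; exact: (@cvgV R[i] nat _ _ u z nz h).
Qed.

Lemma cvC_unique u z w : cvC u z -> cvC u w -> z = w.
Proof.
move=> h1 h2; apply/eqP; rewrite -subr_eq0 -cnorm_eq0; apply/eqP.
apply/le_anti; rewrite cnorm_ge0 andbT; apply/ler_addgt0Pr => e e0.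
have [n1 H1] := h1 _ (divr_gt0 e0 (ltr0Sn _ 1)).
have [n2 H2] := h2 _ (divr_gt0 e0 (ltr0Sn _ 1)).
have := H1 (maxn n1 n2) (leq_maxl _ _); have := H2 (maxn n1 n2) (leq_maxr _ _).
have := cnormB (u (maxn n1 n2) - w) (u (maxn n1 n2) - z).
have -> : u (maxn n1 n2) - w - (u (maxn n1 n2) - z) = z - w by ring.
lra.
Qed.

Lemma cvC_le u z B : (forall n, cnorm (u n) <= B) -> cvC u z -> cnorm z <= B.
Proof.
move=> h cu; apply/ler_addgt0Pr => e /cu[n0 /(_ n0 (leqnn _)) hn].
have := cnorm_subr z (u n0); have := h n0; rewrite cnormBC; lra.
Qed.

Lemma cvC_squeeze u z (b : nat -> R) :
  (forall n, cnorm (u n - z) <= b n) -> (b @ \oo --> (0 : R)) -> cvC u z.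
Proof.
move=> h /cvgrPdist_lt hb e /hb[n0 _ hn]; exists n0 => n /hn /=.
rewrite sub0r normrN => hn'; apply: le_lt_trans (h n) _.
exact: le_lt_trans (ler_norm _) hn'.
Qed.

Definition psum u n : R[i] := \sum_(i < n) u i.
Definition hsum u z := cvC (psum u) z.
(** For nonnegative [b] this is summability together with a bound for the sum, with no limit to
    name. *)
Definition rbound (b : nat -> R) B := forall n, \sum_(i < n) b i <= B.

Lemma psumS u n : psum u n.+1 = psum u n + u n.
Proof. by rewrite /psum big_ord_recr. Qed.

Lemma hsum_unique u z w : hsum u z -> hsum u w -> z = w.
Proof. exact: cvC_unique. Qed.

Lemma hsum_ext u v z : (forall n, u n = v n) -> hsum u z -> hsum v z.
Proof. by move=> h; have -> : u = v by apply/funext. Qed.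

Lemma hsumD u v z w : hsum u z -> hsum v w -> hsum (fun n => u n + v n) (z + w).
Proof.
move=> h1 h2; apply: cvC_ext (cvCD h1 h2) => n.
by rewrite /psum big_split.
Qed.

Lemma hsumZ u z w : hsum u z -> hsum (fun n => w * u n) (w * z).
Proof.
by move=> h; apply: cvC_ext (cvCZ w h) => n; rewrite /psum mulr_sumr.
Qed.

Lemma hsumN u z : hsum u z -> hsum (fun n => - u n) (- z).
Proof.
by move=> h; apply: cvC_ext (cvCN h) => n; rewrite /psum sumrN.
Qed.

Lemma hsumB u v z w : hsum u z -> hsum v w -> hsum (fun n => u n - v n) (z - w).
Proof. by move=> h1 h2; apply: hsumD => //; exact: hsumN. Qed.

Lemma hsum0 : hsum (fun=> 0) 0.
Proof.
by apply: cvC_ext (cvC_cst 0) => n; rewrite /psum big1.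
Qed.

Lemma hsum_fsum (I : Type) (s : seq I) (f : I -> nat -> R[i]) (g : I -> R[i]) :
  (forall i, hsum (f i) (g i)) ->
  hsum (fun n => \sum_(i <- s) f i n) (\sum_(i <- s) g i).
Proof.
move=> h; elim: s => [|i s IH].
  by rewrite big_nil; apply: hsum_ext hsum0 => n; rewrite big_nil.
by rewrite big_cons; apply: hsum_ext (hsumD (h i) IH) => n; rewrite big_cons.
Qed.

Lemma hsum_fin u k : (forall n, (k <= n)%N -> u n = 0) -> hsum u (psum u k).
Proof.
move=> h; apply: (@cvC_near (fun=> psum u k) _ _ k) (cvC_cst _) => n le.
rewrite -(subnKC le); elim: (n - k)%N => [|m IH]; rewrite ?addn0 //.
by rewrite addnS psumS -IH h ?addr0 // leq_addr.
Qed.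

Lemma hsum_term u z : hsum u z -> cvC u 0.
Proof.
move=> h; have h' : hsum u z := h.
rewrite -(subrr z); apply: (@cvC_ext (fun n => psum u n.+1 - psum u n)).
  by move=> n; rewrite psumS; ring.
by apply: cvCB => //; exact: (cvC_sub (s := S)).
Qed.

Lemma rbound_le (b c : nat -> R) B :
  (forall n, c n <= b n) -> rbound b B -> rbound c B.
Proof. by move=> h hb n; apply: le_trans (hb n); exact: ler_sum. Qed.

Lemma rbound_tail (b : nat -> R) B : (forall n, 0 <= b n) -> rbound b B ->
  forall e, 0 < e -> exists k, forall n, \sum_(k <= i < n) b i < e.
Proof.
move=> b0 hB e e0.
have nd : {homo (fun n => \sum_(i < n) b i) : n m / (n <= m)%N >-> n <= m}.
  move=> n m le; rewrite -(subnKC le); elim: (m - n)%N => [|p IH]; rewrite ?addn0 //.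
  by rewrite addnS big_ord_recr /=; apply: le_trans IH _; rewrite lerDl.
have bd : has_ubound (range (fun n => \sum_(i < n) b i)).
  by exists B => _ [n _ <-].
have /cvgrPdist_lt /(_ _ e0) [k _ hk] := nondecreasing_is_cvgn nd bd.
have lim_ge n : \sum_(i < n) b i <= limn (fun n => \sum_(i < n) b i).
  exact: nondecreasing_cvgn_le nd (nondecreasing_is_cvgn nd bd) n.
exists k => n; have [le|lt] := leqP n k; first by rewrite big_geq.
have := hk k (leqnn k); have := lim_ge n; rewrite /=.
rewrite -!(big_mkord xpredT b) (big_cat_nat (leq0n k) (ltnW lt)) /=.
have := ler_norm (limn (fun n => \sum_(i < n) b i) - \sum_(0 <= i < k) b i).
lra.
Qed.

Lemma psum_tail u k n : (k <= n)%N ->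
  psum u n - psum u k = \sum_(k <= i < n) u i.
Proof.
move=> le; rewrite /psum -!(big_mkord xpredT u) (big_cat_nat (leq0n k) le) /=.
by rewrite [LHS]addrC addKr.
Qed.

Lemma real_abs_cvg (x : nat -> R) B : rbound (fun n => `|x n|) B ->
  cvgn (series x).
Proof.
move=> h; apply: (@normed_cvg R R^o).
have -> : [normed series (x : nat -> R^o)] = (fun n => \sum_(i < n) `|x i|).
  by apply/funext => n; rewrite /normed_series_of /series /= big_mkord.
apply: nondecreasing_is_cvgn; last by exists B => _ [n _ <-].
move=> n m le; rewrite -(subnKC le); elim: (m - n)%N => [|p IH]; rewrite ?addn0 //.
by rewrite addnS big_ord_recr /=; apply: le_trans IH _; rewrite lerDl.
Qed.

(** Completeness is taken from the reals: real and imaginary parts converge absolutely. *)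
Lemma hsum_abs u B : rbound (fun n => cnorm (u n)) B ->
  exists2 z, hsum u z & cnorm z <= B.
Proof.
move=> h.
have hr : cvgn (series (fun n => complex.Re (u n))).
  by apply: (@real_abs_cvg _ B); apply: rbound_le h => n; exact: cnorm_Re.
have hi : cvgn (series (fun n => complex.Im (u n))).
  by apply: (@real_abs_cvg _ B); apply: rbound_le h => n; exact: cnorm_Im.
set a := limn _ in hr; set b := limn _ in hi.
have hs : hsum u (a +i* b).
  move=> e e0; have e2 : 0 < e / 2 by rewrite divr_gt0.
  move/cvgrPdist_lt: (hr) => /(_ _ e2) [n1 _ h1].
  move/cvgrPdist_lt: (hi) => /(_ _ e2) [n2 _ h2].
  exists (maxn n1 n2) => n; rewrite geq_max => /andP[l1 l2].
  have := h1 n l1; have := h2 n l2; rewrite !seriesEord /= => h2' h1'.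
  apply: le_lt_trans (cnorm_ReIm _) _; rewrite [ltRHS](splitr e).
  have Reb : complex.Re (psum u n - (a +i* b)) = \sum_(i < n) complex.Re (u i) - a.
    by rewrite /psum !raddfB /= raddf_sum.
  have Imb : complex.Im (psum u n - (a +i* b)) = \sum_(i < n) complex.Im (u i) - b.
    by rewrite /psum !raddfB /= raddf_sum.
  by rewrite Reb Imb distrC [X in _ + X]distrC ltrD.
exists (a +i* b) => //; apply: cvC_le hs => n.
exact: le_trans (cnorm_sum _ _ _) (h n).
Qed.

Lemma hsum_le u z (b : nat -> R) B :
  (forall n, cnorm (u n) <= b n) -> rbound b B -> hsum u z -> cnorm z <= B.
Proof.
move=> h hB; apply: cvC_le => n; apply: le_trans (cnorm_sum _ _ _) _.
by apply: le_trans (hB n); exact: ler_sum.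
Qed.

(** Dominated convergence for series. The common majorant [b] makes all tails beyond some k
    uniformly small, and the finite heads converge term by term. *)
Lemma tannery (U : nat -> nat -> R[i]) (b : nat -> R) B v (s : nat -> R[i]) :
  (forall N m, cnorm (U N m) <= b m) -> rbound b B ->
  (forall m, cvC (U^~ m) (v m)) -> (forall N, hsum (U N) (s N)) ->
  exists2 z, hsum v z & cvC s z.
Proof.
move=> hb hB hv hs.
have b0 m : 0 <= b m by exact: le_trans (cnorm_ge0 _) (hb 0%N m).
have hvb m : cnorm (v m) <= b m by apply: cvC_le (hv m).
have [z hz _] := hsum_abs (rbound_le hvb hB).
exists z => // e e0; have e4 : 0 < e / 4 by rewrite divr_gt0.
have [k hk] := rbound_tail b0 hB e4.
(* Used twice: for the rows [U n] and for the limit row [v]. *)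
have tl (p : nat -> R[i]) t : (forall m, cnorm (p m) <= b m) -> hsum p t ->
    cnorm (t - psum p k) <= e / 4.
  move=> hw ht.
  apply: (@cvC_le (fun n => psum p (n + k)%N - psum p k)) => [n|].
    rewrite psum_tail ?leq_addl //; apply: le_trans (cnorm_sum _ _ _) _.
    by apply: ltW; apply: le_lt_trans (hk (n + k)%N); exact: ler_sum.
  apply: cvCB; last exact: cvC_cst.
  by apply: (@cvC_sub (psum p) t (fun n => n + k)%N) => // n; rewrite leq_addr.
have fs : cvC (fun N => psum (U N) k) (psum v k).
  elim: (k) => [|j IH].
    by apply: cvC_ext (cvC_cst _) => n; rewrite /psum !big_ord0.
  by rewrite psumS; apply: cvC_ext (cvCD IH (hv j)) => n; rewrite psumS.
have [n0 hn0] := fs _ e4; exists n0 => n /hn0 h1.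
have := tl _ _ (hb n) (hs n); have := tl _ _ hvb hz.
have -> : s n - z = (s n - psum (U n) k) + (psum (U n) k - psum v k)
  - (z - psum v k) by ring.
have := cnormB (s n - psum (U n) k + (psum (U n) k - psum v k)) (z - psum v k).
have := cnormD (s n - psum (U n) k) (psum (U n) k - psum v k).
lra.
Qed.

End ComplexSeries.

(** * The complex exponential *)
Section ComplexExp.
Variable R : realType.
Implicit Types (z w t : R[i]) (x y : R).

(** The bounds for sine and cosine form a ladder: each one bounds the derivative needed for the
    next. *)
Lemma mvt_bound (f df : R -> R) (g y : R) :
  (forall x, is_derive x 1 f (df x)) ->
  (forall x, `|x| <= `|y| -> `|df x| <= g) -> `|f y - f 0| <= g * `|y|.
Proof.
move=> hf hg.
have cf (a b : R) : {within `[a, b], continuous f}.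
  apply: derivable_within_continuous => x _; exact: ex_derive.
have [y0|/ltW y0] := leP 0 y.
  have [c] := MVT_segment y0 (fun x _ => hf x) (cf _ _).
  rewrite in_itv /= => /andP[c0 cy] ->; rewrite subr0 normrM.
  by rewrite ler_wpM2r // hg // !ger0_norm.
have [c] := MVT_segment y0 (fun x _ => hf x) (cf _ _).
rewrite in_itv /= => /andP[c0 cy]; rewrite distrC => ->; rewrite sub0r normrM normrN.
by rewrite ler_wpM2r // hg // !ler0_norm // lerN2.
Qed.

Lemma sin_bound y : `|sin y| <= `|y|.
Proof.
rewrite -[sin y]subr0 -[in X in `|_ - X|]sin0 -[leRHS]mul1r.
by apply: (mvt_bound (df := cos)) => x _; exact: cos_max.
Qed.

Lemma cos_bound y : `|cos y - 1| <= y ^+ 2.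
Proof.
rewrite -[X in `|_ - X|]cos0 -real_normK ?num_real // expr2.
apply: (mvt_bound (df := fun x => - sin x)) => x h.
by rewrite normrN; apply: le_trans (sin_bound x) h.
Qed.

Lemma cos_bound1 y : `|cos y - 1| <= `|y|.
Proof.
rewrite -[X in `|_ - X|]cos0 -[leRHS]mul1r.
by apply: (mvt_bound (df := fun x => - sin x)) => x _; rewrite normrN sin_max.
Qed.

Lemma sin_sub_bound y : `|sin y - y| <= y ^+ 2.
Proof.
have -> : sin y - y = (sin y - y) - (sin 0 - 0) by rewrite sin0 subr0 subr0.
rewrite -real_normK ?num_real // expr2.
apply: (mvt_bound (f := fun x => sin x - x) (df := fun x => cos x - 1)) => x h.
by apply: le_trans (cos_bound1 x) h.
Qed.

(** Everything follows from [1 + x <= expR x], taken at x and at -x. *)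
Lemma expR_sub1_bound x : `|expR x - 1| <= `|x| * expR `|x|.
Proof.
have h1 := expR_ge1Dx x; have h2 := expR_ge1Dx (- x).
have e0 := expR_gt0 x; have eN : expR x * expR (- x) = 1 by rewrite expRxMexpNx_1.
have : expR x * (1 - x) <= 1 by rewrite -[leRHS]eN ler_pM2l.
have [x0|/ltW x0] := leP 0 x => h3.
  rewrite !ger0_norm //; [nra|lra].
have e1 : 1 <= expR `|x| by rewrite -expR0 ler_expR.
have ex : expR x <= 1 by rewrite -expR0 ler_expR.
have nx := ler0_norm x0; rewrite nx in e1 *.
have -> : `|expR x - 1| = - (expR x - 1) by rewrite ler0_norm ?subr_le0.
nra.
Qed.

Lemma expR_sub1x_bound x : `|expR x - 1 - x| <= x ^+ 2 * expR `|x|.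
Proof.
have h1 := expR_ge1Dx x; have h4 := expR_sub1_bound x.
have e0 := expR_gt0 x; have eN : expR x * expR (- x) = 1 by rewrite expRxMexpNx_1.
have h2 := expR_ge1Dx (- x).
have h3 : expR x * (1 - x) <= 1 by rewrite -[leRHS]eN ler_pM2l.
rewrite ger0_norm; last by nra.
apply: (@le_trans _ _ (`|x| * `|expR x - 1|)).
  by rewrite -normrM; apply: le_trans (ler_norm _); lra.
by rewrite -real_normK ?num_real // expr2 -mulrA ler_wpM2l.
Qed.

Lemma cexpD z w : cexp (z + w) = cexp z * cexp w.
Proof.
rewrite /cexp !raddfD /= expRD cosD sinD.
case: z w => a b [c d] /=; apply/eqP; rewrite eq_complex /=.
by apply/andP; split; apply/eqP; ring.
Qed.

Lemma cexp0 : cexp 0 = 1 :> R[i].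
Proof.
by rewrite /cexp /= expR0 cos0 sin0; apply/eqP; rewrite eq_complex /=; apply/andP; split; apply/eqP; ring.
Qed.

Lemma cnorm_cexp z : cnorm (cexp z) = expR (complex.Re z).
Proof.
rewrite /cexp cnormM cnorm_real ger0_norm ?expR_ge0 //.
by rewrite cnorm_sqrt /= cos2Dsin2 sqrtr1 mulr1.
Qed.

(** The quadratic remainder that yields both the scaled limits behind the cotangent expansion and
    the complex derivatives of q-series. The constant 4 is crude. *)
Lemma cexp_bound z :
  cnorm (cexp z - 1 - z) <= 4 * cnorm z ^+ 2 * expR (cnorm z).
Proof.
have hx := cnorm_Re z; have hy := cnorm_Im z.
case: z hx hy => x y /= hx hy; set r := cnorm _ in hx hy *.
have ex : expR `|x| <= expR r by rewrite ler_expR.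
have r0 : 0 <= r by exact: cnorm_ge0.
have e1 : 1 <= expR r by rewrite -expR0 ler_expR.
have xx : x ^+ 2 <= r ^+ 2 by rewrite -real_normK ?num_real // lerXn2r ?nnegrE.
have yy : y ^+ 2 <= r ^+ 2 by rewrite -real_normK ?num_real // lerXn2r ?nnegrE.
have -> : cexp (x +i* y) - 1 - (x +i* y) =
  (expR x)%:C * ((cos y - 1) +i* (sin y - y)) + (expR x - 1 - x)%:C
    + (0 +i* (y * (expR x - 1))).
  rewrite /cexp /=; apply/eqP; rewrite eq_complex /=.
  by apply/andP; split; apply/eqP; ring.
have h1 : cnorm ((cos y - 1) +i* (sin y - y)) <= 2 * r ^+ 2.
  apply: le_trans (cnorm_ReIm _) _ => /=.
  have := cos_bound y; have := sin_sub_bound y; lra.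
have h2 : cnorm (0 +i* (y * (expR x - 1))) <= r ^+ 2 * expR r.
  apply: le_trans (cnorm_ReIm _) _ => /=; rewrite normr0 add0r normrM expr2 -mulrA.
  apply: ler_pM => //; apply: le_trans (expR_sub1_bound x) _.
  by apply: ler_pM; rewrite ?expR_ge0.
have h3 : cnorm (expR x - 1 - x)%:C <= r ^+ 2 * expR r.
  rewrite cnorm_real; apply: le_trans (expR_sub1x_bound x) _.
  by apply: ler_pM; rewrite ?sqr_ge0 ?expR_ge0.
have h4 : cnorm ((expR x)%:C * ((cos y - 1) +i* (sin y - y))) <= 2 * r ^+ 2 * expR r.
  rewrite cnormM cnorm_real ger0_norm ?expR_ge0 // mulrC.
  apply: ler_pM; rewrite ?cnorm_ge0 ?expR_ge0 //.
  by apply: le_trans ex; rewrite ler_expR ler_norm.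
apply: le_trans (cnormD _ _) _; apply: le_trans (lerD (cnormD _ _) (lexx _)) _.
lra.
Qed.

Lemma e2piD z w : e2pi (z + w) = e2pi z * e2pi w.
Proof. by rewrite /e2pi mulrDr cexpD. Qed.

Lemma e2pi0 : e2pi 0 = 1 :> R[i].
Proof. by rewrite /e2pi mulr0 cexp0. Qed.

Lemma e2piN z : e2pi (- z) = (e2pi z)^-1.
Proof.
have h : e2pi (- z) * e2pi z = 1 by rewrite -e2piD addNr e2pi0.
have nz : e2pi z != 0.
  by apply/eqP => h0; move: h; rewrite h0 mulr0 => /eqP; rewrite eq_sym oner_eq0.
by apply: (mulIf nz); rewrite mulVf.
Qed.

Lemma cnorm_e2pi z : cnorm (e2pi z) = expR (- (2 * pi * complex.Im z)).
Proof.
rewrite /e2pi cnorm_cexp; congr expR; case: z => a b /=; ring.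
Qed.

Lemma e2pi_neq0 z : e2pi z != 0.
Proof. by rewrite -cnorm_eq0 cnorm_e2pi gt_eqF ?expR_gt0. Qed.

Lemma e2pi_half : e2pi (2^-1 : R[i]) = -1.
Proof.
have -> : (2^-1 : R[i]) = (2^-1 : R)%:C by rewrite fmorphV rmorph_nat.
rewrite /e2pi /cexp /=.
have -> : (2 * pi * 0 - 0 * 1) * 2^-1 - (2 * pi * 1 + 0 * 0) * 0 = 0 :> R by ring.
have -> : (2 * pi * 0 - 0 * 1) * 0 + (2 * pi * 1 + 0 * 0) * 2^-1 = pi :> R by field.
rewrite expR0 cospi sinpi mul1r; apply/eqP; rewrite eq_complex /=.
by rewrite oppr0 !eqxx.
Qed.

Lemma e2pi1 : e2pi 1 = 1 :> R[i].
Proof.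
have -> : (1 : R[i]) = 2^-1 + 2^-1 by field.
by rewrite e2piD e2pi_half mulrNN mulr1; field.
Qed.

Lemma e2piM n z : e2pi (n%:R * z) = e2pi z ^+ n.
Proof.
elim: n => [|n IH]; first by rewrite mul0r e2pi0.
by rewrite -natr1 mulrDl mul1r e2piD IH exprSr.
Qed.

Lemma e2pi_nat n : e2pi n%:R = 1 :> R[i].
Proof. by rewrite -[n%:R]mulr1 e2piM e2pi1 expr1n. Qed.

Lemma e2pi_addn z n : e2pi (z + n%:R) = e2pi z.
Proof. by rewrite e2piD e2pi_nat mulr1. Qed.

Lemma e2pi_bound z : cnorm (e2pi z - 1 - (2 * pi)%:C * 'i * z) <=
  4 * (2 * pi * cnorm z) ^+ 2 * expR (2 * pi * cnorm z).
Proof.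
have e : cnorm ((2 * pi)%:C * 'i * z) = 2 * pi * cnorm z.
  rewrite !cnormM cnorm_real ger0_norm; last by rewrite mulr_ge0 // pi_ge0.
  congr (_ * _); rewrite -[RHS]mulr1; congr (_ * _).
  by rewrite cnorm_sqrt /= expr0n /= expr1n add0r sqrtr1.
by rewrite -e /e2pi; exact: cexp_bound.
Qed.

End ComplexExp.

(** * Partial fractions of the cotangent *)
Section PartialFractions.
Variable R : realType.
Implicit Types (z w t u v : R[i]) (x y : R).

Lemma cos_quarter_ge x : `|x| <= pi / 4 -> 2^-1 <= cos x.
Proof.
rewrite ler_norml => /andP[h1 h2].
have p0 := pi_ge0 R.
have c2 : 0 <= cos (x *+ 2) by apply: cos_ge0_pihalf; rewrite -[x *+ 2]mulr_natr; apply/andP; split; lra.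
have c1 : 0 <= cos x by apply: cos_ge0_pihalf; apply/andP; split; lra.
rewrite cos_mulr2n -[_ *+ 2]mulr_natr in c2; nra.
Qed.

(** The mean value theorem is applied on [0, x / 2], where the cosine is at least 1/2; duplication
    then reaches x. *)
Lemma sin_lower x : 0 <= x <= pi / 2 -> x / 4 <= sin x.
Proof.
move=> /andP[x0 x1].
have cf (a b : R) : {within `[a, b], continuous (@sin R)}.
  apply: derivable_within_continuous => y _; exact: derivable_sin.
have h0 : 0 <= x / 2 by rewrite divr_ge0.
have [c] := MVT_segment h0 (fun y _ => is_derive_sin y) (cf _ _).
rewrite in_itv /= => /andP[c0 cx]; rewrite sin0 !subr0 => hs.
have hc : 2^-1 <= cos c by apply: cos_quarter_ge; rewrite ger0_norm //; lra.
have hh : 2^-1 <= cos (x / 2) by apply: cos_quarter_ge; rewrite ger0_norm //; lra.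
have hs2 : x / 4 <= sin (x / 2) by rewrite hs; nra.
have -> : sin x = (cos (x / 2) * sin (x / 2)) *+ 2.
  by rewrite -sin_mulr2n; congr sin; rewrite -[_ *+ 2]mulr_natr; field.
by rewrite -[_ *+ 2]mulr_natr; nra.
Qed.

Lemma sin_pi_lower x : `|x| <= 2^-1 -> (x * pi / 4) ^+ 2 <= sin (pi * x) ^+ 2.
Proof.
move=> hx; have p0 := pi_ge0 R.
have hy (y : R) : 0 <= y <= 2^-1 -> (y * pi / 4) ^+ 2 <= sin (pi * y) ^+ 2.
  move=> /andP[y0 y1]; have := @sin_lower (pi * y).
  have h : 0 <= pi * y <= pi / 2 by apply/andP; split; nra.
  move=> /(_ h) => h'; rewrite lerXn2r ?nnegrE //.
  - by rewrite divr_ge0 // mulr_ge0.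
  - by apply: le_trans h'; rewrite divr_ge0 // mulr_ge0.
  - by rewrite (mulrC y).
move: hx; rewrite ler_norml => /andP[h1 h2].
have [x0|/ltW x0] := leP 0 x; first by apply: hy; rewrite x0.
have := hy (- x); rewrite mulrN sinN sqrrN => /(_ _) h.
have -> : x * pi / 4 = - (- x * pi / 4) by ring.
by rewrite sqrrN; apply: h; rewrite oppr_ge0 x0 /=; lra.
Qed.

Lemma e2piE x y :
  e2pi (x +i* y) = (expR (- (2 * pi * y)))%:C * (cos (2 * pi * x) +i* sin (2 * pi * x)).
Proof.
rewrite /e2pi /cexp /=; congr (_%:C * _).
  by congr expR; ring.
by congr (_ +i* _); congr (_ _); ring.
Qed.

(** In this strip 0 is the only zero of [1 - e2pi z], and it is simple. With z = a + i b and r =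
    |e2pi z|, the squared modulus is (1 - r)^2 + 4 r sin^2(pi a): the first term controls b and the
    second controls a. *)
Lemma one_sub_e2pi_lower z Y : `|complex.Re z| <= 2^-1 -> `|complex.Im z| <= Y ->
  expR (- (2 * pi * Y)) * cnorm z <= cnorm (1 - e2pi z).
Proof.
case: z => a b /= ha hb; set rho := expR _.
have p2 := pi_ge2 R.
have rho0 : 0 < rho by exact: expR_gt0.
have Y0 : 0 <= Y by apply: le_trans hb.
have rho1 : rho <= 1 by rewrite -expR0 ler_expR oppr_le0 !mulr_ge0 // ?pi_ge0.
rewrite -(@ler_pXn2r _ 2) ?nnegrE ?mulr_ge0 ?cnorm_ge0 ?(ltW rho0) // exprMn !cnorm_sq.
rewrite e2piE /=; set r := expR _.
have r0 : 0 < r by exact: expR_gt0.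
have hr : rho <= r.
  rewrite ler_expR lerN2 ler_wpM2l ?mulr_ge0 ?pi_ge0 //.
  exact: le_trans (ler_norm _) hb.
set C := cos _; set S := sin _.
have cs : C ^+ 2 + S ^+ 2 = 1 by exact: cos2Dsin2.
have C2 : C = 1 - 2 * sin (pi * a) ^+ 2.
  have := cos2Dsin2 (pi * a).
  rewrite /C (_ : 2 * pi * a = (pi * a) *+ 2); last by rewrite -[_ *+ 2]mulr_natr; ring.
  rewrite cos_mulr2n -[_ *+ 2]mulr_natr; lra.
have -> : (1 - (r * C - 0 * S)) ^+ 2 + (0 - (r * S + 0 * C)) ^+ 2 =
   (1 - r) ^+ 2 + 4 * r * sin (pi * a) ^+ 2.
  rewrite (_ : (1 - (r * C - 0 * S)) ^+ 2 + (0 - (r * S + 0 * C)) ^+ 2 =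
     1 - 2 * r * C + r ^+ 2 * (C ^+ 2 + S ^+ 2)); last by ring.
  rewrite cs C2; ring.
have hs := sin_pi_lower ha.
have h1 : (rho * a) ^+ 2 <= 4 * r * sin (pi * a) ^+ 2.
  apply: (@le_trans _ _ (4 * r * (a * pi / 4) ^+ 2)); last first.
    by rewrite ler_wpM2l // mulr_ge0 // ltW.
  have k1 : rho ^+ 2 <= r by rewrite expr2; apply: le_trans hr; rewrite ler_piMr // ltW.
  have k2 : 1 <= 4 * (pi / 4) ^+ 2 :> R by clear -p2; nra.
  have -> : 4 * r * (a * pi / 4) ^+ 2 = r * a ^+ 2 * (4 * (pi / 4) ^+ 2) by ring.
  apply: (@le_trans _ _ (r * a ^+ 2)).
    by rewrite exprMn ler_wpM2r // sqr_ge0.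
  by rewrite ler_peMr // mulr_ge0 ?sqr_ge0 // ltW.
have h2 : rho * `|b| <= `|1 - r|.
  have [b0|/ltW b0] := leP 0 b.
    have r1 : r <= 1 by rewrite -expR0 ler_expR oppr_le0 !mulr_ge0 // ?pi_ge0.
    rewrite !ger0_norm ?subr_ge0 //.
    have := expR_ge1Dx (2 * pi * b); rewrite -[expR _]invrK -expRN -/r.
    rewrite -(ler_pM2l r0) mulfV ?gt_eqF // => h.
    have : rho * b <= r * (2 * pi * b).
      by apply: ler_pM => //; [exact: ltW | rewrite ler_peMl //; lra].
    lra.
  have r1 : 1 <= r by rewrite -expR0 ler_expR oppr_ge0 mulr_ge0_le0 // mulr_ge0 ?pi_ge0.
  rewrite ler0_norm // ler0_norm ?subr_le0 //.
  have := expR_ge1Dx (- (2 * pi * b)); rewrite -/r => h.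
  have : rho * - b <= 1 * (2 * pi * - b).
    by apply: ler_pM; rewrite ?oppr_ge0 ?(ltW rho0) // ler_peMl ?oppr_ge0 //; lra.
  lra.
have h3 : (rho * b) ^+ 2 <= (1 - r) ^+ 2.
  rewrite -(real_normK (num_real (rho * b))) -(real_normK (num_real (1 - r))).
  by rewrite lerXn2r ?nnegrE // normrM ger0_norm // ltW.
rewrite !exprMn in h1 h3; rewrite mulrDr addrC; exact: lerD h3 h1.
Qed.

(** Up to an affine change this is the cotangent: pi cot(pi z) = -2 pi i (cotg z - 1/2). Likewise (2
    pi i)^2 cosec2 z = pi^2 / sin^2(pi z). *)
Definition cotg z : R[i] := (1 - e2pi z)^-1.
Definition cosec2 z : R[i] := e2pi z / (1 - e2pi z) ^+ 2.

Lemma cotg_bound z Y : `|complex.Re z| <= 2^-1 -> `|complex.Im z| <= Y ->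
  cnorm (cotg z) <= expR (2 * pi * Y) / cnorm z.
Proof.
move=> h1 h2; have [->|nz] := eqVneq z 0.
  by rewrite /cotg e2pi0 subrr invr0 !cnorm0 invr0 mulr0.
have h := one_sub_e2pi_lower h1 h2.
have z0 : 0 < cnorm z by rewrite cnorm_gt0.
rewrite /cotg cnormV -[expR _]invrK -invfM -expRN lef_pV2 // posrE.
  by apply: lt_le_trans h; rewrite mulr_gt0 ?expR_gt0.
by rewrite mulr_gt0 ?expR_gt0.
Qed.

Lemma cnorm_e2pi_le z Y : `|complex.Im z| <= Y -> cnorm (e2pi z) <= expR (2 * pi * Y).
Proof.
rewrite ler_norml => /andP[h1 h2]; rewrite cnorm_e2pi ler_expR -mulrN.
by rewrite ler_wpM2l ?mulr_ge0 ?pi_ge0 //; lra.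
Qed.

Lemma cotg_add1 z : cotg (z + 1) = cotg z.
Proof. by rewrite /cotg e2piD e2pi1 mulr1. Qed.

Lemma cosec2_add1 z : cosec2 (z + 1) = cosec2 z.
Proof. by rewrite /cosec2 e2piD e2pi1 mulr1. Qed.

Lemma e2pi_half_sq z : e2pi z = e2pi (z / 2) ^+ 2.
Proof. by rewrite -e2piM; congr e2pi; field. Qed.

Lemma e2pi_half_add1 z : e2pi ((z + 1) / 2) = - e2pi (z / 2).
Proof. by rewrite mulrDl mul1r e2piD e2pi_half mulrN1. Qed.

Lemma sqr_neq1 z : 1 - z ^+ 2 != 0 -> (1 - z != 0) && (1 + z != 0).
Proof. by rewrite (_ : 1 - z ^+ 2 = (1 - z) * (1 + z)) ?mulf_eq0 ?negb_or //; ring. Qed.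

Lemma cotg_double z : e2pi z != 1 ->
  cotg z = 2^-1 * (cotg (z / 2) + cotg ((z + 1) / 2)).
Proof.
rewrite /cotg e2pi_half_add1 (e2pi_half_sq z) eq_sym -subr_eq0.
set q := e2pi _ => h; have /andP[h1 h2] := sqr_neq1 h.
by field; rewrite !opprK ?h ?h1 ?h2.
Qed.

Lemma cosec2_double z : e2pi z != 1 ->
  cosec2 z = 4^-1 * (cosec2 (z / 2) + cosec2 ((z + 1) / 2)).
Proof.
rewrite /cosec2 e2pi_half_add1 (e2pi_half_sq z) eq_sym -subr_eq0.
set q := e2pi _ => h; have /andP[h1 h2] := sqr_neq1 h.
by field; rewrite !opprK ?h ?h1 ?h2.
Qed.

Lemma e2pi_pow2_neq1 z n : (0 < n)%N -> e2pi z != 1 -> e2pi (z / n%:R) != 1.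
Proof.
move=> n0; apply: contra => /eqP h; rewrite -[z](mulVKf (x := n%:R)).
  by rewrite e2piM mulrC h expr1n.
by rewrite pnatr_eq0 -lt0n.
Qed.

End PartialFractions.

(** * Iterated duplication formulas and their scaled limits *)

Section PartialFractionSeries.
Variable R : realType.
Implicit Types (z w t u v : R[i]) (x y : R).

Notation tpi := ((2 * pi)%:C * 'i : R[i]).

Lemma tpi_neq0 : tpi != 0.
Proof.
rewrite mulf_neq0 //; last by rewrite eq_complex /= oner_eq0 andbF.
by rewrite eq_complex /= eqxx andbT mulf_neq0 // gt_eqF ?pi_gt0.
Qed.

Lemma cnorm_tpi : cnorm tpi = 2 * pi.
Proof.
rewrite cnormM cnorm_real ger0_norm ?mulr_ge0 ?pi_ge0 //.
by rewrite cnorm_sqrt /= expr0n expr1n add0r sqrtr1 mulr1.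
Qed.

(** The route to partial fractions: for each fixed k the point (z + k) / 2^j tends to the pole 0 as
    j grows, so each term tends to its polar part. *)
Lemma doubling_sum (phi : R[i] -> R[i]) (lam : R[i]) :
  (forall z, e2pi z != 1 -> phi z = lam * (phi (z / 2) + phi ((z + 1) / 2))) ->
  forall j z, e2pi z != 1 ->
  phi z = lam ^+ j * \sum_(k < 2 ^ j) phi ((z + k%:R) / (2 ^ j)%:R).
Proof.
move=> hphi; elim=> [|j IH] z hz.
  by rewrite expr0 mul1r big_ord_recl big_ord0 addr0 divr1 addr0.
rewrite IH // exprSr -mulrA; congr (_ * _).
have -> : (2 ^ j.+1 = 2 ^ j + 2 ^ j)%N by rewrite expnS; lia.
rewrite big_split_ord /= -big_split mulr_sumr; apply: eq_bigr => k _ /=.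
have n0 : (2 ^ j)%:R != 0 :> R[i] by rewrite pnatr_eq0 -lt0n expn_gt0.
rewrite hphi; last by rewrite e2pi_pow2_neq1 ?expn_gt0 // e2pi_addn.
have n2 : (2 ^ j)%:R + (2 ^ j)%:R != 0 :> R[i].
  by rewrite -natrD pnatr_eq0 -lt0n addn_gt0 expn_gt0.
by congr (_ * (phi _ + phi _)); rewrite !natrD; field; rewrite n2.
Qed.

(** By periodicity the upper half of the residues modulo 2^(j+1) is replaced by negative ones, so
    that all arguments stay in |Re| <= 1/2, where the lower bound for [1 - e2pi] holds. *)
Lemma doubling_sum_sym (phi : R[i] -> R[i]) (lam : R[i]) :
  (forall z, e2pi z != 1 -> phi z = lam * (phi (z / 2) + phi ((z + 1) / 2))) ->
  (forall z, phi (z + 1) = phi z) ->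
  forall j z, e2pi z != 1 ->
  phi z = lam ^+ j.+1 * \sum_(k < 2 ^ j)
    (phi ((z + k%:R) / (2 ^ j.+1)%:R) + phi ((z - 1 - k%:R) / (2 ^ j.+1)%:R)).
Proof.
move=> hphi hper j z hz; rewrite (doubling_sum hphi j.+1 hz); congr (_ * _).
have e2 : (2 ^ j.+1 = 2 ^ j + 2 ^ j)%N by rewrite expnS; lia.
set n := (2 ^ j.+1)%:R; rewrite e2 big_split_ord big_split; congr (_ + _).
rewrite (reindex_inj rev_ord_inj) /=; apply: eq_bigr => k _.
rewrite -[RHS]hper; congr phi.
have n0 : n != 0 by rewrite pnatr_eq0 -lt0n expn_gt0.
have -> : ((2 ^ j + (2 ^ j - k.+1))%N%:R : R[i]) = n - 1 - k%:R.
  rewrite /n e2 -addrA -opprD nat1r -natrB; first by congr _%:R; have := ltn_ord k; lia.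
  by have := ltn_ord k; lia.
by field.
Qed.

Lemma e2pi_sub1_bound w (n : nat) : (0 < n)%N ->
  cnorm (e2pi (w / n%:R) - 1) <=
  (2 * pi * cnorm w + 4 * (2 * pi * cnorm w) ^+ 2 * expR (2 * pi * cnorm w)) / n%:R.
Proof.
move=> n0; have n1 : 1 <= n%:R :> R by rewrite ler1n.
have n0' : 0 < n%:R :> R by rewrite ltr0n.
set W := 2 * pi * cnorm w.
have W0 : 0 <= W by rewrite !mulr_ge0 ?pi_ge0 ?cnorm_ge0.
have cw : 2 * pi * cnorm (w / n%:R) = W / n%:R by rewrite cnormM cnormV cnorm_nat mulrA.
clearbody W.
have := e2pi_bound (w / n%:R); rewrite cw => h.
have -> : e2pi (w / n%:R) - 1 = (e2pi (w / n%:R) - 1 - tpi * (w / n%:R)) + tpi * (w / n%:R) by ring.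
apply: le_trans (cnormD _ _) _; rewrite [leRHS]mulrDl [leLHS]addrC; apply: lerD.
  by rewrite cnormM cnorm_tpi -cw cnormM.
apply: le_trans h _.
have h1 : W / n%:R <= W by rewrite ler_pdivrMr // ler_peMr.
have h2 : expR (W / n%:R) <= expR W by rewrite ler_expR.
rewrite [leRHS](_ : _ = 4 * (W * (W / n%:R)) * expR W); last by rewrite expr2; ring.
apply: ler_pM; rewrite ?expR_ge0 ?mulr_ge0 ?sqr_ge0 //.
by rewrite ler_wpM2l // expr2 ler_wpM2r // divr_ge0.
Qed.

Lemma e2pi_sub1_quad w (n : nat) : (0 < n)%N ->
  cnorm (n%:R * (e2pi (w / n%:R) - 1) - tpi * w) <=
  4 * (2 * pi * cnorm w) ^+ 2 * expR (2 * pi * cnorm w) / n%:R.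
Proof.
move=> n0; have n1 : 1 <= n%:R :> R by rewrite ler1n.
have n0' : 0 < n%:R :> R by rewrite ltr0n.
have nz : n%:R != 0 :> R[i] by rewrite pnatr_eq0 -lt0n.
set W := 2 * pi * cnorm w.
have W0 : 0 <= W by rewrite !mulr_ge0 ?pi_ge0 ?cnorm_ge0.
have cw : 2 * pi * cnorm (w / n%:R) = W / n%:R by rewrite cnormM cnormV cnorm_nat mulrA.
clearbody W.
have := e2pi_bound (w / n%:R); rewrite cw => h.
have -> : n%:R * (e2pi (w / n%:R) - 1) - tpi * w =
  n%:R * (e2pi (w / n%:R) - 1 - tpi * (w / n%:R)) by field.
rewrite cnormM cnorm_nat.
apply: le_trans (ler_wpM2l (ltW n0') h) _.
have h1 : W / n%:R <= W by rewrite ler_pdivrMr // ler_peMr.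
have h2 : expR (W / n%:R) <= expR W by rewrite ler_expR.
rewrite [leLHS](_ : _ = (4 * W ^+ 2 / n%:R) * expR (W / n%:R)); last first.
  by field; rewrite gt_eqF.
rewrite [leRHS](_ : _ = (4 * W ^+ 2 / n%:R) * expR W); last by ring.
by rewrite ler_wpM2l // divr_ge0 // mulr_ge0 // sqr_ge0.
Qed.

Lemma pow2_ge (j : nat) : (j.+1 <= 2 ^ j.+1)%N.
Proof. exact/ltnW/ltn_expl. Qed.

Lemma cvC_scaled_e2pi w :
  cvC (fun j => (2 ^ j.+1)%:R * (1 - e2pi (w / (2 ^ j.+1)%:R))) (- (tpi * w)).
Proof.
set C := 4 * (2 * pi * cnorm w) ^+ 2 * expR (2 * pi * cnorm w).
have C0 : 0 <= C by rewrite !mulr_ge0 ?expR_ge0 ?sqr_ge0 ?mulr_ge0 ?pi_ge0 ?cnorm_ge0.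
apply: (@cvC_squeeze _ _ _ (fun j => C * harmonic j)) => [j|].
  have n0 : (0 < 2 ^ j.+1)%N by rewrite expn_gt0.
  rewrite cnormBC.
  rewrite [X in cnorm X](_ : _ =
    (2 ^ j.+1)%:R * (e2pi (w / (2 ^ j.+1)%:R) - 1) - tpi * w); last by ring.
  apply: le_trans (e2pi_sub1_quad w n0) _; rewrite ler_wpM2l //= lef_pV2 ?posrE ?ltr0n //.
  by rewrite ler_nat pow2_ge.
rewrite -(mulr0 C); apply: cvgM; [exact: cvg_cst|exact: cvg_harmonic].
Qed.

Lemma cvC_e2pi_scaled w : cvC (fun j => e2pi (w / (2 ^ j.+1)%:R)) 1.
Proof.
set C := (2 * pi * cnorm w + 4 * (2 * pi * cnorm w) ^+ 2 * expR (2 * pi * cnorm w)).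
have C0 : 0 <= C by rewrite addr_ge0 ?mulr_ge0 ?expR_ge0 ?sqr_ge0 ?mulr_ge0 ?pi_ge0 ?cnorm_ge0.
apply: (@cvC_squeeze _ _ _ (fun j => C * harmonic j)) => [j|].
  have n0 : (0 < 2 ^ j.+1)%N by rewrite expn_gt0.
  apply: le_trans (e2pi_sub1_bound w n0) _; rewrite ler_wpM2l //= lef_pV2 ?posrE ?ltr0n //.
  by rewrite ler_nat pow2_ge.
rewrite -(mulr0 C); apply: cvgM; [exact: cvg_cst|exact: cvg_harmonic].
Qed.

(** Telescoping: the first n + 1 terms sum to at most 2 - 1 / (n + 1). *)
Lemma rbound_inv_sq : rbound (fun k => (k.+1%:R ^+ 2)^-1 : R) 2.
Proof.
have h n : \sum_(i < n.+1) (i.+1%:R ^+ 2)^-1 <= 2 - n.+1%:R^-1 :> R.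
  elim: n => [|n IH]; first by rewrite big_ord_recr big_ord0 /=; lra.
  rewrite big_ord_recr /=; apply: le_trans (lerD IH (lexx _)) _.
  have a0 : 0 < n.+1%:R :> R by rewrite ltr0n.
  have -> : n.+2%:R = n.+1%:R + 1 :> R by rewrite natr1.
  set a := n.+1%:R in a0 *.
  rewrite -subr_ge0 (_ : _ - _ = (a * (a + 1) ^+ 2)^-1).
    by rewrite invr_ge0 mulr_ge0 ?sqr_ge0 // ltW.
  by field; rewrite !gt_eqF // addr_gt0.
case=> [|n]; first by rewrite big_ord0.
by apply: le_trans (h n) _; rewrite gerBl invr_ge0.
Qed.

Lemma rboundZ (b : nat -> R) B c : 0 <= c -> rbound b B -> rbound (fun k => c * b k) (c * B).
Proof. by move=> c0 h n; rewrite -mulr_sumr ler_wpM2l. Qed.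

Lemma e2pi_neq1_shift z (k : nat) : e2pi z != 1 -> z + k%:R != 0 /\ z - 1 - k%:R != 0.
Proof.
move=> hz; split; apply: contra hz => /eqP h.
  by rewrite -(e2pi_addn z k) h e2pi0.
have -> : z = k.+1%:R by apply/eqP; rewrite -subr_eq0 -nat1r opprD addrA h.
by rewrite e2pi_nat.
Qed.

(** For k >= 1 real parts alone give k >= (k + 1) / 2; the case k = 0 uses that z is neither 0 nor
    1. *)
Lemma shifted_lower z : 0 <= complex.Re z <= 1 -> e2pi z != 1 ->
  exists2 c : R, 0 < c & forall k : nat,
    c * k.+1%:R <= cnorm (z + k%:R) /\ c * k.+1%:R <= cnorm (z - 1 - k%:R).
Proof.
move=> /andP[x0 x1] hz.
have [z0 z1] := e2pi_neq1_shift 0 hz; rewrite addr0 subr0 in z0 z1.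
exists (Num.min 2^-1 (Num.min (cnorm z) (cnorm (z - 1)))).
  by rewrite !lt_min !cnorm_gt0 z0 z1 invr_gt0 ltr0n.
set c := Num.min _ _.
have c1 : c <= 2^-1 by rewrite ge_min lexx.
have c2 : c <= cnorm z by rewrite !ge_min lexx orbT.
have c3 : c <= cnorm (z - 1) by rewrite !ge_min lexx !orbT.
case=> [|k]; first by rewrite mulr1 addr0 subr0.
have k0 : 0 <= k%:R :> R by [].
have e1 : k.+1%:R = k%:R + 1 :> R by rewrite natr1.
have e2 : k.+2%:R = k%:R + 2 :> R by rewrite -natrD addn2.
have h : c * k.+2%:R <= k.+1%:R.
  apply: le_trans (ler_wpM2r _ c1) _ => //.
  by rewrite e1 e2; lra.
split; apply: le_trans h _; apply: le_trans _ (cnorm_Re _); rewrite raddfD.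
  rewrite -(rmorph_nat (real_complex R)) /=.
  by apply: le_trans (ler_norm _); lra.
rewrite raddfN raddfB -(rmorph_nat (real_complex R)) /= -normrN.
by apply: le_trans (ler_norm _); lra.
Qed.

End PartialFractionSeries.

(** * Partial fraction expansions on the strip 0 <= Re z <= 1 *)

Section PartialFractionTheorems.
Variable R : realType.
Implicit Types (z w t u v : R[i]) (x y : R).

Notation tpi := ((2 * pi)%:C * 'i : R[i]).

Lemma Re_divn w (n : nat) : complex.Re (w / n%:R) = complex.Re w / n%:R.
Proof.
rewrite -(rmorph_nat (real_complex R)) -fmorphV; case: w => a b /=; ring.
Qed.

Lemma Im_divn w (n : nat) : complex.Im (w / n%:R) = complex.Im w / n%:R.
Proof.
rewrite -(rmorph_nat (real_complex R)) -fmorphV; case: w => a b /=; ring.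
Qed.

Lemma Re_nat (n : nat) : complex.Re (n%:R : R[i]) = n%:R.
Proof. by rewrite -(rmorph_nat (real_complex R)). Qed.

Lemma Im_nat (n : nat) : complex.Im (n%:R : R[i]) = 0.
Proof. by rewrite -(rmorph_nat (real_complex R)). Qed.

Lemma shifted_region z (j k : nat) : 0 <= complex.Re z <= 1 -> (k < 2 ^ j)%N ->
  [/\ `|complex.Re ((z + k%:R) / (2 ^ j.+1)%:R)| <= 2^-1,
      `|complex.Im ((z + k%:R) / (2 ^ j.+1)%:R)| <= `|complex.Im z|,
      `|complex.Re ((z - 1 - k%:R) / (2 ^ j.+1)%:R)| <= 2^-1 &
      `|complex.Im ((z - 1 - k%:R) / (2 ^ j.+1)%:R)| <= `|complex.Im z|].
Proof.
move=> /andP[x0 x1] kj.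
have n1 : 1 <= (2 ^ j.+1)%:R :> R by rewrite ler1n expn_gt0.
have n0 : 0 < (2 ^ j.+1)%:R :> R by rewrite ltr0n expn_gt0.
have k0 : 0 <= k%:R :> R by [].
have kn : 2 * (k%:R + 1) <= (2 ^ j.+1)%:R :> R.
  by rewrite natr1 -natrM ler_nat expnS leq_mul2l.
rewrite !Re_divn !Im_divn !raddfB !raddfD /= !Re_nat !Im_nat !subr0 !addr0.
set n := (2 ^ j.+1)%:R in n1 n0 kn *.
have im : `|complex.Im z / n| <= `|complex.Im z|.
  by rewrite normrM normfV (ger0_norm (ltW n0)) ler_pdivrMr // ler_peMr.
split=> //; rewrite normrM normfV (ger0_norm (ltW n0)) ler_pdivrMr //.
  rewrite ger0_norm; lra.
rewrite ler0_norm; lra.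
Qed.

Lemma cosec2E z : cosec2 z = e2pi z * cotg z ^+ 2.
Proof. by rewrite /cosec2 /cotg exprVn. Qed.

Lemma cosec2_bound z Y : `|complex.Re z| <= 2^-1 -> `|complex.Im z| <= Y ->
  cnorm (cosec2 z) <= expR (2 * pi * Y) ^+ 3 / cnorm z ^+ 2.
Proof.
move=> h1 h2; rewrite cosec2E cnormM cnormX [expR _ ^+ 3]exprS -mulrA -expr_div_n.
apply: ler_pM; rewrite ?cnorm_ge0 ?sqr_ge0 //; first exact: cnorm_e2pi_le.
by rewrite lerXn2r ?nnegrE ?cnorm_ge0 ?divr_ge0 ?expR_ge0 ?cnorm_ge0 //; exact: cotg_bound.
Qed.

Lemma cvC_cosec2_scaled w : w != 0 ->
  cvC (fun j => ((2 ^ j.+1)%:R ^+ 2)^-1 * cosec2 (w / (2 ^ j.+1)%:R))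
      ((tpi * w) ^+ 2)^-1.
Proof.
move=> w0; have nz : - (tpi * w) != 0 by rewrite oppr_eq0 mulf_neq0 ?tpi_neq0.
have h := cvCV nz (cvC_scaled_e2pi w).
have := cvCM (cvC_e2pi_scaled w) (cvCM h h).
rewrite mul1r -expr2 exprVn sqrrN; apply: cvC_ext => j.
by rewrite /cosec2 -expr2 exprVn exprMn invfM mulrCA.
Qed.

Lemma cvC_cotg_scaled w : w != 0 ->
  cvC (fun j => ((2 ^ j.+1)%:R)^-1 * cotg (w / (2 ^ j.+1)%:R)) (- (tpi * w)^-1).
Proof.
move=> w0; have nz : - (tpi * w) != 0 by rewrite oppr_eq0 mulf_neq0 ?tpi_neq0.
have := cvCV nz (cvC_scaled_e2pi w); rewrite invrN; apply: cvC_ext => j.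
by rewrite /cotg invfM.
Qed.

Lemma psum_if (f : nat -> R[i]) k :
  psum (fun i => if (i < k)%N then f i else 0) k = \sum_(i < k) f i.
Proof. by apply: eq_bigr => i _; rewrite ltn_ord. Qed.

Lemma cvC_if (f : nat -> R[i]) l k : cvC f l ->
  cvC (fun j => if (k < 2 ^ j)%N then f j else 0) l.
Proof.
apply: (@cvC_near _ _ _ _ k) => j kj.
by rewrite (leq_ltn_trans kj) // ltn_expl.
Qed.

(** Dominated convergence in the duplication formula with n = 2^(j+1): n^-2 cosec2(w / n) tends to
    (2 pi i w)^-2, and the bound near the pole does not depend on j. *)
Lemma cosec2_series_strip z : 0 <= complex.Re z <= 1 -> e2pi z != 1 ->
  hsum (fun k => (z + k%:R) ^- 2 + (z - 1 - k%:R) ^- 2) (tpi ^+ 2 * cosec2 z).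
Proof.
move=> hx hz; have [c c0 hc] := shifted_lower hx hz.
pose U j k := if (k < 2 ^ j)%N then
   ((2 ^ j.+1)%:R ^+ 2)^-1 * cosec2 ((z + k%:R) / (2 ^ j.+1)%:R)
   + ((2 ^ j.+1)%:R ^+ 2)^-1 * cosec2 ((z - 1 - k%:R) / (2 ^ j.+1)%:R) else 0.
set C := expR (2 * pi * `|complex.Im z|) ^+ 3.
have C0 : 0 <= C by rewrite exprn_ge0 ?expR_ge0.
pose b (k : nat) : R := (2 * C / c ^+ 2) * (k.+1%:R ^+ 2)^-1.
have bE (k : nat) : b k = C / (c * k.+1%:R) ^+ 2 + C / (c * k.+1%:R) ^+ 2.
  have : 0 < k.+1%:R :> R by []; rewrite /b; set a := k.+1%:R => a0.
  by field; rewrite !gt_eqF.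
have b0 k : 0 <= b k.
  by rewrite /b !mulr_ge0 ?invr_ge0 ?sqr_ge0.
have one w k j : c * k.+1%:R <= cnorm w -> `|complex.Re (w / (2 ^ j.+1)%:R)| <= 2^-1 ->
    `|complex.Im (w / (2 ^ j.+1)%:R)| <= `|complex.Im z| ->
    cnorm (((2 ^ j.+1)%:R ^+ 2)^-1 * cosec2 (w / (2 ^ j.+1)%:R)) <= C / (c * k.+1%:R) ^+ 2.
  move=> h1 h2 h3; have n0 : 0 < (2 ^ j.+1)%:R :> R by rewrite ltr0n expn_gt0.
  have p0 : 0 < c * k.+1%:R by rewrite mulr_gt0.
  have w0 : 0 < cnorm w by exact: lt_le_trans h1.
  rewrite cnormM cnormV cnormX cnorm_nat.
  apply: le_trans (ler_wpM2l _ (cosec2_bound h2 h3)) _; first by rewrite invr_ge0 sqr_ge0.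
  rewrite cnormM cnormV cnorm_nat -/C.
  rewrite [leLHS](_ : _ = C / cnorm w ^+ 2); last first.
    move: n0 w0; set n := (2 ^ _)%:R; set W := cnorm w; move: (C) n W => C' n W n0 w0.
    by field; rewrite !gt_eqF.
  rewrite ler_wpM2l // lef_pV2 ?posrE ?exprn_gt0 //.
  by apply: lerXn2r; rewrite ?nnegrE ?(ltW p0) ?(ltW w0).
have [||||s hs] := @tannery R U b (2 * C / c ^+ 2 * 2) (fun k => ((tpi * (z + k%:R)) ^+ 2)^-1 +
    ((tpi * (z - 1 - k%:R)) ^+ 2)^-1) (fun=> cosec2 z).
- move=> j k; rewrite /U; case: ifP => kj; last by rewrite cnorm0.
  have [h1 h2 h3 h4] := shifted_region hx kj; have [h5 h6] := hc k.
  by rewrite bE; apply: le_trans (cnormD _ _) (lerD _ _); apply: one.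
- apply: rboundZ; last exact: rbound_inv_sq.
  by rewrite !mulr_ge0 ?invr_ge0 ?sqr_ge0.
- move=> k; have [z1 z2] := e2pi_neq1_shift k hz.
  by apply: cvC_if; apply: cvCD; exact: cvC_cosec2_scaled.
- move=> j; have -> : cosec2 z = psum (U j) (2 ^ j).
    rewrite (doubling_sum_sym (@cosec2_double R) (@cosec2_add1 R) j hz) psum_if.
    rewrite mulr_sumr; apply: eq_bigr => k _; rewrite mulrDr.
    by rewrite natrX -exprM mulnC exprM -[4]/(2 * 2)%N%:R natrM -expr2 exprVn.
  by apply: hsum_fin => k kj; rewrite /U ltnNge kj.
(* The sums do not depend on j, so their limit is their common value. *)
move=> cs; rewrite -(cvC_unique cs (cvC_cst _)).
apply: hsum_ext (hsumZ (tpi ^+ 2) hs) => k.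
have [z1 z2] := e2pi_neq1_shift k hz; move: (tpi) (tpi_neq0 R) => T t0.
by rewrite !exprMn; field; rewrite z1 z2 t0.
Qed.

Lemma cotgN z : e2pi z != 1 -> cotg (- z) = 1 - cotg z.
Proof.
rewrite /cotg e2piN eq_sym -subr_eq0 => h; have q0 := e2pi_neq0 z.
have h' : e2pi z - 1 != 0 by rewrite -oppr_eq0 opprB.
by field; rewrite ?q0 ?h ?h'.
Qed.

(** A single cotangent term decays only like 1 / k; the difference of two nearby ones gains the
    factor that makes the series absolutely convergent. *)
Lemma cotg_sub_bound u v Y :
  `|complex.Re u| <= 2^-1 -> `|complex.Im u| <= Y ->
  `|complex.Re v| <= 2^-1 -> `|complex.Im v| <= Y -> e2pi u != 1 -> e2pi v != 1 ->
  cnorm (cotg u - cotg v) <=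
    expR (2 * pi * Y) ^+ 3 * cnorm (e2pi (u - v) - 1) / (cnorm u * cnorm v).
Proof.
move=> h1 h2 h3 h4 hu' hv'.
have hu : 1 - e2pi u != 0 by rewrite subr_eq0 eq_sym.
have hv : 1 - e2pi v != 0 by rewrite subr_eq0 eq_sym.
have -> : cotg u - cotg v = e2pi v * (e2pi (u - v) - 1) * cotg u * cotg v.
  rewrite /cotg e2piD e2piN; have := e2pi_neq0 v => q0.
  by field; rewrite hu hv q0.
rewrite 3!cnormM; have := cotg_bound h1 h2; have := cotg_bound h3 h4.
have := cnorm_e2pi_le h4; set E := expR _ => k1 k2 k3.
rewrite [leRHS](_ : _ = E * cnorm (e2pi (u - v) - 1) * (E / cnorm u) * (E / cnorm v)).
  apply: ler_pM; rewrite ?mulr_ge0 ?cnorm_ge0 //.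
  apply: ler_pM; rewrite ?mulr_ge0 ?cnorm_ge0 //.
  by apply: ler_wpM2r; rewrite ?cnorm_ge0.
by rewrite invfM; ring.
Qed.

(** Unlike for [cosec2], domination is possible only for pairs: [cotgN] turns the sum of the terms
    at z + k and z - 1 - k into a difference, to which [cotg_sub_bound] applies. *)
Lemma cotg_series_strip z : 0 <= complex.Re z <= 1 -> e2pi z != 1 ->
  hsum (fun k => (z + k%:R)^-1 + (z - 1 - k%:R)^-1) (- tpi * (cotg z - 2^-1)).
Proof.
move=> hx hz; have [c c0 hc] := shifted_lower hx hz.
pose U j k := if (k < 2 ^ j)%N then
   ((2 ^ j.+1)%:R)^-1 * cotg ((z + k%:R) / (2 ^ j.+1)%:R)
   - ((2 ^ j.+1)%:R)^-1 * cotg (- ((z - 1 - k%:R) / (2 ^ j.+1)%:R)) else 0.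
set C := expR (2 * pi * `|complex.Im z|) ^+ 3.
have C0 : 0 <= C by rewrite exprn_ge0 ?expR_ge0.
(* The difference of the paired points z + k and -(z - 1 - k), the same for all k. *)
set w2 := 2 * z - 1.
set K := (2 * pi * cnorm w2 + 4 * (2 * pi * cnorm w2) ^+ 2 * expR (2 * pi * cnorm w2)).
have K0 : 0 <= K by rewrite addr_ge0 ?mulr_ge0 ?expR_ge0 ?sqr_ge0 ?mulr_ge0 ?pi_ge0 ?cnorm_ge0.
pose b (k : nat) : R := (C * K / c ^+ 2) * (k.+1%:R ^+ 2)^-1.
have b0 k : 0 <= b k.
  by rewrite /b !mulr_ge0 ?invr_ge0 ?sqr_ge0.
have [||||s hs] := @tannery R U b (C * K / c ^+ 2 * 2) (fun k => - (tpi * (z + k%:R))^-1 -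
    - (tpi * - (z - 1 - k%:R))^-1) (fun=> cotg z - 2^-1).
- move=> j k; rewrite /U; case: ifP => kj; last by rewrite cnorm0.
  have [h1 h2 h3 h4] := shifted_region hx kj; have [h5 h6] := hc k.
  have n0 : (0 < 2 ^ j.+1)%N by rewrite expn_gt0.
  set n := (2 ^ j.+1)%N in n0 h1 h2 h3 h4 *.
  have p0 : 0 < n%:R :> R by rewrite ltr0n.
  have a0 : 0 < c * k.+1%:R by rewrite mulr_gt0.
  have e1 : e2pi ((z + k%:R) / n%:R) != 1 by rewrite e2pi_pow2_neq1 // e2pi_addn.
  have e2 : e2pi (- ((z - 1 - k%:R) / n%:R)) != 1.
    rewrite e2piN invr_eq1 e2pi_pow2_neq1 //.
    by rewrite -(e2pi_addn _ 1) -(e2pi_addn _ k) addrAC subrK subrK.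
  rewrite -mulrBr cnormM cnormV cnorm_nat.
  have := cotg_sub_bound h1 h2 _ _ e1 e2; rewrite !raddfN /= !normrN => /(_ h3 h4).
  have -> : (z + k%:R) / n%:R - - ((z - 1 - k%:R) / n%:R) = w2 / n%:R.
    by rewrite /w2; ring.
  rewrite -/C cnormN.
  move=> hb; have hb2 := e2pi_sub1_bound w2 n0; rewrite -/K in hb2.
  apply: le_trans (ler_wpM2l _ hb) _; first by rewrite invr_ge0.
  have A0 : 0 < cnorm (z + k%:R) by apply: lt_le_trans h5.
  have B0 : 0 < cnorm (z - 1 - k%:R) by apply: lt_le_trans h6.
  rewrite !cnormM !cnormV !cnorm_nat.
  apply: (@le_trans _ _ (C * K / (cnorm (z + k%:R) * cnorm (z - 1 - k%:R)))).
    apply: (@le_trans _ _ (n%:R^-1 * (C * (K / n%:R) / (cnorm (z + k%:R) / n%:R *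
      (cnorm (z - 1 - k%:R) / n%:R))))).
      rewrite ler_wpM2l ?invr_ge0 // ler_wpM2r ?invr_ge0 ?mulr_ge0 ?invr_ge0 ?cnorm_ge0 //.
      by rewrite ler_wpM2l.
    rewrite le_eqVlt; apply/orP; left; apply/eqP; move: p0 A0 B0; set a := cnorm _; set b' := cnorm _.
    move: (C) (K) (n%:R) a b' => C' K' n' a b' p0 A0 B0.
    by field; rewrite !gt_eqF.
  rewrite [leRHS](_ : _ = C * K / (c * k.+1%:R * (c * k.+1%:R))); last first.
    rewrite /b; move: a0; have : 0 < k.+1%:R :> R by [].
    by set a := k.+1%:R => a1 a0; field; rewrite !gt_eqF.
  rewrite ler_wpM2l ?mulr_ge0 // lef_pV2 ?posrE ?mulr_gt0 //.
  by apply: ler_pM => //; exact: ltW.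
- apply: rboundZ; last exact: rbound_inv_sq.
  by rewrite !mulr_ge0 ?invr_ge0 ?sqr_ge0.
- move=> k; have [z1 z2] := e2pi_neq1_shift k hz.
  apply: cvC_if; apply: cvCB; first exact: cvC_cotg_scaled.
  apply: cvC_ext (cvC_cotg_scaled (w := - (z - 1 - k%:R)) _) => [j|].
    by rewrite mulNr.
  by rewrite oppr_eq0.
- move=> j; have -> : cotg z - 2^-1 = psum (U j) (2 ^ j).
    rewrite (doubling_sum_sym (@cotg_double R) (@cotg_add1 R) j hz) psum_if.
    have n0 : (2 ^ j.+1)%:R != 0 :> R[i] by rewrite pnatr_eq0 -lt0n expn_gt0.
    (* The constant 1/2 is spread over the 2^j pairs: it cancels the 1 that [cotgN] produces in each
       of them. *)
    rewrite [X in _ - X](_ : _ = (2^-1 ^+ j.+1) * \sum_(k < 2 ^ j) 1); last first.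
      by rewrite sumr_const card_ord natrX exprS -mulrA -exprMn mulVf ?expr1n ?mulr1.
    rewrite -mulrBr -sumrB mulr_sumr; apply: eq_bigr => k _.
    rewrite natrX exprVn -mulrBr; congr (_ * _).
    rewrite cotgN; first by ring.
    rewrite -natrX e2pi_pow2_neq1 ?expn_gt0 //.
    by rewrite -(e2pi_addn _ 1) -(e2pi_addn _ k) addrAC subrK subrK.
  by apply: hsum_fin => k kj; rewrite /U ltnNge kj.
move=> cs; rewrite -(cvC_unique cs (cvC_cst _)).
apply: hsum_ext (hsumZ (- tpi) hs) => k.
have [z1 z2] := e2pi_neq1_shift k hz; move: (tpi) (tpi_neq0 R) => T t0.
move: (z + k%:R) (z - 1 - k%:R) z1 z2 => p q z1 z2.
by field; rewrite z1 t0 z2.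
Qed.

End PartialFractionTheorems.

(** * The Eisenstein series of weight 2 *)
Section Eisenstein2.
Variable R : realType.
Implicit Types (z w t u v : R[i]) (x y : R).

Notation tpi := ((2 * pi)%:C * 'i : R[i]).

Lemma cvC_inv_nat z : cvC (fun k => (z + k%:R)^-1) 0.
Proof.
move=> e e0; set B := cnorm z + e^-1.
exists (Num.bound B) => k hk; rewrite subr0 cnormV.
have B0 : 0 <= B by rewrite addr_ge0 ?cnorm_ge0 ?invr_ge0 ?ltW.
have : B < k%:R.
  apply: lt_le_trans (_ : (Num.bound B)%:R <= _); last by rewrite ler_nat.
  by have := archi_boundP B0.
have := cnorm_subr (k%:R) (- z); rewrite opprK cnormN cnorm_nat addrC (addrC k%:R).
move=> h1 h2; have h3 : e^-1 < cnorm (z + k%:R) by rewrite /B in h2; lra.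
rewrite -[ltRHS]invrK ltf_pV2 ?posrE ?invr_gt0 //.
by apply: lt_trans h3; rewrite invr_gt0.
Qed.

Lemma cvC_inv_natN z : cvC (fun k => (z - k%:R)^-1) 0.
Proof.
rewrite -oppr0; apply: cvC_ext (cvCN (cvC_inv_nat (- z))) => k.
by rewrite -invrN opprD opprK.
Qed.

Section Shift.
Variable h : R[i] -> R[i].
Hypothesis hp : forall z, cvC (fun k => h (z + k%:R)) 0.
Hypothesis hm : forall z, cvC (fun k => h (z - k%:R)) 0.

(** Moving z by 1 alters a partial sum by two boundary terms, which tend to 0. This carries the
    expansions from the strip to all of the plane. *)
Lemma psum_shift z J :
  psum (fun k => h (z + 1 + k%:R) + h (z + 1 - 1 - k%:R)) J =
  psum (fun k => h (z + k%:R) + h (z - 1 - k%:R)) J + (h (z + J%:R) - h (z - J%:R)).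
Proof.
elim: J => [|J IH]; first by rewrite /psum !big_ord0 addr0 subr0 subrr addr0.
rewrite !psumS IH -natr1 (_ : z + 1 - 1 - J%:R = z - J%:R); last by ring.
rewrite (_ : z + (J%:R + 1) = z + 1 + J%:R); last by ring.
rewrite (_ : z - (J%:R + 1) = z - 1 - J%:R); last by ring.
ring.
Qed.

Lemma shift_up z l : hsum (fun k => h (z + k%:R) + h (z - 1 - k%:R)) l ->
  hsum (fun k => h (z + 1 + k%:R) + h (z + 1 - 1 - k%:R)) l.
Proof.
move=> hs; rewrite -[l]addr0 -[X in l + X](subrr 0).
by apply: cvC_ext (cvCD hs (cvCB (hp z) (hm z))) => J; rewrite psum_shift.
Qed.

Lemma shift_down z l :
  hsum (fun k => h (z + 1 + k%:R) + h (z + 1 - 1 - k%:R)) l ->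
  hsum (fun k => h (z + k%:R) + h (z - 1 - k%:R)) l.
Proof.
move=> hs; rewrite -[l]subr0 -[X in l - X](subrr 0).
apply: cvC_ext (cvCB hs (cvCB (hp z) (hm z))) => J; rewrite psum_shift.
by rewrite addrK.
Qed.

Lemma shift_all (L : R[i] -> R[i]) : (forall z, L (z + 1) = L z) ->
  (forall z, 0 <= complex.Re z <= 1 -> e2pi z != 1 ->
     hsum (fun k => h (z + k%:R) + h (z - 1 - k%:R)) (L z)) ->
  forall z, e2pi z != 1 -> hsum (fun k => h (z + k%:R) + h (z - 1 - k%:R)) (L z).
Proof.
move=> hL hs.
suff H n z : - n%:R <= complex.Re z <= 1 + n%:R -> e2pi z != 1 ->
    hsum (fun k => h (z + k%:R) + h (z - 1 - k%:R)) (L z).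
  move=> z; apply: (H (Num.bound `|complex.Re z|)).
  have := archi_boundP (normr_ge0 (complex.Re z)).
  by move/ltW; rewrite ler_norml => /andP[h1 h2]; apply/andP; split => //; lra.
elim: n z => [|n IH] z; first by rewrite oppr0 addr0; exact: hs.
rewrite -natr1 => /andP[h1 h2] hz.
have [x0|x0] := ltP (complex.Re z) 0.
  apply: shift_down; rewrite -hL; apply: IH; last by rewrite e2piD e2pi1 mulr1.
  rewrite raddfD /=; have : 0 <= n%:R :> R by []; by move=> ?; apply/andP; split; lra.
have [x1|x1] := leP (complex.Re z) 1; first by apply: hs => //; rewrite x0.
rewrite -(subrK 1 z) hL; apply: shift_up; apply: IH.
  rewrite raddfB /=; have : 0 <= n%:R :> R by []; by move=> ?; apply/andP; split; lra.
by rewrite e2piD e2piN e2pi1 invr1 mulr1.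
Qed.

(** Pairs k with -k and isolates the term at 0, which is the order of summation used for lattice
    rows. *)
Lemma shift_sym z l : hsum (fun k => h (z + k%:R) + h (z - 1 - k%:R)) l ->
  hsum (fun k => h (z + k.+1%:R) + h (z - k.+1%:R)) (l - h z).
Proof.
move=> hs; rewrite -[l - _]addr0.
apply: cvC_ext (cvCD (cvCB hs (cvC_cst (h z))) (hp z)) => J.
elim: J => [|J IH]; first by rewrite /psum !big_ord0 addr0; ring.
rewrite !psumS -IH -natr1 (_ : z - (J%:R + 1) = z - 1 - J%:R); last by ring.
ring.
Qed.

End Shift.

Lemma cosec2_series z : e2pi z != 1 ->
  hsum (fun k => (z + k.+1%:R) ^- 2 + (z - k.+1%:R) ^- 2) (tpi ^+ 2 * cosec2 z - z ^- 2).
Proof.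
have h2 (u : nat -> R[i]) : cvC u 0 -> cvC (fun k => u k ^+ 2) 0.
  by move=> hu; rewrite -(mulr0 0); exact: cvCM.
have hp w : cvC (fun k => (w + k%:R) ^- 2) 0.
  by apply: cvC_ext (h2 _ (cvC_inv_nat w)) => k; rewrite exprVn.
have hm w : cvC (fun k => (w - k%:R) ^- 2) 0.
  by apply: cvC_ext (h2 _ (cvC_inv_natN w)) => k; rewrite exprVn.
move=> hz; apply: (shift_sym (h := fun w => w ^- 2)) => //.
apply: (shift_all (h := fun w => w ^- 2) hp hm (L := fun z => tpi ^+ 2 * cosec2 z)) hz.
  by move=> w; rewrite cosec2_add1.
exact: cosec2_series_strip.
Qed.

Lemma cotg_series z : e2pi z != 1 ->
  hsum (fun k => (z + k.+1%:R)^-1 + (z - k.+1%:R)^-1)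
    (- tpi * (cotg z - 2^-1) - z^-1).
Proof.
move=> hz; apply: (shift_sym (h := fun w => w^-1)) => //; first exact: cvC_inv_nat.
apply: (shift_all (h := fun w => w^-1) cvC_inv_nat cvC_inv_natN
   (L := fun z => - tpi * (cotg z - 2^-1))) hz.
  by move=> w; rewrite cotg_add1.
exact: cotg_series_strip.
Qed.

Lemma inv_sq_hsum : exists z : R[i], hsum (fun k => (k.+1%:R) ^- 2) z.
Proof.
have rb : rbound (fun k => cnorm ((k.+1%:R : R[i]) ^- 2)) 2.
  by apply: rbound_le (rbound_inv_sq R) => k; rewrite cnormV cnormX cnorm_nat.
by have [z hz _] := hsum_abs rb; exists z.
Qed.

(** The value is pi^2 / 6. The expansion of [cosec2] at 1/2 sums the odd squares, and the even ones
    contribute a quarter of the total. *)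
Lemma zeta2 : hsum (fun k => (k.+1%:R) ^- 2) (- tpi ^+ 2 / 24).
Proof.
have [z hz] := inv_sq_hsum.
have hodd : hsum (fun k => ((k.*2).+1%:R) ^- 2) (- tpi ^+ 2 / 32).
  have hre : 0 <= complex.Re (2^-1 : R[i]) <= 1.
    have -> : (2^-1 : R[i]) = (2^-1 : R)%:C by rewrite fmorphV rmorph_nat.
    by apply/andP; split => /=; lra.
  have n1 : e2pi (2^-1 : R[i]) != 1 by rewrite e2pi_half eqNr oner_eq0.
  have := hsumZ 8^-1 (cosec2_series_strip hre n1).
  rewrite /cosec2 e2pi_half (_ : 8^-1 * _ = - tpi ^+ 2 / 32); last first.
    by move: tpi => T; field.
  apply: hsum_ext => k.
  have d0 : (k.*2.+1)%:R != 0 :> R[i] by rewrite pnatr_eq0.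
  have e0 : (k.*2.+1)%:R = 2 * k%:R + 1 :> R[i].
    by rewrite -natrM natr1; congr _%:R; lia.
  have -> : 2^-1 + k%:R = (k.*2.+1)%:R / 2 :> R[i] by rewrite e0; field.
  have -> : 2^-1 - 1 - k%:R = - ((k.*2.+1)%:R / 2) :> R[i] by rewrite e0; field.
  by move: d0; set D := _%:R => d0; field.
suff e : z = - tpi ^+ 2 / 32 + 4^-1 * z.
  suff -> : - tpi ^+ 2 / 24 = z by [].
  have -> : - tpi ^+ 2 = 32 * (z - 4^-1 * z) by rewrite {1}e; field.
  by field.
(* Partial sums of even length split into as many odd as even terms. *)
apply: (cvC_unique (u := psum (fun k => (k.+1%:R) ^- 2) \o double)).
  by apply: cvC_sub => // n; rewrite -addnn leq_addr.
apply: cvC_ext (cvCD hodd (cvCZ 4^-1 hz)) => n /=.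
elim: n => [|n IH]; first by rewrite /psum !big_ord0 mulr0 addr0.
rewrite doubleS !psumS -IH mulrDr.
have -> : (n.*2.+2)%:R = 2 * n.+1%:R :> R[i] by rewrite -natrM; congr _%:R; lia.
have : n.+1%:R != 0 :> R[i] by rewrite pnatr_eq0.
set a := n.+1%:R => a0; have -> : (2 * a) ^- 2 = 4^-1 / a ^+ 2 by field.
ring.
Qed.

End Eisenstein2.

(** * The law of E_2 under S by exchanging rows and columns of a lattice sum *)

Section Eisenstein2Law.
Variable R : realType.
Implicit Types (z w t u v : R[i]) (x y : R).

Notation tpi := ((2 * pi)%:C * 'i : R[i]).

Lemma e2pi_neq1_Im z : complex.Im z != 0 -> e2pi z != 1.
Proof.
apply: contra => /eqP h; have := cnorm_e2pi z; rewrite h cnorm1 -expR0 => /expR_inj/eqP.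
by rewrite eq_sym oppr_eq0 mulf_eq0 gt_eqF ?mulr_gt0 ?pi_gt0.
Qed.

Lemma Im_natM (n : nat) z : complex.Im (n%:R * z) = n%:R * complex.Im z.
Proof. by rewrite -(rmorph_nat (real_complex R)); case: z => a b /=; ring. Qed.

Lemma Im_inv z : complex.Im z^-1 = - complex.Im z / cnorm z ^+ 2.
Proof. by rewrite cnorm_sq; case: z => a b /=; rewrite mulNr. Qed.

Lemma upper_neq0 t : upper_half t -> t != 0.
Proof. by rewrite /upper_half /= => h; apply/eqP => h0; rewrite h0 ltxx in h. Qed.

(** With w = m t + r one has m Im t <= |w|, hence |r| <= |w| + m |t| <= |w| (1 + |t| / Im t). *)
Lemma lattice_lower t : upper_half t -> exists2 k : R, 0 < k &
  forall (m : nat) (r : R), m%:R * complex.Im t <= cnorm (m%:R * t + r%:C) /\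
     k * `|r| <= cnorm (m%:R * t + r%:C).
Proof.
rewrite /upper_half /=; set y := complex.Im t => y0.
have T0 := cnorm_ge0 t; have yT : 0 < y + cnorm t by lra.
exists (y / (y + cnorm t)); first by rewrite divr_gt0.
move=> m r; set w := _ + _.
have m0 : 0 <= m%:R :> R by [].
have h1 : m%:R * y <= cnorm w.
  apply: le_trans (cnorm_Im w); rewrite raddfD /= Im_natM addr0.
  exact: ler_norm.
split=> //.
have h2 : `|r| <= cnorm w + m%:R * cnorm t.
  have -> : `|r| = cnorm (w - m%:R * t) by rewrite -cnorm_real; congr cnorm; rewrite /w; ring.
  by apply: le_trans (cnormB _ _) _; rewrite cnormM cnorm_nat.
rewrite mulrAC ler_pdivrMr //.
have h3 : y * `|r| <= y * (cnorm w + m%:R * cnorm t) by rewrite ler_wpM2l // ltW.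
apply: le_trans h3 _.
have : m%:R * y * cnorm t <= cnorm w * cnorm t by rewrite ler_wpM2r.
nra.
Qed.

(** The subtracted term telescopes along a row and agrees with w^-2 up to O(w^-4). So the double sum
    of [eis_diff] converges absolutely, whereas that of w^-2 does not. *)
Definition eis_diff w : R[i] := w ^- 2 - ((w - 2^-1)^-1 - (w + 2^-1)^-1).

Lemma eis_diffE w : w != 0 -> w - 2^-1 != 0 -> w + 2^-1 != 0 ->
  eis_diff w = - (4 * w ^+ 2 * ((w - 2^-1) * (w + 2^-1)))^-1.
Proof.
move=> w0 w1 w2; rewrite /eis_diff.
have -> : (w - 2^-1)^-1 - (w + 2^-1)^-1 = ((w - 2^-1) * (w + 2^-1))^-1.
  have e : w + 2^-1 = (w - 2^-1) + 1 by field.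
  by move: w1 w2; rewrite e; move: (w - 2^-1) => a a0 a1; field; rewrite a0 a1.
have : (w - 2^-1) * (w + 2^-1) - w ^+ 2 = - 4^-1 by field.
have : (w - 2^-1) * (w + 2^-1) != 0 by rewrite mulf_neq0.
move: (_ * _) => P P0 e.
have -> : w ^- 2 - P^-1 = (P - w ^+ 2) / (w ^+ 2 * P) by field; rewrite P0 w0.
by rewrite e; field; rewrite P0 w0.
Qed.

(** Of the four factors in the denominator of [eis_diffE], the two equal to w are bounded below
    through m, and the two shifted by 1/2 through n. *)
Lemma eis_diff_bound t : upper_half t -> exists2 D : R, 0 <= D &
  forall m n : nat, cnorm (eis_diff (m.+1%:R * t + n%:R)) <=
       D * (m.+1%:R ^+ 2)^-1 * (n.+1%:R ^+ 2)^-1 /\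
     cnorm (eis_diff (m.+1%:R * t - n%:R)) <=
       D * (m.+1%:R ^+ 2)^-1 * (n.+1%:R ^+ 2)^-1.
Proof.
move=> ht; have [k k0 hk] := lattice_lower ht; set y := complex.Im t in hk.
have y0 : 0 < y by exact: ht.
set c := Num.min (k / 4) y.
have c0 : 0 < c by rewrite lt_min y0 divr_gt0.
exists (4 * y ^+ 2 * c ^+ 2)^-1.
  by rewrite invr_ge0 mulr_ge0 ?mulr_ge0 ?(ltW y0) ?(ltW c0).
move=> m n.
have M0 : 0 < m.+1%:R :> R by [].
have N0 : 0 < n.+1%:R :> R by [].
have M1 : 1 <= m.+1%:R :> R by rewrite ler1n.
have key (s : R) : `|s| = n%:R -> cnorm (eis_diff (m.+1%:R * t + s%:C)) <=
    (4 * y ^+ 2 * c ^+ 2)^-1 * (m.+1%:R ^+ 2)^-1 * (n.+1%:R ^+ 2)^-1.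
  move=> hs; set w := _ + _.
  have half : (2^-1 : R[i]) = (2^-1 : R)%:C by rewrite fmorphV rmorph_nat.
  have hw0 : m.+1%:R * y <= cnorm w by have [] := hk m.+1 s.
  have shifted (d : R) : `|d| = 2^-1 -> c * n.+1%:R <= cnorm (w + d%:C).
    move=> hd; have -> : w + d%:C = m.+1%:R * t + (s + d)%:C by rewrite /w rmorphD addrA.
    have [h1 h2] := hk m.+1 (s + d).
    (* For n = 0 the real shift gives no growth and the imaginary part serves instead. *)
    case: n hs {N0} => [|n] hs.
      rewrite mulr1; apply: le_trans h1; apply: (@le_trans _ _ y); first by rewrite ge_min lexx orbT.
      by rewrite ler_peMl // ltW.
    apply: le_trans h2; apply: (@le_trans _ _ (k / 4 * n.+2%:R)).
      by rewrite ler_wpM2r // ge_min lexx.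
    rewrite -mulrA ler_wpM2l ?(ltW k0) //.
    have := ler_normB (s + d) d; rewrite addrK hs hd.
    have -> : n.+2%:R = n.+1%:R + 1 :> R by rewrite natr1.
    have : 1 <= n.+1%:R :> R by rewrite ler1n.
    lra.
  have hw1 : c * n.+1%:R <= cnorm (w - 2^-1).
    by rewrite half -rmorphN; apply: shifted; rewrite normrN ger0_norm.
  have hw2 : c * n.+1%:R <= cnorm (w + 2^-1).
    by rewrite half; apply: shifted; rewrite ger0_norm.
  have p0 : 0 < c * n.+1%:R by rewrite mulr_gt0.
  have q0 : 0 < m.+1%:R * y by rewrite mulr_gt0.
  have a0 : 0 < cnorm w by exact: lt_le_trans hw0.
  have a1 : 0 < cnorm (w - 2^-1) by exact: lt_le_trans hw1.
  have a2 : 0 < cnorm (w + 2^-1) by exact: lt_le_trans hw2.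
  rewrite eis_diffE -?cnorm_gt0 // cnormN cnormV 3!cnormM cnormX cnorm_nat.
  rewrite -2!invfM lef_pV2 ?posrE ?mulr_gt0 ?exprn_gt0 //.
  rewrite [leLHS](_ : _ = 4 * (m.+1%:R * y) ^+ 2 * ((c * n.+1%:R) * (c * n.+1%:R))); last by ring.
  apply: ler_pM; first by rewrite pmulr_rge0 // sqr_ge0.
  - by rewrite -expr2 sqr_ge0.
  - by rewrite ler_wpM2l //; apply: lerXn2r; rewrite ?nnegrE ?(ltW q0) ?(ltW a0).
  by apply: ler_pM => //; exact: ltW.
split.
  have := key n%:R; rewrite rmorph_nat; apply; exact: ger0_norm.
have := key (- n%:R); rewrite rmorphN rmorph_nat; apply; rewrite normrN; exact: ger0_norm.
Qed.

(** The telescoped correction vanishes as N grows in a fixed row, but not after summation over the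
    rows: this is the source of the anomaly of E_2. *)
Definition eis_row t N : R[i] :=
  t ^- 2 + psum (fun n => (t + n.+1%:R) ^- 2 + (t - n.+1%:R) ^- 2) N
  - ((t - (N%:R + 2^-1))^-1 - (t + (N%:R + 2^-1))^-1).

Lemma eis_rowE t N : eis_row t N =
  eis_diff t + \sum_(n < N) (eis_diff (t + n.+1%:R) + eis_diff (t - n.+1%:R)).
Proof.
elim: N => [|N IH].
  by rewrite /eis_row /psum !big_ord0 /eis_diff !addr0 add0r.
rewrite big_ord_recr /= addrA -IH /eis_row psumS /eis_diff.
have -> : t - (N%:R + 2^-1) = t - N.+1%:R + 2^-1 by rewrite -natr1; field.
have -> : t + (N%:R + 2^-1) = t + N.+1%:R - 2^-1 by rewrite -natr1; field.
rewrite !opprD !addrA; ring.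
Qed.

Lemma eis_row_bound t : upper_half t -> exists2 D : R, 0 <= D &
  forall (N m : nat), cnorm (eis_row (m.+1%:R * t) N) <= D * (m.+1%:R ^+ 2)^-1.
Proof.
move=> ht; have [D D0 hD] := eis_diff_bound ht.
(* One central term, and two sides, each bounded by twice the central bound. *)
exists (5 * D); first by rewrite mulr_ge0.
move=> N m; rewrite eis_rowE; set E := D * (m.+1%:R ^+ 2)^-1.
have E0 : 0 <= E by rewrite mulr_ge0 // invr_ge0 sqr_ge0.
have h0 : cnorm (eis_diff (m.+1%:R * t)) <= E.
  have [] := hD m 0%N; rewrite addr0 => h _; apply: le_trans h _.
  by rewrite expr1n invr1 mulr1.
have -> : 5 * D * (m.+1%:R ^+ 2)^-1 = E + 2 * E * 2 by rewrite /E; ring.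
apply: le_trans (cnormD _ _) (lerD h0 _); apply: le_trans (cnorm_sum _ _ _) _.
have := rboundZ (c := 2 * E) _ (rbound_inv_sq R); rewrite mulr_ge0 // => /(_ isT N).
apply: le_trans; apply: ler_sum => n _; apply: le_trans (cnormD _ _) _.
have [h1 h2] := hD m n.+1; have le : (n.+2%:R ^+ 2)^-1 <= (n.+1%:R ^+ 2)^-1 :> R.
  by rewrite lef_pV2 ?posrE ?exprn_gt0 //; apply: lerXn2r; rewrite ?nnegrE // ler_nat.
have h3 := ler_wpM2l E0 le.
apply: le_trans (lerD (le_trans h1 h3) (le_trans h2 h3)) _.
by rewrite -[leRHS]mulrA mulr_natl mulr2n.
Qed.

Lemma eis_row_lim t : e2pi t != 1 -> cvC (eis_row t) (tpi ^+ 2 * cosec2 t).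
Proof.
move=> ht.
have -> : tpi ^+ 2 * cosec2 t = t ^- 2 + (tpi ^+ 2 * cosec2 t - t ^- 2) - (0 - 0) by ring.
apply: cvCB; first by apply: cvCD; [exact: cvC_cst | exact: cosec2_series].
apply: cvCB.
  by apply: cvC_ext (cvC_inv_natN (t - 2^-1)) => n; congr (_^-1); ring.
by apply: cvC_ext (cvC_inv_nat (t + 2^-1)) => n; congr (_^-1); ring.
Qed.

(** The sum over m >= 1 of the truncated rows at m t. The three summands are the column n = 0,
    evaluated by [zeta2], the columns n and -n together, and the correction, evaluated by the
    cotangent expansion. *)
Definition eis_col t N : R[i] :=
  t ^- 2 * (- tpi ^+ 2 / 24) +
  \sum_(n < N) t ^- 2 * (tpi ^+ 2 * cosec2 (n.+1%:R / t) - (n.+1%:R / t) ^- 2)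
  + t^-1 * (- tpi * (cotg ((N%:R + 2^-1) / t) - 2^-1) - ((N%:R + 2^-1) / t)^-1).

Lemma Im_natinv t (r : R) : upper_half t -> 0 < r -> complex.Im (r%:C / t) < 0.
Proof.
move=> ht r0; have -> : complex.Im (r%:C / t) = r * complex.Im t^-1.
  by case: (t^-1) => a b /=; ring.
rewrite Im_inv pmulr_rlt0 // mulNr oppr_lt0 divr_gt0 // exprn_gt0 // cnorm_gt0.
exact: upper_neq0.
Qed.

Lemma natC (n : nat) : (n%:R : R[i]) = (n%:R : R)%:C.
Proof. by rewrite rmorph_nat. Qed.

Lemma halfC (n : nat) : (n%:R + 2^-1 : R[i]) = (n%:R + 2^-1 : R)%:C.
Proof. by rewrite rmorphD fmorphV !rmorph_nat. Qed.

Lemma eis_col_hsum t N : upper_half t ->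
  hsum (fun m => eis_row (m.+1%:R * t) N) (eis_col t N).
Proof.
move=> ht; have t0 := upper_neq0 ht.
have rowE (m : nat) : eis_row (m.+1%:R * t) N =
   t ^- 2 * m.+1%:R ^- 2
   + \sum_(n < N) t ^- 2 * ((n.+1%:R / t + m.+1%:R) ^- 2 + (n.+1%:R / t - m.+1%:R) ^- 2)
   + t^-1 * (((N%:R + 2^-1) / t + m.+1%:R)^-1 + ((N%:R + 2^-1) / t - m.+1%:R)^-1).
  have e1 r : m.+1%:R * t + r = t * (r / t + m.+1%:R) by field.
  have e2 r : m.+1%:R * t - r = - (t * (r / t - m.+1%:R)) by field.
  have e3 p : (t * p) ^- 2 = t ^- 2 * p ^- 2 by rewrite exprMn invfM.
  rewrite /eis_row (e1 (N%:R + 2^-1)) (e2 (N%:R + 2^-1)) (mulrC m.+1%:R t) e3 (mulrC t m.+1%:R).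
  rewrite invrN (invfM t (_ - _)) (invfM t (_ + _)).
  rewrite /psum (eq_bigr (fun n : 'I_N => t ^- 2 * ((n.+1%:R / t + m.+1%:R) ^- 2 +
    (n.+1%:R / t - m.+1%:R) ^- 2))); first by ring.
  by move=> n _; rewrite (e1 n.+1%:R) (e2 n.+1%:R) sqrrN !e3 mulrDr.
apply: (hsum_ext (fun m => esym (rowE m))); apply: hsumD; first apply: hsumD.
- by apply: hsumZ; exact: zeta2.
- apply: hsum_fsum => n; apply: hsumZ; apply: cosec2_series; apply: e2pi_neq1_Im.
  by rewrite natC lt_eqF // Im_natinv.
- apply: hsumZ; apply: cotg_series; apply: e2pi_neq1_Im.
  by rewrite halfC lt_eqF // Im_natinv // ltr_wpDl // invr_gt0.
Qed.

(** The points (n + 1/2) / t descend in the lower half-plane, where [e2pi] grows without bound. *)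
Lemma cotg_lim t : upper_half t -> cvC (fun n => cotg ((n%:R + 2^-1) / t)) 0.
Proof.
move=> ht; set y := complex.Im t / cnorm t ^+ 2.
have y0 : 0 < y by rewrite divr_gt0 // exprn_gt0 // cnorm_gt0 upper_neq0.
apply: (@cvC_squeeze _ _ _ (fun j => (2 * pi * y)^-1 * 2 * harmonic j)) => [n|]; last first.
  rewrite -(mulr0 ((2 * pi * y)^-1 * 2)).
  by apply: cvgM; [exact: cvg_cst | exact: cvg_harmonic].
rewrite subr0 /cotg cnormV.
have n0 : 0 <= n%:R :> R by [].
have im : complex.Im ((n%:R + 2^-1) / t) = - ((n%:R + 2^-1) * y).
  have -> : complex.Im ((n%:R + 2^-1) / t) = (n%:R + 2^-1) * complex.Im t^-1.
    by rewrite halfC; case: (t^-1) => a b /=; ring.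
  by rewrite Im_inv mulNr mulrN.
have P0 : 0 < 2 * pi * y by rewrite mulr_gt0 // mulr_gt0 ?pi_gt0.
have h : 2 * pi * y * ((n%:R + 1) / 2) <= cnorm (1 - e2pi ((n%:R + 2^-1) / t)).
  rewrite cnormBC; apply: le_trans (cnorm_subr _ _); rewrite cnorm1 cnorm_e2pi im mulrN opprK.
  have := expR_ge1Dx (2 * pi * ((n%:R + 2^-1) * y)).
  have : 2 * pi * y * ((n%:R + 1) / 2) <= 2 * pi * y * (n%:R + 2^-1).
    by rewrite ler_wpM2l ?(ltW P0) //; lra.
  have -> : 2 * pi * y * (n%:R + 2^-1) = 2 * pi * ((n%:R + 2^-1) * y) by ring.
  lra.
have p1 : 0 < 2 * pi * y * ((n%:R + 1) / 2) by rewrite mulr_gt0 // divr_gt0 // ltr_wpDl.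
apply: (@le_trans _ _ (2 * pi * y * ((n%:R + 1) / 2))^-1).
  by rewrite lef_pV2 ?posrE //; exact: lt_le_trans h.
rewrite le_eqVlt; apply/orP; left; apply/eqP; rewrite /harmonic /= -natr1.
have n1 : n%:R + 1 != 0 :> R by rewrite natr1 pnatr_eq0.
move: P0; move: (2 * pi * y) => P P0.
by field; rewrite ?n1 ?gt_eqF.
Qed.

(** The Lambert series of the divisor sums, as q^m / (1 - q^m)^2 is [cosec2] at m t. *)
Definition eis_sum t : R[i] := xget 0 (hsum (fun m => cosec2 (m.+1%:R * t))).

Lemma cosec2N z : e2pi z != 1 -> cosec2 (- z) = cosec2 z.
Proof.
rewrite /cosec2 e2piN => hz; have q0 := e2pi_neq0 z.
have h : 1 - e2pi z != 0 by rewrite subr_eq0 eq_sym.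
have h' : e2pi z - 1 != 0 by rewrite subr_eq0.
by field; rewrite ?q0 ?h ?h'.
Qed.

(** Letting N grow in each row first gives [cosec2]; summing over the rows first gives [eis_col].
    Absolute convergence identifies the two results. *)
Lemma eis_sum_lim t : upper_half t ->
  hsum (fun m => cosec2 (m.+1%:R * t)) (eis_sum t) /\
  cvC (eis_col t) (tpi ^+ 2 * eis_sum t).
Proof.
move=> ht; have [D D0 hD] := eis_row_bound ht.
have rb := rboundZ D0 (rbound_inv_sq R).
have lim m : cvC (fun N => eis_row (m.+1%:R * t) N) (tpi ^+ 2 * cosec2 (m.+1%:R * t)).
  apply: eis_row_lim; apply: e2pi_neq1_Im; rewrite Im_natM gt_eqF // mulr_gt0 //.
have [s hs cs] := tannery hD rb lim (fun N => eis_col_hsum N ht).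
have hs' : hsum (fun m => cosec2 (m.+1%:R * t)) (tpi ^- 2 * s).
  apply: hsum_ext (hsumZ (tpi ^- 2) hs) => m.
  by rewrite mulrA mulVf ?mul1r // expf_neq0 // tpi_neq0.
have he : hsum (fun m => cosec2 (m.+1%:R * t)) (eis_sum t).
  by apply: (@xgetPex _ 0 (hsum (fun m => cosec2 (m.+1%:R * t)))); exists (tpi ^- 2 * s).
split=> //; rewrite (hsum_unique he hs') mulrA mulfV ?mul1r //.
by rewrite expf_neq0 // tpi_neq0.
Qed.

Lemma upper_inv t : upper_half t -> upper_half (- t^-1).
Proof.
rewrite /upper_half /= => h; rewrite raddfN /= Im_inv mulNr opprK divr_gt0 //.
by rewrite exprn_gt0 // cnorm_gt0 upper_neq0.
Qed.

Definition E2 t : R[i] := 1 - 24 * eis_sum t.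

(** The columns of t are, up to t^-2, the rows of -1 / t. In the correction [cotg] tends to 0 and
    leaves the constant 1/2 of the cotangent expansion, whence the term 12 t / (2 pi i). *)
Lemma E2_inv t : upper_half t -> E2 (- t^-1) = t ^+ 2 * E2 t + 12 * t / tpi.
Proof.
move=> ht; have ht' := upper_inv ht; have t0 := upper_neq0 ht.
have T0 := tpi_neq0 R.
have [_ h1] := eis_sum_lim ht; have [h2 _] := eis_sum_lim ht'.
set T := tpi in T0 h1 *.
have h3 : cvC (eis_col t) (t ^- 2 * (- T ^+ 2 / 24) +
    (t ^- 2 * (T ^+ 2 * eis_sum (- t^-1)) - (- T ^+ 2 / 24)) + t^-1 * (- T * (0 - 2^-1) - t * 0)).
  apply: cvCD; first apply: cvCD; first exact: cvC_cst.
    have hh : cvC (psum _) _ := hsumB (hsumZ (t ^- 2) (hsumZ (T ^+ 2) h2)) (@zeta2 R).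
    apply: cvC_ext hh => N.
    apply: eq_bigr => n _; rewrite mulrBr; congr (_ * (_ * _) - _).
      rewrite mulrN cosec2N //; apply: e2pi_neq1_Im.
      by rewrite natC lt_eqF // Im_natinv.
    by rewrite expr_div_n invf_div mulrA mulVf ?mul1r // expf_neq0.
  apply: cvCZ; apply: cvCB.
    by apply: cvCZ; apply: cvCB; [exact: cotg_lim|exact: cvC_cst].
  apply: cvC_ext (cvCZ t (cvC_inv_nat 2^-1)) => N.
  by rewrite invf_div addrC.
have := cvC_unique h1 h3; rewrite mulr0 subr0 => h4.
rewrite /E2; have -> : eis_sum (- t^-1) = t ^+ 2 * (eis_sum t - 24^-1) + 24^-1 - t / (2 * T).
  have -> : eis_sum t = T ^- 2 * (T ^+ 2 * eis_sum t) by rewrite mulrA mulVf ?mul1r // expf_neq0.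
  by rewrite h4; field; rewrite T0 t0.
by rewrite -/T; field; rewrite T0.
Qed.

End Eisenstein2Law.

(** * Formal exponentials *)
Section Formal.
Variable F : numFieldType.
Implicit Types (a b c d : nat -> F).

Definition conv a b n : F := \sum_(i < n.+1) a i * b (n - i)%N.
(** A coefficient of a product depends on finitely many others, so [conv] inherits commutativity and
    associativity from polynomials. *)
Definition trunc m a : {poly F} := \poly_(i < m) a i.

Lemma convE m n a b : (n < m)%N -> conv a b n = (trunc m a * trunc m b)`_n.
Proof.
move=> nm; rewrite coefM; apply: eq_bigr => i _; rewrite !coef_poly.
by rewrite (leq_ltn_trans (leq_subr _ _) nm) (leq_ltn_trans _ nm) // -ltnS.
Qed.

Lemma convC a b n : conv a b n = conv b a n.
Proof. by rewrite !(convE _ _ (ltnSn n)) mulrC. Qed.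

Lemma eq_conv a a' b b' n :
  (forall i, (i <= n)%N -> a i = a' i) -> (forall i, (i <= n)%N -> b i = b' i) ->
  conv a b n = conv a' b' n.
Proof.
move=> h1 h2; apply: eq_bigr => i _; rewrite h1 ?h2 ?leq_subr //.
by rewrite -ltnS.
Qed.

Lemma convA a b c n : conv (conv a b) c n = conv a (conv b c) n.
Proof.
transitivity ((trunc n.+1 a * trunc n.+1 b * trunc n.+1 c)`_n).
  rewrite coefM; apply: eq_bigr => i _; rewrite (convE _ _ (ltn_ord i)).
  by rewrite coef_poly ltnS leq_subr.
rewrite -mulrA coefM; apply: eq_bigr => i _.
rewrite (@convE n.+1) ?ltnS ?leq_subr // coef_poly ltn_ord //.
Qed.

Lemma convDl a a' b n : conv (fun i => a i + a' i) b n = conv a b n + conv a' b n.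
Proof. by rewrite /conv -big_split; apply: eq_bigr => i _; rewrite mulrDl. Qed.

Lemma conv_theta a b n : n%:R * conv a b n =
  conv (fun i => i%:R * a i) b n + conv a (fun i => i%:R * b i) n.
Proof.
rewrite /conv -big_split mulr_sumr; apply: eq_bigr => i _ /=.
have le : (i <= n)%N by rewrite -ltnS.
by rewrite -{1}(subnKC le) natrD; ring.
Qed.

Definition delta0 (n : nat) : F := (n == 0)%:R.

(** The recursion n e_n = sum_k d_k e_(n-k) calls all earlier values; building their list makes it
    structural. *)
Fixpoint fexp_seq d n : seq F :=
  if n is m.+1 then
    let s := fexp_seq d m in
    rcons s ((\sum_(i < m.+1) d i.+1 * s`_(m - i)%N) / m.+1%:R)
  else [:: 1].

(* Coefficients of the exponential of sum_(k >= 1) (d k / k) X^k. *)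
Definition fexp d n : F := (fexp_seq d n)`_n.

Lemma size_fexp_seq d n : size (fexp_seq d n) = n.+1.
Proof. by elim: n => //= n IH; rewrite size_rcons IH. Qed.

Lemma fexp_seqE d n i : (i <= n)%N -> (fexp_seq d n)`_i = fexp d i.
Proof.
elim: n => [|n IH]; first by rewrite leqn0 => /eqP ->.
rewrite leq_eqVlt => /orP[/eqP -> //|]; rewrite ltnS => le.
by rewrite /= nth_rcons size_fexp_seq ltnS le IH.
Qed.

Lemma fexp0 d : fexp d 0 = 1. Proof. by []. Qed.

Lemma fexpS d n : n.+1%:R * fexp d n.+1 = \sum_(i < n.+1) d i.+1 * fexp d (n - i)%N.
Proof.
rewrite /fexp /= nth_rcons size_fexp_seq ltnn eqxx mulrC divfK ?pnatr_eq0 //.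
by apply: eq_bigr => i _; rewrite fexp_seqE ?leq_subr.
Qed.

Lemma fexp_theta d n : d 0%N = 0 -> n%:R * fexp d n = conv d (fexp d) n.
Proof.
move=> d0; case: n => [|n].
  by rewrite mul0r /conv big_ord_recl big_ord0 d0 mul0r addr0.
by rewrite fexpS /conv [RHS]big_ord_recl d0 mul0r add0r.
Qed.

(** The equation theta a = d a, with theta = X d/dX, determines a. Identities between exponentials
    are proved by checking it; the cutoff N lets an infinite product be compared with a finite
    one. *)
Lemma fexp_uniq d a N : a 0%N = 1 -> d 0%N = 0 ->
  (forall n, (n <= N)%N -> n%:R * a n = conv d a n) ->
  forall n, (n <= N)%N -> a n = fexp d n.
Proof.
move=> a0 d0 h; elim/ltn_ind => -[|n] IH nN; first by rewrite a0.
apply: (mulfI (x := n.+1%:R)); first by rewrite pnatr_eq0.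
rewrite h // fexpS /conv big_ord_recl d0 mul0r add0r; apply: eq_bigr => i _.
rewrite /bump /= ?add1n subSS IH //; first by rewrite ltnS leq_subr.
by apply: leq_trans (leq_subr _ _) (ltnW nN).
Qed.

Lemma eq_fexp d d' N : d 0%N = 0 -> (forall n, (n <= N)%N -> d n = d' n) ->
  forall n, (n <= N)%N -> fexp d n = fexp d' n.
Proof.
move=> d0 h; apply: fexp_uniq => //; first by rewrite -h.
move=> n nN; rewrite fexp_theta //; apply: eq_conv => // i le.
by apply: h; apply: leq_trans nN.
Qed.

Lemma fexpD d d' n : d 0%N = 0 -> d' 0%N = 0 ->
  conv (fexp d) (fexp d') n = fexp (fun k => d k + d' k) n.
Proof.
move=> d0 d0'; apply: (@fexp_uniq _ _ n) => //.
- by rewrite /conv big_ord_recl big_ord0 addr0 mulr1.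
- by rewrite d0 d0' addr0.
move=> {}n _; rewrite conv_theta convDl -!convA; congr (_ + _).
  by apply: eq_conv => // i _; exact: fexp_theta.
rewrite convC (eq_conv (a' := conv d' (fexp d')) (b' := fexp d)) //; last first.
  by move=> i _; exact: fexp_theta.
by rewrite !convA; apply: eq_conv => // i _; rewrite convC.
Qed.

Lemma fexp_zero d n : (forall k, d k = 0) -> fexp d n = delta0 n.
Proof.
move=> h; apply/esym/(@fexp_uniq _ _ n) => // k _.
rewrite /conv big1 => [|i _]; last by rewrite h mul0r.
by rewrite /delta0; case: k => [|k]; rewrite ?mul0r ?mulr0.
Qed.

Lemma fexpN d n : d 0%N = 0 -> conv (fexp d) (fexp (fun k => - d k)) n = delta0 n.
Proof.
move=> d0; rewrite fexpD ?d0 ?oppr0 // fexp_zero // => k; exact: subrr.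
Qed.

End Formal.

Lemma fexp_rmorph (F G : numFieldType) (f : {rmorphism F -> G}) (d : nat -> F) n :
  f (fexp d n) = fexp (fun k => f (d k)) n.
Proof.
elim/ltn_ind: n => -[|n] IH; first exact: rmorph1.
apply: (mulfI (x := n.+1%:R)); first by rewrite pnatr_eq0.
rewrite -{1}(rmorph_nat f) -rmorphM !fexpS rmorph_sum; apply: eq_bigr => i _.
by rewrite rmorphM IH // ltnS leq_subr.
Qed.

(** * Integrality and unbounded denominators *)
Section Integrality.
Implicit Types (a b d : nat -> rat) (x y : rat).

Definition int_series a := forall n, a n \is a Num.int.

Lemma conv_int a b : int_series a -> int_series b -> int_series (conv a b).
Proof. by move=> ha hb n; apply: rpred_sum => i _; apply: rpredM. Qed.

Lemma int_delta0 : int_series (delta0 rat).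
Proof. by move=> n; rewrite /delta0 rpred_nat. Qed.

(** The inverse series is computed recursively without division, since the constant coefficient is
    1. *)
Lemma fexp_int_opp d : d 0%N = 0 -> int_series (fexp d) ->
  int_series (fexp (fun k => - d k)).
Proof.
move=> d0 h; elim/ltn_ind => -[|n] IH; first exact: rpred1.
have := fexpN n.+1 d0; rewrite /conv big_ord_recl fexp0 mul1r subn0 => e.
have -> : fexp (fun k => - d k) n.+1 =
   - \sum_(i < n.+1) fexp d (lift ord0 i) * fexp (fun k => - d k) (n.+1 - lift ord0 i)%N.
  by apply/eqP; rewrite -addr_eq0 e.
rewrite rpredN; apply: rpred_sum => i _; apply: rpredM; first exact: h.
by apply: IH; rewrite /= /bump ?add1n subSS ltnS leq_subr.
Qed.

Lemma fexp_int_add d d' : d 0%N = 0 -> d' 0%N = 0 ->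
  int_series (fexp d) -> int_series (fexp d') ->
  int_series (fexp (fun k => d k + d' k)).
Proof. by move=> d0 d0' h h' n; rewrite -fexpD //; exact: conv_int. Qed.

Lemma eq_int_fexp d d' : (forall k, d k = d' k) -> int_series (fexp d) -> int_series (fexp d').
Proof. by move=> /funext ->. Qed.

Lemma fexp_int_zero : int_series (fexp (fun=> 0)).
Proof. by move=> n; rewrite fexp_zero //; exact: int_delta0. Qed.

Lemma fexp_int_muln d (c : nat) : d 0%N = 0 -> int_series (fexp d) ->
  int_series (fexp (fun k => c%:R * d k)).
Proof.
move=> d0 h; elim: c => [|c IH].
  by apply: eq_int_fexp fexp_int_zero => k; rewrite mul0r.
have := fexp_int_add d0 _ h IH; rewrite d0 mulr0 => /(_ erefl).
by apply: eq_int_fexp => k; rewrite -nat1r mulrDl mul1r.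
Qed.

Lemma fexp_int_mulz d (c : int) : d 0%N = 0 -> int_series (fexp d) ->
  int_series (fexp (fun k => c%:~R * d k)).
Proof.
move=> d0 h; case: c => c; first exact: fexp_int_muln.
have hc := fexp_int_muln c.+1 d0 h.
apply: eq_int_fexp (fexp_int_opp _ hc) => [k|]; last by rewrite d0 mulr0.
by rewrite NegzE mulrNz mulNr.
Qed.

Definition dlog_factor (m k : nat) : rat :=
  if (0 < k)%N && (m %| k)%N then - m%:R else 0.

(* The logarithmic derivative of 1 - X^m. *)
Lemma fexp_factor m n : (0 < m)%N ->
  fexp (dlog_factor m) n = (n == 0)%:R - (n == m)%:R.
Proof.
move=> m0; apply/esym.
pose u n : rat := (n == 0)%:R - (n == m)%:R.
apply: (@fexp_uniq _ (dlog_factor m) u n) => // [|{}n _].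
  by rewrite /u /= eq_sym gtn_eqF // subr0.
have u_ge k : (m < k)%N -> u k = 0.
  by move=> h; rewrite /u (gtn_eqF (ltn_trans m0 h)) (gtn_eqF h) subr0.
rewrite convC /conv.
have um : u m = -1 by rewrite /u eqxx gtn_eqF // sub0r.
have u0 : u 0%N = 1 by rewrite /u eqxx eq_sym gtn_eqF // subr0.
have uE k : u k != 0 -> (k == 0)%N || (k == m).
  by rewrite /u; case: (k =P 0%N) => // _; case: (k =P m) => // _; rewrite subrr eqxx.
have [nm|mn] := ltnP n m.
  have dl : dlog_factor m n = 0.
    rewrite /dlog_factor; case: ifP => // /andP[n0 /(dvdn_leq n0)].
    by rewrite leqNgt nm.
  rewrite big_ord_recl big1 => [|i _].
    rewrite u0 mul1r subn0 addr0 dl; case: n nm {dl} => [|n] nm; first by rewrite mul0r.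
    by rewrite /u /= ltn_eqF // subrr mulr0.
  have [->|/uE/orP[//|/eqP h]] := eqVneq (u (lift ord0 i)) 0; first by rewrite mul0r.
  by have := ltn_ord i; move: h nm; rewrite /= /bump ?add1n; lia.
have mn' : (m < n.+1)%N by [].
(* [u] is supported on 0 and m, so two terms of the convolution survive. *)
rewrite (bigD1 (ord0 : 'I_n.+1)) //= (bigD1 (Ordinal mn')) /=; last first.
  by rewrite -val_eqE /= gtn_eqF.
rewrite big1 => [|i /andP[i0 im]]; last first.
  have [->|/uE/orP[h|h]] := eqVneq (u i) 0; first by rewrite mul0r.
    by move: i0; rewrite -val_eqE /= h.
  by move: im; rewrite -val_eqE /= h.
rewrite u0 um mul1r subn0 mulN1r addr0 /dlog_factor.
have n0 : (0 < n)%N by exact: leq_trans mn.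
rewrite n0 /= subn_gt0 dvdn_subl //.
have [->|nem] := eqVneq n m; first by rewrite ltnn dvdnn um subr0 mulrN1.
have mn2 : (m < n)%N by rewrite ltn_neqAle eq_sym nem mn.
rewrite mn2 /= [RHS]subrr /u (gtn_eqF n0) (negbTE nem).
by rewrite subrr mulr0.
Qed.

Lemma fexp_factor_int m : (0 < m)%N -> int_series (fexp (dlog_factor m)).
Proof. by move=> m0 n; rewrite fexp_factor // rpredB ?rpred_nat. Qed.

Lemma fexp_product_int (c : nat -> int) M :
  int_series (fexp (fun k => \sum_(m < M) (c m)%:~R * dlog_factor m.+1 k)).
Proof.
elim: M => [|M IH].
  by apply: eq_int_fexp fexp_int_zero => k; rewrite big_ord0.
have h := fexp_int_mulz (c M) (erefl : dlog_factor M.+1 0 = 0)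
  (fexp_factor_int (ltn0Sn M)).
apply: eq_int_fexp (fexp_int_add _ _ IH h) => [k||].
- by rewrite big_ord_recr.
- by rewrite big1 // => i _; rewrite mulr0.
- by rewrite mulr0.
Qed.

(** The factor 1 - X^m affects the coefficient of X^k only if m divides k, so for k > 0 the cutoff
    at k loses nothing. *)
Definition dlog_product (c : nat -> rat) (k : nat) : rat :=
  \sum_(m < k) c m * dlog_factor m.+1 k.

Lemma dlog_product_widen c k N : (k <= N)%N ->
  dlog_product c k = \sum_(m < N) c m * dlog_factor m.+1 k.
Proof.
move=> kN; rewrite /dlog_product -!(big_mkord xpredT (fun m => c m * dlog_factor m.+1 k)).
rewrite (big_cat_nat (leq0n k) kN) /= -[LHS]addr0; congr (_ + _); apply/esym.
rewrite big_nat_cond big1 // => m.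
rewrite andbT => /andP[km _]; rewrite /dlog_factor; case: ifP => [/andP[k0]|]; last by rewrite mulr0.
by move/(dvdn_leq k0); rewrite ltnNge km.
Qed.

(* The infinite product of the (1 - X^m)^(c m) has integral coefficients. *)
Lemma fexp_dlog_product_int (c : nat -> int) :
  int_series (fexp (dlog_product (fun m => (c m)%:~R))).
Proof.
move=> n; rewrite (@eq_fexp _ _ (fun k => \sum_(m < n) (c m)%:~R * dlog_factor m.+1 k) n) //.
- exact: fexp_product_int.
- by rewrite /dlog_product big_ord0.
- by move=> k kn; exact: dlog_product_widen.
Qed.

End Integrality.

(** * p-integrality and the Gauss norm *)

Section PIntegral.
Variable p : nat.
Hypothesis p_pr : prime p.
Implicit Types (x y : rat) (a b d : nat -> rat).

(** The localization of the integers at p. *)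
Definition pint x := exists2 c : nat, ~~ (p %| c)%N & c%:R * x \is a Num.int.

Lemma pint_int x : x \is a Num.int -> pint x.
Proof.
move=> h; exists 1%N; last by rewrite mul1r.
by rewrite dvdn1 gtn_eqF // prime_gt1.
Qed.

Lemma pintD x y : pint x -> pint y -> pint (x + y).
Proof.
move=> [c hc h] [c' hc' h']; exists (c * c')%N; first by rewrite Euclid_dvdM // negb_or hc.
rewrite natrM (_ : _ * _ = c'%:R * (c%:R * x) + c%:R * (c'%:R * y)); last by ring.
by rewrite rpredD // rpredM // rpred_nat.
Qed.

Lemma pintM x y : pint x -> pint y -> pint (x * y).
Proof.
move=> [c hc h] [c' hc' h']; exists (c * c')%N; first by rewrite Euclid_dvdM // negb_or hc.
rewrite natrM (_ : _ * _ = (c%:R * x) * (c'%:R * y)); last by ring.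
by rewrite rpredM.
Qed.

Lemma pint_sum (I : Type) (s : seq I) (P : pred I) (f : I -> rat) :
  (forall i, P i -> pint (f i)) -> pint (\sum_(i <- s | P i) f i).
Proof.
move=> h; elim/big_ind: _ => //; first by apply: pint_int; exact: rpred0.
exact: pintD.
Qed.

Lemma p_neq0 : p%:R != 0 :> rat.
Proof. by rewrite pnatr_eq0 -lt0n prime_gt0. Qed.

(** p generates a prime ideal of the localization: clear denominators and apply Euclid's lemma. *)
Lemma pint_mul_divp x y : pint x -> pint y -> pint (x * y / p%:R) ->
  pint (x / p%:R) \/ pint (y / p%:R).
Proof.
move=> [c hc /intrP[X hX]] [c' hc' /intrP[Y hY]] [c2 hc2 /intrP[Z hZ]].
have e : (X * Y * c2%:Z)%R = (c%:Z * c'%:Z * p%:Z * Z)%R.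
  apply: (@intr_inj rat); rewrite !intrM -hX -hY -hZ; move: p_neq0 => h0.
  by rewrite -!pmulrn; field.
have : (p%:Z %| X * Y * c2%:Z)%Z by rewrite e mulrAC dvdz_mull.
rewrite dvdzE !abszM !absz_nat !Euclid_dvdM // (negbTE hc2) orbF.
have conc W w k : ~~ (p %| k)%N -> k%:R * w = W%:~R :> rat -> (p %| `|W|)%N -> pint (w / p%:R).
  move=> hk hW hp; have /dvdzP[q hq] : (p%:Z %| W)%Z by rewrite dvdzE absz_nat.
  exists k => //; apply/intrP; exists q; rewrite mulrA hW hq intrM -pmulrn mulfK //.
  exact: p_neq0.
by case/orP=> [/(conc _ _ _ hc hX)|/(conc _ _ _ hc' hY)]; [left|right].
Qed.

Lemma pint1_divp : ~ pint (1 / p%:R).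
Proof.
move=> [c hc /intrP[Z hZ]]; move/negP: hc; apply.
have e : c%:Z = (Z * p%:Z)%R.
  by apply: (@intr_inj rat); rewrite intrM -hZ -!pmulrn div1r divfK // p_neq0.
have : (p%:Z %| c%:Z)%Z by rewrite e dvdz_mull.
by rewrite dvdzE !absz_nat.
Qed.

(* The Gauss norm of a is p^e, and n is the first index where it is attained. *)
Definition gauss_norm a (e n : nat) :=
  [/\ forall i, pint (p%:R ^+ e * a i),
      forall i, (i < n)%N -> pint (p%:R ^+ e * a i / p%:R) &
      ~ pint (p%:R ^+ e * a n / p%:R)].

Lemma pint_opp x : pint x -> pint (- x).
Proof. by move=> [c hc h]; exists c => //; rewrite mulrN rpredN. Qed.

(** Gauss's lemma: at index n + n' every product other than that of the two first maximal
    coefficients has smaller norm. *)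
Lemma gauss_norm_conv a b e n e' n' : gauss_norm a e n -> gauss_norm b e' n' ->
  gauss_norm (conv a b) (e + e') (n + n').
Proof.
move=> [h1 h2 h3] [h1' h2' h3'].
have split_term i j : p%:R ^+ (e + e') * (a i * b j) =
    (p%:R ^+ e * a i) * (p%:R ^+ e' * b j) by rewrite exprD; ring.
split=> [k|k kn|].
- rewrite /conv mulr_sumr; apply: pint_sum => i _; rewrite split_term.
  exact: pintM.
- rewrite /conv mulr_sumr mulr_suml; apply: pint_sum => i _; rewrite split_term.
  have [iln|nli] := ltnP i n; first by rewrite mulrAC; apply: pintM => //; exact: h2.
  rewrite -mulrA; apply: pintM => //; apply: h2'.
  by have := ltn_ord i; move: kn nli; lia.
- have nn : (n < (n + n').+1)%N by rewrite ltnS leq_addr.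
  rewrite /conv (bigD1 (Ordinal nn)) //= mulrDr mulrDl => h.
  have : pint (p%:R ^+ (e + e') * (a n * b (n + n' - n)%N) / p%:R).
    rewrite -[X in pint X](addrK (p%:R ^+ (e + e') *
      (\sum_(i < (n + n').+1 | i != Ordinal nn) a i * b (n + n' - i)%N) / p%:R)).
    apply: pintD => //; apply: pint_opp.
    rewrite mulr_sumr mulr_suml; apply: pint_sum => i ine; rewrite split_term.
    have [iln|nli] := ltnP i n; first by rewrite mulrAC; apply: pintM => //; exact: h2.
    rewrite -mulrA; apply: pintM => //; apply: h2'.
    have : i != n :> nat by move: ine; rewrite -val_eqE.
    by have := ltn_ord i; move: nli; lia.
  by rewrite split_term addKn => h4; case: (pint_mul_divp (h1 n) (h1' n') h4).
Qed.

Lemma gauss_norm_fexp_muln d e n (N : nat) : d 0%N = 0 -> gauss_norm (fexp d) e n ->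
  gauss_norm (fexp (fun k => N%:R * d k)) (N * e) (N * n).
Proof.
move=> d0 h; elim: N => [|N IH].
  rewrite !mul0n; have E k : fexp (fun k => 0%:R * d k) k = delta0 rat k.
    by apply: fexp_zero => i; rewrite mul0r.
  split=> [i|//|]; rewrite E expr0 mul1r; last exact: pint1_divp.
  by apply: pint_int; exact: int_delta0.
rewrite !mulSn (_ : fexp _ = conv (fexp d) (fexp (fun k => N%:R * d k))).
  exact: gauss_norm_conv.
apply/funext => k; rewrite fexpD ?d0 ?mulr0 //; congr (fexp _ k).
by apply/funext => i; rewrite -nat1r mulrDl mul1r.
Qed.

Lemma pint_denq x e : ~~ (p ^ e %| `|denq x|)%N -> pint (p%:R ^+ e * x).
Proof.
move=> h; set D := `|denq x|%N in h.
have D0 : (0 < D)%N by rewrite absz_gt0 denq_neq0.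
have [le|lt] := leqP e (logn p D).
  by move: h; rewrite (dvdn_trans (dvdn_exp2l p le) (pfactor_dvdnn p D)).
(* The prime-to-p part of the denominator. *)
exists (D %/ p ^ logn p D)%N.
  apply/negP => hp; have := pfactor_dvdn (logn p D).+1 p_pr D0.
  rewrite ltnn => /negP; apply.
  by rewrite -[X in (_ %| X)%N](divnK (pfactor_dvdnn p D)) expnS dvdn_mul.
have -> : (D %/ p ^ logn p D)%:R * (p%:R ^+ e * x) = (p ^ (e - logn p D))%:R * (D%:R * x).
  have hD : D%:R = (D %/ p ^ logn p D)%:R * p%:R ^+ logn p D :> rat.
    by rewrite -natrX -natrM divnK // pfactor_dvdnn.
  have he : p%:R ^+ e = p%:R ^+ logn p D * p%:R ^+ (e - logn p D) :> rat.
    by rewrite -exprD subnKC // ltnW.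
  rewrite hD he natrX; ring.
apply: rpredM; first exact: rpred_nat.
have -> : D%:R * x = (numq x)%:~R.
  have : (denq x)%:~R * x = (numq x)%:~R by rewrite mulrC -numqE.
  by rewrite -[denq x]gez0_abs ?denq_ge0 // -pmulrn.
exact: intr_int.
Qed.

(* A p-bounded series one of whose powers is p-integral is itself p-integral. *)
Lemma fexp_unbounded d (N : nat) : (0 < N)%N -> d 0%N = 0 ->
  int_series (fexp (fun k => N%:R * d k)) -> ~ pint (d 1%N) ->
  forall e, exists n, (p ^ e %| `|denq (fexp d n)|)%N.
Proof.
move=> N0 d0 hint hd e; apply: contrapT => hno.
have hb : exists e, `[< forall n, pint (p%:R ^+ e * fexp d n) >].
  exists e; apply/asboolP => n; apply: pint_denq; apply/negP => hn.
  by apply: hno; exists n.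
case: (ex_minnP hb) => e0 /asboolP he0 hmin.
(* If the least exponent were 0, the coefficient of index 1, which is [d 1], would be p-integral. *)
case: e0 he0 hmin => [|e0] he0 hmin.
  apply: hd; have := he0 1%N; rewrite expr0 mul1r.
  have := fexpS d 0; rewrite big_ord_recl big_ord0 addr0 mul1r subn0 fexp0 mulr1.
  by move=> ->.
(* By minimality the Gauss norm is attained; the first such index is the one [gauss_norm] needs. *)
have hex : exists n, `[< ~ pint (p%:R ^+ e0 * fexp d n) >].
  apply: contrapT => hne; have /hmin : `[< forall n, pint (p%:R ^+ e0 * fexp d n) >].
    apply/asboolP => n; apply: contrapT => hn; apply: hne; exists n; exact/asboolP.
  by rewrite ltnn.
case: (ex_minnP hex) => n /asboolP hn hminn.
have divE k : p%:R ^+ e0.+1 * fexp d k / p%:R = p%:R ^+ e0 * fexp d k.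
  by rewrite exprSr mulrAC mulfK // p_neq0.
have G : gauss_norm (fexp d) e0.+1 n.
  split=> // [i ilt|]; rewrite divE //; apply: contrapT => hi.
  by have := hminn i (asboolT hi); rewrite leqNgt ilt.
(* The N-th power would have Gauss norm p^(N (e0 + 1)) > 1, although its coefficients are
   integers. *)
have [_ _ ] := gauss_norm_fexp_muln N d0 G; apply.
case: N N0 hint {G} => // N _ hint.
rewrite mulSn addSn exprSr mulrAC mulfK ?p_neq0 //; apply: pint_int.
by rewrite rpredM ?rpredX ?rpred_nat.
Qed.

End PIntegral.

(** * Power series in q *)
Section QSeries.
Variable R : realType.
Implicit Types (a b d : nat -> R[i]) (t z w : R[i]) (r s x y : R).

(** Convergence in the open unit disc, expressed by Cauchy estimates so that stability under sums,
    products and theta is elementary. *)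
Definition disc_conv a := forall r, 0 < r < 1 ->
  exists K : R, forall n, cnorm (a n) * r ^+ n <= K.

Lemma geometric_rbound r : 0 <= r < 1 -> rbound (fun n => r ^+ n) (1 - r)^-1.
Proof.
move=> /andP[r0 r1] n; have h : 0 < 1 - r by rewrite subr_gt0.
rewrite -(ler_pM2l h) mulfV ?gt_eqF // -opprB mulNr -subrX1 opprB.
by rewrite lerBlDr lerDl exprn_ge0.
Qed.

Lemma nat_geometric r n : 0 <= r < 1 -> n%:R * r ^+ n <= (1 - r)^-1.
Proof.
move=> h; apply: le_trans (geometric_rbound h n); case/andP: h => r0 r1.
rewrite -[X in X%:R * _](card_ord n) -sum1_card natr_sum mulr_suml.
apply: ler_sum => i _; rewrite mul1r; apply: ler_wiXn2l; rewrite ?(ltW r1) //; exact: ltnW (ltn_ord i).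
Qed.

(** An estimate at the larger radius s = (r + 1) / 2 leaves a geometric factor r / s to spend at
    r. *)
Lemma mid_bounds r : 0 < r < 1 -> [/\ 0 < (r + 1) / 2 < 1, 0 <= r / ((r + 1) / 2) < 1 & r = r / ((r + 1) / 2) * ((r + 1) / 2)].
Proof.
move=> /andP[r0 r1]; have h : 0 < (r + 1) / 2 by lra.
split; first by apply/andP; split; lra.
  by rewrite divr_ge0 ?(ltW r0) ?(ltW h) //= ltr_pdivrMr //; lra.
by rewrite divfK // gt_eqF.
Qed.

Lemma disc_conv_rbound a r : disc_conv a -> 0 < r < 1 ->
  exists2 B, 0 <= B & rbound (fun n => cnorm (a n) * r ^+ n) B.
Proof.
move=> ha /mid_bounds[hs hx e]; set s := (r + 1) / 2 in hs hx e; set x := r / s in hx e.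
have [K hK] := ha _ hs.
have K0 : 0 <= K by apply: le_trans (hK 0%N); rewrite expr0 mulr1 cnorm_ge0.
have x1 : 0 < 1 - x by case/andP: hx; rewrite subr_gt0.
exists (K * (1 - x)^-1); first by rewrite mulr_ge0 // invr_ge0 ltW.
apply: (@rbound_le _ (fun n => K * x ^+ n)) => [n|].
  rewrite e exprMn [leLHS](_ : _ = cnorm (a n) * s ^+ n * x ^+ n); last by ring.
  by rewrite ler_wpM2r // exprn_ge0 //; case/andP: hx.
by apply: rboundZ => //; exact: geometric_rbound.
Qed.

Lemma disc_conv_ext a b : (forall n, a n = b n) -> disc_conv a -> disc_conv b.
Proof. by move=> /funext ->. Qed.

Lemma disc_conv_le a b : (forall n, cnorm (b n) <= cnorm (a n)) -> disc_conv a -> disc_conv b.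
Proof.
move=> h ha r hr; have [K hK] := ha r hr; exists K => n; apply: le_trans (hK n).
by rewrite ler_wpM2r // exprn_ge0 // ltW //; case/andP: hr.
Qed.

Lemma disc_convD a b : disc_conv a -> disc_conv b -> disc_conv (fun n => a n + b n).
Proof.
move=> ha hb r hr; have [K hK] := ha r hr; have [L hL] := hb r hr; exists (K + L) => n.
apply: le_trans (lerD (hK n) (hL n)); rewrite -mulrDl ler_wpM2r ?cnormD //.
by rewrite exprn_ge0 // ltW //; case/andP: hr.
Qed.

Lemma disc_convZ c a : disc_conv a -> disc_conv (fun n => c * a n).
Proof.
move=> ha r hr; have [K hK] := ha r hr; exists (cnorm c * K) => n.
by rewrite cnormM -mulrA ler_wpM2l // cnorm_ge0.
Qed.

Lemma disc_conv_theta a : disc_conv a -> disc_conv (fun n => n%:R * a n).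
Proof.
move=> ha r /mid_bounds[hs hx e]; set s := (r + 1) / 2 in hs hx e; set x := r / s in hx e.
have [K hK] := ha _ hs.
have K0 : 0 <= K by apply: le_trans (hK 0%N); rewrite expr0 mulr1 cnorm_ge0.
exists ((1 - x)^-1 * K) => n.
rewrite cnormM cnorm_nat e exprMn.
rewrite [leLHS](_ : _ = (n%:R * x ^+ n) * (cnorm (a n) * s ^+ n)); last by ring.
apply: ler_pM => //; last exact: nat_geometric.
- by rewrite mulr_ge0 // exprn_ge0 //; case/andP: hx.
- by rewrite mulr_ge0 ?cnorm_ge0 // exprn_ge0 // ltW //; case/andP: hs.
Qed.

Lemma disc_conv_conv a b : disc_conv a -> disc_conv b -> disc_conv (conv a b).
Proof.
move=> ha hb r hr; have [B B0 hB] := disc_conv_rbound ha hr; have [K hK] := hb r hr.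
have r0 : 0 <= r by case/andP: hr => /ltW.
have K0 : 0 <= K by apply: le_trans (hK 0%N); rewrite expr0 mulr1 cnorm_ge0.
exists (B * K) => n; apply: le_trans (ler_wpM2r K0 (hB n.+1)).
apply: le_trans (ler_wpM2r (exprn_ge0 _ r0) (cnorm_sum _ _ _)) _.
rewrite !mulr_suml; apply: ler_sum => i _; rewrite cnormM.
have le : (i <= n)%N by rewrite -ltnS.
have -> : r ^+ n = r ^+ i * r ^+ (n - i) by rewrite -exprD subnKC.
rewrite [leLHS](_ : _ = (cnorm (a i) * r ^+ i) * (cnorm (b (n - i)%N) * r ^+ (n - i))); last by ring.
by rewrite ler_wpM2l // mulr_ge0 ?cnorm_ge0 ?exprn_ge0.
Qed.

Lemma disc_conv_shift a k : disc_conv a -> disc_conv (fun n => a (k + n)%N).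
Proof.
move=> ha r hr; have [K hK] := ha r hr; exists (K / r ^+ k) => n.
have r0 : 0 < r by case/andP: hr.
rewrite ler_pdivlMr ?exprn_gt0 // -mulrA -exprD addnC; exact: hK.
Qed.

Lemma cnorm_q_bounds t : upper_half t -> 0 < cnorm (e2pi t) < 1.
Proof.
rewrite /upper_half /= => h; rewrite cnorm_e2pi expR_gt0 /= -expR0 ltr_expR.
by rewrite oppr_lt0 mulr_gt0 // mulr_gt0 ?pi_gt0.
Qed.

(** A total function; under the hypotheses of [qevP] the default 0 is not involved. *)
Definition qev a t : R[i] := xget 0 (hsum (fun n => a n * e2pi t ^+ n)).

Lemma qevP a t : disc_conv a -> upper_half t ->
  hsum (fun n => a n * e2pi t ^+ n) (qev a t).
Proof.
move=> ha ht; have [B B0 hB] := disc_conv_rbound ha (cnorm_q_bounds ht).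
have hB' : rbound (fun n => cnorm (a n * e2pi t ^+ n)) B.
  by apply: rbound_le hB => n; rewrite cnormM cnormX.
have [z hz _] := hsum_abs hB'.
by apply: (@xgetPex _ 0 (hsum (fun n => a n * e2pi t ^+ n))); exists z.
Qed.

Lemma qevE a t z : hsum (fun n => a n * e2pi t ^+ n) z -> qev a t = z.
Proof.
move=> h; apply: (hsum_unique _ h).
by apply: (@xgetPex _ 0 (hsum (fun n => a n * e2pi t ^+ n))); exists z.
Qed.

Lemma qev_bound a y : 0 < y -> disc_conv a -> exists2 B, 0 <= B &
  forall t, y <= complex.Im t -> cnorm (qev a t) <= B.
Proof.
move=> y0 ha; set r := expR (- (2 * pi * y)).
have hr : 0 < r < 1.
  by rewrite expR_gt0 -expR0 ltr_expR oppr_lt0 mulr_gt0 // mulr_gt0 ?pi_gt0.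
have [B B0 hB] := disc_conv_rbound ha hr; exists B => // t ty.
have ht : upper_half t by exact: lt_le_trans ty.
apply: (hsum_le _ hB) (qevP ha ht) => n; rewrite cnormM cnormX ler_wpM2l ?cnorm_ge0 //.
apply: lerXn2r; rewrite ?nnegrE ?cnorm_ge0 ?expR_ge0 // cnorm_e2pi ler_expR lerN2.
by rewrite ler_wpM2l // mulr_ge0 ?pi_ge0.
Qed.

Lemma qevD a b t : disc_conv a -> disc_conv b -> upper_half t ->
  qev (fun n => a n + b n) t = qev a t + qev b t.
Proof.
move=> ha hb ht; apply: qevE; apply: hsum_ext (hsumD (qevP ha ht) (qevP hb ht)) => n.
by rewrite mulrDl.
Qed.

Lemma qevZ c a t : disc_conv a -> upper_half t -> qev (fun n => c * a n) t = c * qev a t.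
Proof.
move=> ha ht; apply: qevE; apply: hsum_ext (hsumZ c (qevP ha ht)) => n.
by rewrite mulrA.
Qed.

Lemma psum_conv (A B : nat -> R[i]) N :
  psum (conv A B) N = \sum_(m < N) A m * psum B (N - m)%N.
Proof.
elim: N => [|N IH]; first by rewrite /psum !big_ord0.
rewrite psumS IH [RHS]big_ord_recr /= /conv [in LHS]big_ord_recr /= addrA -big_split /=.
have p1 : psum B 1 = B 0%N by rewrite /psum big_ord_recl big_ord0 addr0.
rewrite subSnn subnn p1; congr (_ + _).
apply: eq_bigr => m _; rewrite -mulrDr subSn ?psumS //.
exact: ltnW (ltn_ord m).
Qed.

Lemma conv_pow a b z n :
  conv a b n * z ^+ n = conv (fun k => a k * z ^+ k) (fun k => b k * z ^+ k) n.
Proof.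
rewrite /conv mulr_suml; apply: eq_bigr => i _.
have le : (i <= n)%N by rewrite -ltnS.
have -> : z ^+ n = z ^+ i * z ^+ (n - i) by rewrite -exprD subnKC.
ring.
Qed.

(** A truncated Cauchy product is a sum over m whose m-th term tends to A_m times the full sum of B,
    and is dominated by a multiple of |A_m|. *)
Lemma qev_conv a b t : disc_conv a -> disc_conv b -> upper_half t ->
  qev (conv a b) t = qev a t * qev b t.
Proof.
move=> ha hb ht; apply: qevE; set q := e2pi t.
have hq := cnorm_q_bounds ht.
have [B B0 hB] := disc_conv_rbound ha hq; have [C C0 hC] := disc_conv_rbound hb hq.
set A' := fun k => a k * q ^+ k; set B' := fun k => b k * q ^+ k.
have nA k : cnorm (A' k) = cnorm (a k) * cnorm q ^+ k by rewrite cnormM cnormX.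
have nB n : cnorm (psum B' n) <= C.
  apply: le_trans (cnorm_sum _ _ _) _; apply: le_trans (hC n); apply: ler_sum => i _.
  by rewrite cnormM cnormX.
pose U N m := if (m < N)%N then A' m * psum B' (N - m)%N else 0.
have hU : forall N m, cnorm (U N m) <= C * (cnorm (a m) * cnorm q ^+ m).
  move=> N m; rewrite /U; case: ifP => _.
    by rewrite cnormM nA mulrC ler_wpM2r // mulr_ge0 ?cnorm_ge0 ?exprn_ge0 ?cnorm_ge0.
  by rewrite cnorm0 mulr_ge0 // mulr_ge0 ?cnorm_ge0 ?exprn_ge0 ?cnorm_ge0.
have hl m : cvC (U^~ m) (A' m * qev b t).
  apply: (@cvC_near _ (fun N => A' m * psum B' (N - m)%N) _ _ m.+1) => [N mN|].
    by rewrite /U mN.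
  apply: cvCZ => e /(qevP hb ht)[n0 hn0]; exists (n0 + m)%N => n le.
  by apply: hn0; rewrite leq_subRL ?(leq_trans (leq_addl _ _) le) // addnC.
have hs N : hsum (U N) (psum (conv A' B') N).
  rewrite psum_conv.
  have -> : \sum_(m < N) A' m * psum B' (N - m)%N = psum (U N) N.
    by apply: eq_bigr => m _; rewrite /U ltn_ord.
  by apply: hsum_fin => m; rewrite /U ltnNge => ->.
have [z hz cz] := tannery hU (rboundZ C0 hB) hl hs.
have : hsum (fun m => A' m * qev b t) (qev a t * qev b t).
  by rewrite mulrC; apply: hsum_ext (hsumZ _ (qevP ha ht)) => m; rewrite mulrC.
move=> /(hsum_unique hz) <-; apply: cvC_ext cz => N.
by apply: eq_bigr => i _; rewrite conv_pow.
Qed.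

(** The lower bound for [1 - e2pi] covers fractions up to 1/2; larger ones are moved by -1. *)
Lemma e2pi_frac_neq1 (n m : nat) : (0 < n < m)%N -> e2pi (n%:R / m%:R : R[i]) != 1.
Proof.
move=> /andP[n0 nm]; have m0 : 0 < m%:R :> R by rewrite ltr0n (leq_trans _ nm).
have key x : `|x| <= 2^-1 -> x != 0 -> e2pi x%:C != 1.
  move=> hx x0; have := @one_sub_e2pi_lower R x%:C 0 hx; rewrite normr0 lexx => /(_ isT).
  rewrite mulr0 oppr0 expR0 mul1r cnorm_real => h.
  rewrite -subr_eq0 -opprB oppr_eq0 -cnorm_gt0; apply: lt_le_trans h.
  by rewrite normr_gt0.
have -> : (n%:R / m%:R : R[i]) = (n%:R / m%:R : R)%:C by rewrite rmorphM fmorphV !rmorph_nat.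
set x := n%:R / m%:R.
have x0 : 0 < x by rewrite divr_gt0 // ltr0n.
have x1 : x < 1 by rewrite ltr_pdivrMr // mul1r ltr_nat.
have [h|h] := leP x 2^-1; first by apply: key; rewrite ?gt_eqF // ger0_norm // ltW.
have -> : e2pi x%:C = e2pi (x - 1)%:C.
  by rewrite -[in LHS](subrK 1 x) rmorphD rmorph1 e2piD e2pi1 mulr1.
by apply: key; [rewrite ler0_norm; lra | rewrite lt_eqF //; lra].
Qed.

(** The mean of the n-th powers of the (m+1)-th roots of unity, a discrete substitute for
    integration over a period. *)
Definition root_avg (m n : nat) : R[i] :=
  m.+1%:R^-1 * \sum_(j < m.+1) e2pi (n%:R / m.+1%:R) ^+ j.

Lemma root_avg0 m : root_avg m 0 = 1.
Proof.
rewrite /root_avg mul0r e2pi0 (eq_bigr (fun=> 1)) => [|i _]; last by rewrite expr1n.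
by rewrite sumr_const card_ord mulVf // pnatr_eq0.
Qed.

Lemma root_avg_small m n : (0 < n <= m)%N -> root_avg m n = 0.
Proof.
move=> h; rewrite /root_avg; apply/eqP; rewrite mulf_eq0 orbC; apply/orP; left.
have h1 : e2pi (n%:R / m.+1%:R : R[i]) - 1 != 0 by rewrite subr_eq0 e2pi_frac_neq1.
rewrite -(mulrI_eq0 _ (mulfI h1)) -subrX1 -e2piM mulrC divfK ?pnatr_eq0 //.
by rewrite e2pi_nat subrr.
Qed.

Lemma cnorm_root_avg m n : cnorm (root_avg m n) <= 1.
Proof.
rewrite /root_avg cnormM cnormV cnorm_nat mulrC ler_pdivrMr ?ltr0n // mul1r.
apply: le_trans (cnorm_sum _ _ _) _.
rewrite -[X in _ <= X%:R](card_ord m.+1) -sum1_card natr_sum; apply: ler_sum => j _.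
rewrite cnormX cnorm_e2pi -(rmorph_nat (real_complex R)) Im_divn /= mul0r mulr0 oppr0.
by rewrite expR0 expr1n.
Qed.

(* The constant coefficient is the mean of the function over a horizontal line. *)
Lemma mean_value a y e : disc_conv a -> 0 < y ->
  (forall x, cnorm (qev a (x +i* y)) <= e) -> cnorm (a 0%N) <= e.
Proof.
move=> ha y0 he; have ht x : upper_half (x +i* y) by [].
set t := 0 +i* y; set q := e2pi t.
have [B B0 hB] := disc_conv_rbound ha (cnorm_q_bounds (ht 0)).
(* The n-th term of the mean of the series over m + 1 equidistant points; as m grows only n = 0
   survives. *)
pose U m n := a n * q ^+ n * root_avg m n.
have hU m n : cnorm (U m n) <= cnorm (a n) * cnorm q ^+ n.
  by rewrite cnormM cnormM cnormX ler_piMr ?cnorm_root_avg // mulr_ge0 ?exprn_ge0 ?cnorm_ge0.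
have hl n : cvC (U^~ n) (a n * delta0 R[i] n).
  apply: (@cvC_near _ (fun=> a n * delta0 R[i] n) _ _ n) (cvC_cst _) => m nm.
  rewrite /U /delta0; case: n nm => [|n] nm; first by rewrite root_avg0 expr0 !mulr1.
  by rewrite root_avg_small // !mulr0.
pose pt m (j : 'I_m.+1) : R[i] := (j%:R / m.+1%:R : R) +i* y.
have hs m : hsum (U m) (m.+1%:R^-1 * \sum_(j < m.+1) qev a (pt m j)).
  have := hsumZ m.+1%:R^-1 (hsum_fsum (index_enum 'I_m.+1) (fun j => qevP ha (ht (j%:R / m.+1%:R)))).
  apply: hsum_ext => n; rewrite /U /root_avg mulrCA; congr (_ * _).
  rewrite mulr_sumr; apply: eq_bigr => j _; rewrite -mulrA; congr (_ * _).
  rewrite -!e2piM -e2piD; congr e2pi.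
  rewrite (_ : (_ / _) +i* y = j%:R / m.+1%:R + t); first by ring.
  rewrite -(rmorph_nat (real_complex R)) -(rmorph_nat (real_complex R) m.+1) -fmorphV.
  by rewrite /t -rmorphM; apply/eqP; rewrite eq_complex /= addr0 add0r !eqxx.
have [z hz cz] := tannery hU hB hl hs.
have e1 : z = a 0%N.
  apply: (hsum_unique hz); rewrite -[a 0%N]addr0.
  have := @hsum_fin R (fun n => a n * delta0 R[i] n) 1.
  rewrite /psum big_ord_recl big_ord0 /delta0 mulr1; apply.
  by case=> // n _; rewrite mulr0.
rewrite -e1; apply: cvC_le cz => m.
rewrite cnormM cnormV cnorm_nat mulrC ler_pdivrMr ?ltr0n //.
apply: le_trans (cnorm_sum _ _ _) _.
apply: (@le_trans _ _ (\sum_(j < m.+1) e)); first by apply: ler_sum => j _; exact: he.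
by rewrite sumr_const card_ord mulr_natr.
Qed.

Lemma qev0 a t : disc_conv a -> upper_half t ->
  qev a t = a 0%N + e2pi t * qev (fun n => a n.+1) t.
Proof.
move=> ha ht; apply: qevE; have h := qevP (disc_conv_shift 1 ha) ht.
apply: (@cvC_near _ (fun N => a 0%N + e2pi t * psum (fun n => a n.+1 * e2pi t ^+ n) N.-1) _ _ 1).
  case=> // N _; rewrite /psum big_ord_recl expr0 mulr1 mulr_sumr; congr (_ + _).
  by apply: eq_bigr => i _; rewrite /bump /= exprS; ring.
apply: cvCD; first exact: cvC_cst.
apply: cvCZ => e /h[n0 hn0]; exists n0.+1 => -[|n] // le; exact: hn0.
Qed.

Lemma qev_eq0 a : disc_conv a -> (forall t, upper_half t -> qev a t = 0) ->
  forall n, a n = 0.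
Proof.
move=> ha h0 n; elim: n a ha h0 => [|n IH] a ha h0.
  apply/eqP; rewrite -cnorm_eq0; apply/eqP/le_anti; rewrite cnorm_ge0 andbT.
  by apply: (@mean_value _ 1) => // x; rewrite h0 ?cnorm0 // /upper_half /=.
have a0 : a 0%N = 0.
  apply/eqP; rewrite -cnorm_eq0; apply/eqP/le_anti; rewrite cnorm_ge0 andbT.
  by apply: (@mean_value _ 1) => // x; rewrite h0 ?cnorm0 // /upper_half /=.
apply: (IH (fun n => a n.+1)); first exact: (disc_conv_shift 1).
move=> t ht; have := h0 t ht; rewrite qev0 // a0 add0r => /eqP.
by rewrite mulf_eq0 (negbTE (e2pi_neq0 _)) => /eqP.
Qed.

Lemma qev_inj a b : disc_conv a -> disc_conv b ->
  (forall t, upper_half t -> qev a t = qev b t) -> forall n, a n = b n.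
Proof.
move=> ha hb h n; apply/eqP; rewrite -subr_eq0; apply/eqP.
have hb' := disc_convZ (-1) hb.
have := @qev_eq0 (fun n => a n + -1 * b n) (disc_convD ha hb') _ n.
rewrite mulN1r; apply => t ht.
by rewrite qevD // qevZ // h // mulN1r subrr.
Qed.

(** With f n = |e_n| s^n the recursion gives (n + 1) f(n + 1) <= M (f 0 + ... + f n). This allows
    only subexponential growth, so f n = O(g^n) for the chosen g = s / r > 1, which bounds |e_n|
    r^n. *)
Lemma disc_conv_fexp d : disc_conv d -> disc_conv (fexp d).
Proof.
move=> hd r hr; have [hs hx e] := mid_bounds hr.
set s := (r + 1) / 2 in hs hx e; set x := r / s in hx e.
have [M hM] := hd _ hs.
have M0 : 0 <= M by apply: le_trans (hM 0%N); rewrite expr0 mulr1 cnorm_ge0.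
have r0 : 0 < r by case/andP: hr.
have s0 : 0 < s by case/andP: hs.
have x0 : 0 < x by rewrite divr_gt0.
set g := x^-1; have g1 : 1 < g by rewrite invf_gt1 //; case/andP: hx.
have g0 : 0 < g by exact: lt_trans g1.
pose f n := cnorm (fexp d n) * s ^+ n.
have f0 n : 0 <= f n by rewrite mulr_ge0 ?cnorm_ge0 // exprn_ge0 // ltW.
have frec n : n.+1%:R * f n.+1 <= M * \sum_(i < n.+1) f i.
  rewrite /f mulrA -cnorm_nat -cnormM fexpS.
  apply: le_trans (ler_wpM2r (exprn_ge0 _ (ltW s0)) (cnorm_sum _ _ _)) _.
  rewrite mulr_suml mulr_sumr [leRHS](reindex_inj rev_ord_inj) /=; apply: ler_sum => i _.
  have le : (i <= n)%N by rewrite -ltnS.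
  rewrite cnormM subSS.
  have -> : s ^+ n.+1 = s ^+ i.+1 * s ^+ (n - i) by rewrite -exprD addSn subnKC.
  rewrite [leLHS](_ : _ = (cnorm (d i.+1) * s ^+ i.+1) * (cnorm (fexp d (n - i)%N) * s ^+ (n - i))); last by ring.
  by apply: ler_wpM2r; [exact: f0 | exact: hM].
(* From this index on, n + 1 outweighs the factor M / (g - 1) produced by the geometric sum. *)
set n0 := Num.bound (M / (g - 1)).
have gm : 0 < g - 1 by rewrite subr_gt0.
have hn0 n : (n0 <= n)%N -> M <= n.+1%:R * (g - 1).
  move=> le; rewrite -ler_pdivrMr //; apply: ltW.
  apply: lt_le_trans (archi_boundP _) _; first by rewrite divr_ge0 // ltW.
  by rewrite ler_nat (leq_trans le).
pose K := 1 + \sum_(i < n0.+1) f i.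
have K0 : 0 <= K by rewrite addr_ge0 // sumr_ge0.
have key n : f n <= K * g ^+ n.
  elim/ltn_ind: n => n IH.
  have [lt|ge] := ltnP n n0.+1.
    apply: (@le_trans _ _ K); last by rewrite ler_peMr // exprn_ege1 // ltW.
    rewrite /K (bigD1 (Ordinal lt)) //= addrCA lerDl addr_ge0 // sumr_ge0 //.
  case: n ge IH => // n ge IH.
  have n1 : 0 < n.+1%:R :> R by [].
  rewrite -(ler_pM2l n1); apply: le_trans (frec n) _.
  apply: (@le_trans _ _ (M * (K * (g ^+ n.+1 / (g - 1))))).
    rewrite ler_wpM2l //; apply: (@le_trans _ _ (\sum_(i < n.+1) K * g ^+ i)).
      by apply: ler_sum => i _; exact: IH.
    rewrite -mulr_sumr ler_wpM2l // ler_pdivlMr // mulrC -subrX1.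
    by rewrite gerBl.
  rewrite [leLHS](_ : _ = M / (g - 1) * (K * g ^+ n.+1)); last by ring.
  rewrite ler_wpM2r ?mulr_ge0 ?exprn_ge0 ?(ltW g0) //.
  by rewrite ler_pdivrMr //; exact: hn0.
exists K => n; rewrite e exprMn [leLHS](_ : _ = f n * x ^+ n); last by rewrite /f; ring.
rewrite -ler_pdivlMr ?exprn_gt0 //; apply: le_trans (key n) _.
by rewrite /g exprVn.
Qed.

End QSeries.

(** * Complex derivatives *)
Section Derivative.
Variable R : realType.
Implicit Types (f g : R[i] -> R[i]) (t z w h u : R[i]) (r s x y : R).

Notation tpi := ((2 * pi)%:C * 'i : R[i]).

(* Complex differentiability with a quadratic remainder: it is stable under all
   operations used here and avoids limits of difference quotients. *)
Definition cder f t (d : R[i]) := exists K delta : R, 0 < delta /\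
  forall h, cnorm h < delta -> exists2 u, cnorm u <= K & f (t + h) = f t + d * h + h ^+ 2 * u.

Lemma cderI f t d K delta : 0 < delta ->
  (forall h, cnorm h < delta -> cnorm (f (t + h) - f t - d * h) <= K * cnorm h ^+ 2) ->
  cder f t d.
Proof.
move=> d0 hf; exists (Num.max K 0), delta; split=> // h hh.
have [->|h0] := eqVneq h 0.
  by exists 0; rewrite ?cnorm0 ?le_max ?lexx ?orbT // addr0; ring.
exists ((f (t + h) - f t - d * h) / h ^+ 2); last first.
  by rewrite mulrCA mulfV ?expf_neq0 // mulr1; ring.
rewrite cnormM cnormV cnormX ler_pdivrMr ?exprn_gt0 ?cnorm_gt0 //.
by apply: le_trans (hf h hh) _; rewrite ler_wpM2r ?sqr_ge0 // le_max lexx.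
Qed.

Lemma cder_eq_der f t d d' : d = d' -> cder f t d -> cder f t d'.
Proof. by move=> ->. Qed.

Lemma cder_upper_eq f g t d : upper_half t -> (forall z, upper_half z -> f z = g z) ->
  cder f t d -> cder g t d.
Proof.
move=> ht fg [K [e [e0 he]]]; exists K, (Num.min e (complex.Im t)); split.
  by rewrite lt_min e0.
move=> h; rewrite lt_min => /andP[h1 h2]; have [u hu hf] := he h h1; exists u => //.
rewrite -!fg // /upper_half /= raddfD /=.
have := cnorm_Im h; have := ler_norm (- complex.Im h); rewrite normrN; lra.
Qed.

Lemma cder_cst z t : cder (fun=> z) t 0.
Proof.
exists 0, 1; split=> // h _; exists 0; rewrite ?cnorm0 //; ring.
Qed.

Lemma cder_id t : cder id t 1.
Proof. by exists 0, 1; split=> // h _; exists 0; rewrite ?cnorm0 //; ring. Qed.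

Lemma cderD f g t d d' : cder f t d -> cder g t d' -> cder (fun z => f z + g z) t (d + d').
Proof.
move=> [K [e [e0 he]]] [L [e' [e0' he']]]; exists (K + L), (Num.min e e').
split=> [|h]; rewrite lt_min ?e0 // => /andP[h1 h2].
have [u hu ->] := he h h1; have [v hv ->] := he' h h2; exists (u + v); last by ring.
exact: le_trans (cnormD _ _) (lerD hu hv).
Qed.

Lemma cnorm_ge_le (K : R) u : cnorm u <= K -> 0 <= K.
Proof. exact: le_trans (cnorm_ge0 u). Qed.

Lemma cderM f g t d d' : cder f t d -> cder g t d' ->
  cder (fun z => f z * g z) t (d * g t + f t * d').
Proof.
move=> [K [e [e0 he]]] [L [e' [e0' he']]].
exists (K * (cnorm (g t) + cnorm d' + L) + (cnorm (f t) + cnorm d) * L + cnorm d * cnorm d'),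
  (Num.min 1 (Num.min e e')).
split=> [|h]; rewrite !lt_min ?ltr01 ?e0 // => /and3P[h0 h1 h2].
have [u hu ->] := he h h1; have [v hv ->] := he' h h2.
have K0 := cnorm_ge_le hu; have L0 := cnorm_ge_le hv; have n0 := cnorm_ge0 h.
exists (u * (g t + d' * h + h ^+ 2 * v) + (f t + d * h) * v + d * d'); last by ring.
have b1 w c : cnorm w <= c -> cnorm (w * h) <= c.
  move=> hw; rewrite cnormM; apply: le_trans hw; rewrite ler_piMr ?cnorm_ge0 //; exact: ltW.
apply: le_trans (cnormD _ _) _; apply: lerD; last by rewrite cnormM.
apply: le_trans (cnormD _ _) _; apply: lerD; rewrite cnormM.
  apply: ler_pM; rewrite ?cnorm_ge0 //.
  apply: le_trans (cnormD _ _) _; apply: lerD.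
    by apply: le_trans (cnormD _ _) _; rewrite lerD2l; exact: b1.
  by rewrite mulrC expr2 mulrA; exact: (b1 _ _ (b1 _ _ hv)).
apply: ler_pM; rewrite ?cnorm_ge0 //.
by apply: le_trans (cnormD _ _) _; rewrite lerD2l; exact: b1.
Qed.

Lemma cderZ c f t d : cder f t d -> cder (fun z => c * f z) t (c * d).
Proof.
by move=> hf; apply: cder_eq_der (cderM (cder_cst c t) hf); ring.
Qed.

Lemma cder_comp f g t d d' : cder f t d -> cder g (f t) d' ->
  cder (fun z => g (f z)) t (d' * d).
Proof.
move=> [K [e [e0 he]]] [L [e' [e0' he']]].
set M := cnorm d + `|K| + 1.
have M0 : 0 < M by rewrite ltr_wpDl // addr_ge0 ?cnorm_ge0.
exists (cnorm d' * K + M ^+ 2 * L), (Num.min 1 (Num.min e (e' / M))).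
split=> [|h]; rewrite !lt_min ?ltr01 ?e0 ?divr_gt0 // => /and3P[h0 h1 h2].
have [u hu ->] := he h h1; have K0 := cnorm_ge_le hu.
have hm : cnorm (d + h * u) <= M.
  apply: le_trans (cnormD _ _) _; rewrite /M ger0_norm // -addrA lerD2l.
  rewrite cnormM; apply: (@le_trans _ _ (1 * K)); last by rewrite mul1r lerDl.
  by apply: ler_pM; rewrite ?cnorm_ge0 ?(ltW h0).
have hk : cnorm (d * h + h ^+ 2 * u) < e'.
  have -> : d * h + h ^+ 2 * u = h * (d + h * u) by ring.
  rewrite cnormM; apply: (@le_lt_trans _ _ (cnorm h * M)).
    by rewrite ler_wpM2l ?cnorm_ge0.
  by rewrite -ltr_pdivlMr.
rewrite -addrA; have [v hv ->] := he' _ hk; have L0 := cnorm_ge_le hv.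
exists (d' * u + (d + h * u) ^+ 2 * v); last by ring.
apply: le_trans (cnormD _ _) _; apply: lerD; rewrite cnormM.
  by rewrite ler_wpM2l ?cnorm_ge0.
apply: ler_pM; rewrite ?cnorm_ge0 // cnormX.
by apply: lerXn2r; rewrite ?nnegrE ?cnorm_ge0 ?(ltW M0).
Qed.

Lemma cder_inv z : z != 0 -> cder (fun z => z^-1) z (- z ^- 2).
Proof.
move=> z0; have n0 : 0 < cnorm z by rewrite cnorm_gt0.
exists (cnorm (z ^- 2) * (2 / cnorm z)), (cnorm z / 2); split; first by rewrite divr_gt0.
move=> h hh; have hz : cnorm z / 2 <= cnorm (z + h).
  have := cnorm_subr z (- h); rewrite opprK cnormN; lra.
have zh : z + h != 0 by rewrite -cnorm_gt0; apply: lt_le_trans hz; rewrite divr_gt0.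
exists (z ^- 2 * (z + h)^-1); last by field; rewrite z0 zh.
rewrite cnormM ler_wpM2l ?cnorm_ge0 // cnormV -invf_div lef_pV2 ?posrE ?divr_gt0 //.
by rewrite cnorm_gt0.
Qed.

Lemma cderV f t d : f t != 0 -> cder f t d -> cder (fun z => (f z)^-1) t (- d / f t ^+ 2).
Proof.
move=> f0 hf; apply: cder_eq_der (cder_comp hf (cder_inv f0)); ring.
Qed.

Lemma cderX f t d n : cder f t d -> cder (fun z => f z ^+ n) t (n%:R * f t ^+ n.-1 * d).
Proof.
move=> hf; elim: n => [|n IH].
  by apply: cder_eq_der (cder_cst 1 t); rewrite !mul0r.
have h := cderM hf IH; have -> : (fun z => f z ^+ n.+1) = (fun z => f z * f z ^+ n).
  by apply/funext => z; rewrite exprS.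
apply: cder_eq_der h; case: n {IH} => [|n] /=; first by rewrite !expr0; ring.
rewrite exprS -[n.+2%:R]natr1; ring.
Qed.

Lemma cder_exprz (k : int) t : t != 0 -> cder (fun z => z ^ k) t (k%:~R * t ^ k / t).
Proof.
move=> t0; case: k => n.
  have h : cder (fun z => z ^ Posz n) t _ := cderX n (cder_id t).
  apply: cder_eq_der h; rewrite -exprnP.
  case: n => [|n]; first by rewrite !mul0r.
  by rewrite /= exprS mulr1 -pmulrn; field.
have h0 : t ^+ n.+1 != 0 by rewrite expf_neq0.
have h : cder (fun z => z ^ Negz n) t _ :=
  cderV (f := fun z => z ^+ n.+1) h0 (cderX n.+1 (cder_id t)).
apply: cder_eq_der h.
rewrite mulr1 /= NegzE -exprnN mulrNz -pmulrn.
have -> : t ^+ n.+1 = t * t ^+ n by rewrite exprS.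
have h1 : t ^+ n != 0 by rewrite expf_neq0.
by field; rewrite t0 h1.
Qed.

Lemma cder_e2piZ c t : cder (fun z => e2pi (c * z)) t (tpi * c * e2pi (c * t)).
Proof.
set K := 4 * (2 * pi * cnorm c) ^+ 2 * expR (2 * pi * cnorm c) * cnorm (e2pi (c * t)).
have K0 : 0 <= 2 * pi * cnorm c by rewrite !mulr_ge0 ?pi_ge0 ?cnorm_ge0.
apply: (@cderI _ _ _ K 1) => // h /ltW h1.
rewrite mulrDr e2piD (_ : _ - _ - _ =
   (e2pi (c * h) - 1 - tpi * (c * h)) * e2pi (c * t)); last by ring.
rewrite cnormM; have := e2pi_bound (c * h); rewrite cnormM.
have -> : 2 * pi * (cnorm c * cnorm h) = 2 * pi * cnorm c * cnorm h by ring.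
set W := 2 * pi * cnorm c in K0 *; set A := cnorm (_ - _) => hA.
have -> : K * cnorm h ^+ 2 = 4 * (W * cnorm h) ^+ 2 * expR W * cnorm (e2pi (c * t)).
  by rewrite /K -/W; ring.
rewrite ler_wpM2r ?cnorm_ge0 //; apply: le_trans hA _.
rewrite ler_wpM2l //; first by rewrite mulr_ge0 // sqr_ge0.
by rewrite ler_expR ler_piMr.
Qed.

Lemma cder_qev a t : disc_conv a -> upper_half t ->
  cder (qev a) t (tpi * qev (fun n => n%:R * a n) t).
Proof.
move=> ha ht; set y := complex.Im t; have y0 : 0 < y by exact: ht.
have ha1 := disc_conv_theta ha; have ha2 := disc_conv_theta ha1.
set r := expR (- (pi * y)).
have hr : 0 < r < 1 by rewrite expR_gt0 -expR0 ltr_expR oppr_lt0 mulr_gt0 ?pi_gt0.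
have [B B0 hB] := disc_conv_rbound ha2 hr.
have y2 : 0 < y / 2 by rewrite divr_gt0.
apply: (@cderI _ _ _ (4 * (2 * pi) ^+ 2 * B) _ y2) => h hh.
have ht' : upper_half (t + h).
  rewrite /upper_half /= raddfD /= -/y.
  have := cnorm_Im h; have := ler_norm (- complex.Im h); rewrite normrN; lra.
have hs := hsumB (hsumB (qevP ha ht') (qevP ha ht)) (hsumZ (tpi * h) (qevP ha1 ht)).
have e : qev a (t + h) - qev a t - tpi * qev (fun n => n%:R * a n) t * h =
  qev a (t + h) - qev a t - tpi * h * qev (fun n => n%:R * a n) t.
  by rewrite [X in _ - X]mulrAC.
rewrite e; have P0 : 0 <= 4 * (2 * pi) ^+ 2 * cnorm h ^+ 2.
  by rewrite mulr_ge0 ?sqr_ge0 // mulr_ge0 ?sqr_ge0.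
have -> : 4 * (2 * pi) ^+ 2 * B * cnorm h ^+ 2 = 4 * (2 * pi) ^+ 2 * cnorm h ^+ 2 * B by ring.
apply: (hsum_le _ (rboundZ P0 hB) hs) => n.
rewrite -!e2piM mulrDr e2piD.
have alg (c X Y N T : R[i]) : c * (X * Y) - c * X - T * h * (N * c * X) =
  c * X * (Y - 1 - T * (N * h)) by ring.
rewrite alg.
rewrite [leLHS]cnormM [cnorm (a n * _)]cnormM.
have := e2pi_bound (n%:R * h); rewrite [cnorm (_ * h)]cnormM cnorm_nat => hb.
rewrite [cnorm (n%:R * _)]cnormM [cnorm (n%:R * _)]cnormM !cnorm_nat cnorm_e2pi Im_natM -/y.
apply: le_trans (ler_wpM2l _ hb) _; first by rewrite mulr_ge0 ?cnorm_ge0 ?expR_ge0.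
have er : r ^+ n = expR (n%:R * (- (pi * y))) by rewrite /r expRM_natl.
set E := expR (2 * pi * (n%:R * cnorm h)); set E' := expR (- (2 * pi * (n%:R * y))).
have EE : E' * E <= r ^+ n.
  rewrite -expRD er ler_expR.
  have : n%:R * pi * cnorm h <= n%:R * pi * (y / 2).
    by rewrite ler_wpM2l ?mulr_ge0 ?pi_ge0 //; exact: ltW.
  lra.
rewrite [leLHS](_ : _ = 4 * (2 * pi) ^+ 2 * cnorm h ^+ 2 * (n%:R * (n%:R * cnorm (a n)) * (E' * E))); last by ring.
apply: ler_wpM2l => //; apply: ler_wpM2l => //.
by rewrite mulr_ge0 // mulr_ge0 // cnorm_ge0.
Qed.

Lemma quadratic_increments_cst (phi : R -> R) :
  (forall s, exists K delta : R, 0 < delta /\ forall h : R, `|h| < delta ->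
     `|phi (s + h) - phi s| <= K * h ^+ 2) ->
  forall s s', phi s = phi s'.
Proof.
move=> hphi s s'; apply: is_derive_0_is_cst => x.
have [K [e [e0 he]]] := hphi x.
have cv : (fun h : R => h^-1 *: (phi (h *: (1 : R) + x) - phi x)) @ 0^' --> (0 : R).
  apply/cvgrPdist_lt => eps eps0; near=> h.
  rewrite sub0r normrN normrZ normfV.
  have h0 : h != 0 by near: h; exact: nbhs_dnbhs_neq.
  have hh : `|h| < e by near: h; apply: dnbhs0_lt.
  have he2 : `|h| < eps / (`|K| + 1) by near: h; apply: dnbhs0_lt; rewrite divr_gt0 // ltr_wpDl.
  have n0 : 0 < `|h| by rewrite normr_gt0.
  have -> : h *: (1 : R) + x = x + h by rewrite -[h *: 1]/(h * 1) mulr1 addrC.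
  rewrite mulrC ltr_pdivrMr //.
  apply: le_lt_trans (he h hh) _.
  rewrite ltr_pdivlMr ?ltr_wpDl // in he2.
  apply: (@le_lt_trans _ _ (`|K| * `|h| ^+ 2)).
    by rewrite real_normK ?num_real // ler_wpM2r ?sqr_ge0 // ler_norm.
  rewrite expr2 mulrA ltr_pM2r //; nra.
apply: DeriveDef; first by apply/cvg_ex; exists 0.
exact: cvg_lim.
Unshelve. all: by end_near. Qed.

(** Two points are joined by a horizontal line and a vertical one parametrized by [expR], both
    indexed by all of R and contained in the half-plane. Along each, the real and imaginary parts of
    f have quadratic increments. *)
Lemma cder_zero_cst f : (forall t, upper_half t -> cder f t 0) ->
  forall t t', upper_half t -> upper_half t' -> f t = f t'.
Proof.
move=> hf.
have key (p : R -> R[i]) : (forall s, upper_half (p s)) ->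
   (forall s, exists L : R, forall h : R, `|h| < 1 -> cnorm (p (s + h) - p s) <= L * `|h|) ->
   forall s s', f (p s) = f (p s').
  move=> hp hL s s'.
  suff H (g : R[i] -> R) : (forall z, `|g z| <= cnorm z) -> (forall z w, g (z - w) = g z - g w) ->
      g (f (p s)) = g (f (p s')).
    apply/eqP; rewrite eq_complex (H _ (@cnorm_Re R)) ?(H _ (@cnorm_Im R)) ?eqxx //.
      by move=> z w; rewrite raddfB.
    by move=> z w; rewrite raddfB.
  move=> hg gB; apply: (@quadratic_increments_cst (fun s => g (f (p s)))) => {}s.
  have [K [e [e0 he]]] := hf _ (hp s); have [L hLs] := hL s.
  pose L' := `|L| + 1; have L0 : 0 < L' by rewrite ltr_wpDl.
  exists (L' ^+ 2 * K), (Num.min 1 (e / L')); split; first by rewrite lt_min ltr01 divr_gt0.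
  move=> h; rewrite lt_min => /andP[h1 h2].
  have hd : cnorm (p (s + h) - p s) <= L' * `|h|.
    apply: le_trans (hLs h h1) _; rewrite ler_wpM2r //.
    by apply: le_trans (ler_norm _) _; rewrite lerDl.
  have hd2 : cnorm (p (s + h) - p s) < e.
    by apply: le_lt_trans hd _; rewrite mulrC -ltr_pdivlMr.
  have [u hu hfu] := he _ hd2; have K0 := cnorm_ge_le hu.
  rewrite -gB; apply: le_trans (hg _) _.
  have -> : p (s + h) = p s + (p (s + h) - p s) by rewrite [RHS]addrC subrK.
  rewrite hfu mul0r addr0 [X in cnorm X](_ : _ = (p (s + h) - p s) ^+ 2 * u); last by ring.
  rewrite cnormM cnormX.
  rewrite [leRHS](_ : _ = (L' * `|h|) ^+ 2 * K); last first.
    by rewrite exprMn real_normK ?num_real //; ring.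
  apply: ler_pM; rewrite ?sqr_ge0 ?cnorm_ge0 //.
  by apply: lerXn2r; rewrite ?nnegrE ?cnorm_ge0 ?mulr_ge0 ?(ltW L0).
case=> x y [x' y'] ht ht'; rewrite /upper_half /= in ht ht'.
have -> : f (x +i* y) = f (x' +i* y).
  apply: (key (fun s => s +i* y)) => // s; exists 1 => h _.
  apply: le_trans (cnorm_ReIm _) _.
  by rewrite /= subrr normr0 addr0 mul1r addrC addKr.
rewrite -[y]lnK ?posrE // -[y']lnK ?posrE //.
apply: (key (fun s => x' +i* expR s)) => s; first exact: expR_gt0.
exists (expR s * expR 1) => h h1; apply: le_trans (cnorm_ReIm _) _.
rewrite /= subrr normr0 add0r expRD -{2}[expR s]mulr1 -mulrBr normrM ger0_norm ?expR_ge0 //.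
rewrite -mulrA ler_wpM2l ?expR_ge0 //; apply: le_trans (expR_sub1_bound h) _.
by rewrite mulrC ler_wpM2r // ler_expR ltW.
Qed.

Lemma cder_derivable f t d : cder f t d -> derivable (f : R[i]^o -> R[i]^o) t 1.
Proof.
move=> [K [e [e0 he]]]; apply/cvg_ex; exists d.
apply/(@cvgrPdist_lt R[i] R[i]^o) => eps eps0.
have re : 0 < complex.Re eps by move: eps0; rewrite ltcE => /andP[].
have epsE : eps = (complex.Re eps)%:C.
  by move: eps0; rewrite ltcE => /andP[/eqP /= i0 _]; apply/eqP; rewrite eq_complex /= i0 !eqxx.
near=> h.
have h0 : h != 0 by near: h; exact: nbhs_dnbhs_neq.
have hh : cnorm h < e.
  by rewrite -ltcR -cnormE; near: h; apply: (@dnbhs0_lt R[i] R[i]^o); rewrite ltcR.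
have he2 : cnorm h < complex.Re eps / (`|K| + 1).
  by rewrite -ltcR -cnormE; near: h; apply: (@dnbhs0_lt R[i] R[i]^o); rewrite ltcR divr_gt0 // ltr_wpDl.
have [u hu hf] := he h hh; have K0 := cnorm_ge_le hu.
rewrite [X in f X - _](_ : _ = t + h); last by rewrite -[_ *: _]/(h * 1) mulr1 addrC.
rewrite hf.
have -> : d - h^-1 *: (f t + d * h + h ^+ 2 * u - f t) = - (h * u).
  by rewrite -[_ *: _]/(_ * _); field.
rewrite normrN epsE cnormE ltcR cnormM.
rewrite ger0_norm // ltr_pdivlMr ?ltr_wpDl // in he2.
apply: le_lt_trans he2; rewrite ler_wpM2l ?cnorm_ge0 //; apply: le_trans hu _.
by rewrite lerDl.
Unshelve. all: by end_near. Qed.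

End Derivative.

(** The index m stands for the divisor m + 1; [f] is the involution sending a divisor to its
    codivisor. *)
Lemma div_ord_invol (k : nat) (m : 'I_k.+1) : (m.+1 %| k.+1)%N ->
  let f (m : 'I_k.+1) := inord (k.+1 %/ m.+1).-1 : 'I_k.+1 in
  [/\ f (f m) = m, ((f m).+1 %| k.+1)%N & (f m).+1 = (k.+1 %/ m.+1)%N].
Proof.
move=> dv f.
have pos : (0 < k.+1 %/ m.+1)%N by rewrite divn_gt0 // ltn_ord.
have lt : ((k.+1 %/ m.+1).-1 < k.+1)%N by rewrite prednK // leq_div.
have vf : (f m).+1 = (k.+1 %/ m.+1)%N by rewrite /f inordK // prednK.
have dv' : (k.+1 %/ m.+1 %| k.+1)%N by apply/dvdnP; exists m.+1; rewrite mulnC divnK.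
split; rewrite ?vf //; apply: val_inj.
rewrite (_ : f (f m) = inord (k.+1 %/ (k.+1 %/ m.+1)).-1); last by rewrite -vf.
rewrite /= inordK.
  by rewrite -[X in (X %/ _).-1](divnK dv) mulKn.
by rewrite prednK ?leq_div // divn_gt0 // dvdn_leq.
Qed.

Lemma sum_divisors_sym (V : nmodType) (k : nat) (F : nat -> V) :
  \sum_(m < k | (m.+1 %| k)%N) F m.+1 = \sum_(m < k | (m.+1 %| k)%N) F (k %/ m.+1)%N.
Proof.
case: k => [|k]; first by rewrite !big_ord0.
pose f (m : 'I_k.+1) := inord (k.+1 %/ m.+1).-1 : 'I_k.+1.
rewrite (reindex_onto f f) => [|m /div_ord_invol[] //].
apply: eq_big => m.
  apply/andP/idP => [[h1 /eqP h2]|h]; last first.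
    by have [h1 h2 _] := div_ord_invol h; split; [exact: h2 | apply/eqP; exact: h1].
  by rewrite -h2; have [] := div_ord_invol h1.
move=> /andP[h1 /eqP h2].
have h3 : (f (f m)).+1 = (k.+1 %/ (f m).+1)%N by have [] := div_ord_invol h1.
rewrite h2 in h3; congr F; rewrite h3 -[X in (X %/ _)%N](divnK h1) mulKn //.
by rewrite -h3.
Qed.

(** * Divisor sums as the q-expansion of E_2 *)

Section DeltaPower.
Variable R : realType.
Implicit Types (t z w : R[i]) (x y : rat).

Notation tpi := ((2 * pi)%:C * 'i : R[i]).

Lemma disc_conv_one : disc_conv (fun=> 1 : R[i]).
Proof.
move=> r /andP[r0 r1]; exists 1 => n; rewrite cnorm1 mul1r.
by rewrite exprn_ile1 ?ltW.
Qed.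

Lemma qev_delta0 t : upper_half t -> qev (delta0 R[i]) t = 1.
Proof.
move=> ht; apply: qevE.
have := @hsum_fin R (fun n => delta0 R[i] n * e2pi t ^+ n) 1.
rewrite /psum big_ord_recl big_ord0 /delta0 expr0 mul1r addr0; apply.
by case=> // n _; rewrite mul0r.
Qed.

Lemma ext_qev (a b : nat -> R[i]) t : (forall n, a n = b n) -> qev a t = qev b t.
Proof. by move=> /funext ->. Qed.

Lemma qev_addn (a : nat -> R[i]) t n : qev a (t + n%:R) = qev a t.
Proof. by rewrite /qev e2pi_addn. Qed.

(** The coefficients of the series a(X^M). *)
Definition stride (V : nmodType) (M : nat) (a : nat -> V) (n : nat) : V :=
  if (M %| n)%N then a (n %/ M)%N else 0.

(** [(n + M) %/ M.+1] counts the multiples of M + 1 below n. *)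
Lemma psum_stride (a : nat -> R[i]) M n :
  psum (stride M.+1 a) n = psum a ((n + M) %/ M.+1).
Proof.
elim: n => [|n IH].
  by rewrite add0n divn_small // /psum !big_ord0.
rewrite psumS IH /stride addSn divnS //.
case: (boolP (M.+1 %| n)%N) => h.
  have /dvdnP[k ->] := h; rewrite mulnK // divnMDl // divn_small // addn0.
  by rewrite -addnS dvdn_addr ?dvdn_mull // dvdnn add1n psumS.
suff -> : (M.+1 %| (n + M).+1)%N = false by rewrite add0n addr0.
by rewrite -addnS dvdn_addl //; exact: negbTE.
Qed.

Lemma hsum_stride (a : nat -> R[i]) M z : hsum a z -> hsum (stride M.+1 a) z.
Proof.
move=> ha e /ha[n0 hn0]; exists (n0 * M.+1)%N => n le.
rewrite psum_stride; apply: hn0; rewrite leq_divRL //.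
by apply: leq_trans le _; rewrite leq_addr.
Qed.

Lemma stride_pow (a : nat -> R[i]) M (q : R[i]) n :
  stride M.+1 a n * q ^+ n = stride M.+1 (fun k => a k * (q ^+ M.+1) ^+ k) n.
Proof.
rewrite /stride; case: ifP => [h|]; last by rewrite mul0r.
by rewrite -exprM mulnC divnK.
Qed.

Lemma disc_conv_stride (a : nat -> R[i]) M : disc_conv a -> disc_conv (stride M.+1 a).
Proof.
move=> ha r /andP[r0 r1].
have hr : 0 < r ^+ M.+1 < 1 by rewrite exprn_gt0 // exprn_ilt1 // ltW.
have [K hK] := ha _ hr; exists K => n; rewrite /stride; case: ifP => [h|_].
  by apply: le_trans (hK (n %/ M.+1)%N); rewrite -exprM mulnC divnK.
rewrite cnorm0 mul0r; apply: le_trans (hK 0%N).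
by rewrite expr0 mulr1 cnorm_ge0.
Qed.

Lemma upper_natM t n : upper_half t -> upper_half (n.+1%:R * t).
Proof. by rewrite /upper_half /= => h; rewrite Im_natM mulr_gt0. Qed.

Lemma qev_stride (a : nat -> R[i]) M t : disc_conv a -> upper_half t ->
  qev (stride M.+1 a) t = qev a (M.+1%:R * t).
Proof.
move=> ha ht; apply: qevE; have := hsum_stride M (qevP ha (upper_natM M ht)).
by apply: hsum_ext => n; rewrite stride_pow e2piM.
Qed.

(** q / (1 - q)^2 is q times the square of the geometric series. *)
Lemma cosec2_qev t : upper_half t -> qev (fun n => n%:R) t = cosec2 t.
Proof.
move=> ht; have h1 := disc_conv_one.
have hth : disc_conv (fun n => n%:R : R[i]).
  by apply: disc_conv_ext (disc_conv_theta h1) => n; rewrite mulr1.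
have q1 : 1 - e2pi t != 0.
  by rewrite subr_eq0 eq_sym e2pi_neq1_Im // gt_eqF.
have g : qev (fun=> 1) t = (1 - e2pi t)^-1.
  have := qev0 h1 ht; set q := qev _ _ => e.
  by apply: (mulfI q1); rewrite mulfV // mulrBl mul1r {1}e addrK.
have e : qev (fun n => n.+1%:R) t = qev (fun=> 1) t * qev (fun=> 1) t.
  rewrite -qev_conv //; apply: ext_qev => n.
  rewrite /conv (eq_bigr (fun=> 1)) => [|i _]; last by rewrite mulr1.
  by rewrite sumr_const card_ord.
by rewrite qev0 // add0r e g /cosec2 expr2 invfM.
Qed.

(* Minus 24 times the sum of the divisors of k: the logarithmic derivative of
   the product of the (1 - X^m)^24. *)
Definition dsigma (k : nat) : rat := 24 * dlog_product (fun=> 1) k.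

Lemma dsigma0 : dsigma 0 = 0.
Proof. by rewrite /dsigma /dlog_product big_ord0 mulr0. Qed.

Lemma dsigmaE k : dsigma k = - 24 * \sum_(m < k | (m.+1 %| k)%N) (k %/ m.+1)%:R.
Proof.
rewrite -(sum_divisors_sym k (fun n => n%:R)) mulNr -mulrN; congr (_ * _).
rewrite /dlog_product [in RHS]big_mkcond -sumrN; apply: eq_bigr => m _ /=.
rewrite mul1r /dlog_factor; case: k m => [[]//|k] m /=.
by case: ifP; rewrite ?oppr0.
Qed.

Definition dsigmaC (k : nat) : R[i] := ratr (dsigma k).

Lemma dsigmaC0 : dsigmaC 0 = 0.
Proof. by rewrite /dsigmaC dsigma0 rmorph0. Qed.

Lemma dsigmaCE k : dsigmaC k = - 24 * \sum_(m < k) stride m.+1 (fun n => n%:R) k.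
Proof.
rewrite /dsigmaC dsigmaE rmorphM rmorphN rmorph_nat rmorph_sum /= big_mkcond.
congr (_ * _); apply: eq_bigr => m _; rewrite /stride.
by case: ifP => // _; rewrite rmorph_nat.
Qed.

Lemma disc_conv_dsigma : disc_conv dsigmaC.
Proof.
have h := disc_convZ 24 (disc_conv_theta (disc_conv_theta disc_conv_one)).
apply: disc_conv_le h => n; rewrite dsigmaCE !cnormM cnormN !cnorm_nat cnorm1 mulr1.
rewrite ler_wpM2l //; apply: le_trans (cnorm_sum _ _ _) _.
apply: (@le_trans _ _ (\sum_(m < n) (n%:R : R))); last first.
  by rewrite sumr_const card_ord mulr_natr.
apply: ler_sum => m _; rewrite /stride; case: ifP => _; last by rewrite cnorm0.
by rewrite cnorm_nat ler_nat leq_div.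
Qed.

(** The Lambert series is rearranged by powers of q. The truncations run over the square m, k < N;
    the m-th inner sum is O(|q|^m) uniformly in N, which gives the majorant. *)
Lemma qev_dsigma t : upper_half t -> qev dsigmaC t = - 24 * eis_sum t.
Proof.
move=> ht.
have h1 := disc_conv_one.
have hth : disc_conv (fun n => n%:R : R[i]).
  by apply: disc_conv_ext (disc_conv_theta h1) => n; rewrite mulr1.
rewrite -[RHS]/(- 24 * eis_sum t); apply: qevE.
pose q := e2pi t; pose r := cnorm q; have hr : 0 < r < 1 := cnorm_q_bounds ht.
case/andP: (hr) => r0 r1.
pose T m k := stride m.+1 (fun n => n%:R : R[i]) k * q ^+ k.
pose U N m := if (m < N)%N then psum (T m) N else 0.
have [B B0 hB] := disc_conv_rbound hth hr.
have Tbound m N : cnorm (psum (T m) N) <= B / r * r ^+ m.+1.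
  have -> : psum (T m) N = psum (stride m.+1 (fun k => k%:R * (q ^+ m.+1) ^+ k)) N.
    by apply: eq_bigr => k _; exact: stride_pow.
  rewrite psum_stride; apply: le_trans (cnorm_sum _ _ _) _.
  set N' := (_ %/ _)%N; rewrite mulrAC ler_pdivlMr // mulr_suml.
  apply: le_trans (ler_wpM2r (exprn_ge0 m.+1 (ltW r0)) (hB N')).
  rewrite mulr_suml; apply: ler_sum => k _.
  rewrite cnormM !cnormX -/r -!mulrA -exprM -exprSr -exprD.
  case: (nat_of_ord k) => [|j]; last first.
    by rewrite cnorm_nat ler_wpM2l //; apply: ler_wiXn2l; rewrite ?(ltW r0) ?(ltW r1) //; lia.
  by rewrite cnorm0 !mul0r.
have hU N m : cnorm (U N m) <= B * r ^+ m.
  rewrite /U; case: ifP => _; last by rewrite cnorm0 mulr_ge0 // exprn_ge0 // ltW.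
  apply: le_trans (Tbound m N) _; rewrite exprS mulrA divfK ?gt_eqF //.
have hl m : cvC (U^~ m) (cosec2 (m.+1%:R * t)).
  apply: (@cvC_near _ (psum (T m)) _ _ m.+1) => [N mN|]; first by rewrite /U mN.
  rewrite -cosec2_qev; last exact: upper_natM.
  by rewrite -qev_stride //; apply: qevP => //; exact: disc_conv_stride.
have hs N : hsum (U N) (psum (fun k => (\sum_(m < k) stride m.+1 (fun n => n%:R) k) * q ^+ k) N).
  have -> : psum (fun k => (\sum_(m < k) stride m.+1 (fun n => n%:R) k) * q ^+ k) N = psum (U N) N.
    rewrite /psum [RHS](eq_bigr (fun m : 'I_N => \sum_(k < N) T m k)) => [|m _]; last first.
      by rewrite /U ltn_ord.
    rewrite exchange_big /=; apply: eq_bigr => k _; rewrite mulr_suml.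
    have kN := ltnW (ltn_ord k).
    rewrite -!(big_mkord xpredT (fun m => T m k)) (big_cat_nat (leq0n k) kN) /=.
    rewrite [X in _ = _ + X]big_nat_cond [X in _ = _ + X]big1 ?addr0 // => m.
    rewrite andbT => /andP[km _]; rewrite /T /stride; case: ifP => [h|]; last by rewrite mul0r.
    case: (posnP k) => [->|k0]; first by rewrite div0n mul0r.
    by have := dvdn_leq k0 h; rewrite ltnNge km.
  by apply: hsum_fin => m; rewrite /U ltnNge => ->.
have hr' : 0 <= r < 1 by rewrite r1 ltW.
have [z hz cz] := tannery hU (rboundZ B0 (geometric_rbound hr')) hl hs.
have [he _] := eis_sum_lim ht; rewrite (hsum_unique he hz).
apply: cvC_ext (cvCZ (- 24) cz) => N; rewrite /psum mulr_sumr; apply: eq_bigr => k _.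
by rewrite dsigmaCE mulrA.
Qed.

End DeltaPower.

(** * Rational powers of the discriminant *)
Section DeltaLaw.
Variable R : realType.
Implicit Types (t z w l : R[i]) (x y : rat).

Notation tpi := ((2 * pi)%:C * 'i : R[i]).

(* The q-expansion of (Delta / q)^x. *)
Definition delta_coef x : nat -> R[i] := fexp (fun k => ratr x * dsigmaC R k).

Lemma dsigmaCx0 x : ratr x * dsigmaC R 0 = 0.
Proof. by rewrite dsigmaC0 mulr0. Qed.

Lemma disc_conv_delta x : disc_conv (delta_coef x).
Proof. by apply: disc_conv_fexp; apply: disc_convZ; exact: disc_conv_dsigma. Qed.

Definition delta_pow x t : R[i] := e2pi (ratr x * t) * qev (delta_coef x) t.

Lemma delta_coefN x t : upper_half t ->
  qev (delta_coef x) t * qev (delta_coef (- x)) t = 1.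
Proof.
move=> ht; rewrite -qev_conv //; try exact: disc_conv_delta.
rewrite -(qev_delta0 ht); apply: ext_qev => n.
apply: etrans (fexpN n (dsigmaCx0 x)); apply: eq_conv => // i _.
by congr (fexp _ i); apply/funext => k; rewrite rmorphN mulNr.
Qed.

Lemma delta_coef_neq0 x t : upper_half t -> qev (delta_coef x) t != 0.
Proof.
move=> /(delta_coefN x) h; apply/eqP => h0; move: h; rewrite h0 mul0r => /eqP.
by rewrite eq_sym oner_eq0.
Qed.

Lemma delta_pow_neq0 x t : upper_half t -> delta_pow x t != 0.
Proof. by move=> ht; rewrite mulf_neq0 ?e2pi_neq0 ?delta_coef_neq0. Qed.

Lemma delta_pow_addn x t n : delta_pow x (t + n%:R) = e2pi (ratr x * n%:R) * delta_pow x t.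
Proof. by rewrite /delta_pow qev_addn mulrDr e2piD -mulrA mulrCA. Qed.

Lemma cder_delta_pow x t : upper_half t ->
  cder (delta_pow x) t (tpi * ratr x * E2 t * delta_pow x t).
Proof.
move=> ht; have hd := disc_conv_delta x; have hs := disc_convZ (ratr x) (@disc_conv_dsigma R).
apply: cder_eq_der (cderM (cder_e2piZ (ratr x) t) (cder_qev hd ht)).
have -> : qev (fun n => n%:R * delta_coef x n) t =
    ratr x * (- 24 * eis_sum t) * qev (delta_coef x) t.
  rewrite -qev_dsigma // -(qevZ _ (@disc_conv_dsigma R) ht).
  rewrite -qev_conv //; apply: ext_qev => n.
  by rewrite fexp_theta // dsigmaCx0.
have alg (T X E S Q : R[i]) :
  T * X * E * Q + E * (T * (X * (- 24 * S) * Q)) = T * X * (1 - 24 * S) * (E * Q) by ring.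
exact: alg.
Qed.

(** [l] plays the role of the logarithmic derivative f' / f. *)
Definition ldiff (f : R[i] -> R[i]) t l := cder f t (l * f t).

Lemma ldiffM f g t l l' : ldiff f t l -> ldiff g t l' ->
  ldiff (fun z => f z * g z) t (l + l').
Proof.
by move=> hf hg; apply: cder_eq_der (cderM hf hg); rewrite mulrDl -mulrA; congr (_ + _); rewrite mulrCA.
Qed.

Lemma ldiff_comp f g t l d : cder f t d -> ldiff g (f t) l ->
  ldiff (fun z => g (f z)) t (l * d).
Proof. by move=> hf hg; apply: cder_eq_der (cder_comp hf hg); rewrite mulrAC. Qed.

Lemma ldiff_eq f t l l' : l = l' -> ldiff f t l -> ldiff f t l'.
Proof. by move=> ->. Qed.

Lemma ldiff_delta x t : upper_half t -> ldiff (delta_pow x) t (tpi * ratr x * E2 t).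
Proof. exact: cder_delta_pow. Qed.

Lemma upper_half2 t : upper_half t -> upper_half (t / 2).
Proof. by rewrite /upper_half /= => h; rewrite Im_divn divr_gt0. Qed.

Lemma cder_scale c t : cder (fun z => c * z) t c.
Proof. by apply: cder_eq_der (cderZ c (cder_id t)); rewrite mulr1. Qed.

Lemma cder_half t : cder (fun z => z / 2) t 2^-1.
Proof.
have -> : (fun z : R[i] => z / 2) = (fun z => 2^-1 * z) by apply/funext => z; rewrite mulrC.
exact: cder_scale.
Qed.

Lemma cder_negV t : t != 0 -> cder (fun z => - z^-1) t (t ^- 2).
Proof.
move=> t0; have -> : (fun z : R[i] => - z^-1) = (fun z => -1 * z^-1).
  by apply/funext => z; rewrite mulN1r.
by apply: cder_eq_der (cderZ (-1) (cder_inv t0)); rewrite mulrN mulN1r opprK.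
Qed.

(** The quotient of the two sides of the law under S, with Delta^(-x) and Delta^(-y) standing for
    the divisions. *)
Definition inv_ratio x y (k : int) t : R[i] :=
  delta_pow x (- t^-1) * delta_pow y (- (t / 2)^-1) * t ^ (- k)
  * (delta_pow (- x) t * delta_pow (- y) (t / 2)).

(** The anomalies of the two E_2 terms contribute 12 x / t and 12 y / t, which cancel the -k / t of
    the automorphy factor. *)
Lemma inv_ratio_ldiff x y k t : upper_half t -> k%:~R = 12 * (x + y) ->
  ldiff (inv_ratio x y k) t 0.
Proof.
move=> ht hk; have t0 := upper_neq0 ht; have ht2 := upper_half2 ht.
have t20 := upper_neq0 ht2.
have T0 := tpi_neq0 R.
have h1 := ldiff_comp (cder_negV t0) (ldiff_delta x (upper_inv ht)).
have h2 := ldiff_comp (cder_half t)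
  (ldiff_comp (cder_negV t20) (ldiff_delta y (upper_inv ht2))).
have h3 : ldiff (fun z => z ^ (- k)) t ((- k)%:~R / t).
  by apply: cder_eq_der (cder_exprz (- k) t0); rewrite mulrAC.
have h4 := ldiff_delta (- x) ht.
have h5 := ldiff_comp (cder_half t) (ldiff_delta (- y) ht2).
apply: ldiff_eq (ldiffM (ldiffM (ldiffM h1 h2) h3) (ldiffM h4 h5)).
rewrite !E2_inv //.
have -> : (- k)%:~R = - (12 * (ratr x + ratr y)) :> R[i].
  by rewrite mulrNz -(ratr_int _ k) hk rmorphM rmorph_nat rmorphD.
have eN u : ratr (- u) = - ratr u :> R[i] by exact: rmorphN.
rewrite !eN; move: (E2 t) (E2 (t / 2)) (ratr x : R[i]) (ratr y : R[i]) (tpi) T0 => G H X Y T T0.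
by field; rewrite T0 t0.
Qed.

Lemma inv_ratio_neq0 x y k t : upper_half t -> inv_ratio x y k t != 0.
Proof.
move=> ht; have ht2 := upper_half2 ht; have t0 := upper_neq0 ht.
apply: mulf_neq0; last by apply: mulf_neq0; exact: delta_pow_neq0.
apply: mulf_neq0; last exact: expfz_neq0.
by apply: mulf_neq0; apply: delta_pow_neq0; exact: upper_inv.
Qed.

Lemma delta_pow_mulN x t : upper_half t -> delta_pow (- x) t * delta_pow x t = 1.
Proof.
move=> ht; rewrite /delta_pow (_ : _ * _ = (e2pi (ratr (- x) * t) * e2pi (ratr x * t)) *
  (qev (delta_coef x) t * qev (delta_coef (- x)) t)); last by rewrite mulrACA [X in _ * X]mulrC.
by rewrite delta_coefN // mulr1 -e2piD -mulrDl rmorphN addNr mul0r e2pi0.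
Qed.

(** A function with vanishing derivative is constant; its value at i serves as c, and only c != 0
    matters later. *)
Lemma delta_pow_inv x y (k : int) : k%:~R = 12 * (x + y) ->
  exists2 c : R[i], c != 0 & forall t, upper_half t ->
    t ^ (- k) * (delta_pow x (- t^-1) * delta_pow y (2 * - t^-1)) =
    c * (delta_pow x t * delta_pow y (t / 2)).
Proof.
move=> hk.
have hi : upper_half ('i : R[i]) by rewrite /upper_half /=.
exists (inv_ratio x y k 'i); first exact: inv_ratio_neq0.
move=> t ht; have ht2 := upper_half2 ht.
have -> : inv_ratio x y k 'i = inv_ratio x y k t.
  apply: cder_zero_cst => // z hz; apply: cder_eq_der (inv_ratio_ldiff hz hk).
  by rewrite mul0r.
have e : 2 * - t^-1 = - (t / 2)^-1 by rewrite invf_div mulrN.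
rewrite /inv_ratio e.
have alg (P Q T a b c d : R[i]) : a * b = 1 -> c * d = 1 ->
    T * (P * Q) = P * Q * T * (a * c) * (b * d).
  move=> h1 h2; rewrite [RHS](_ : _ = P * Q * T * (a * b) * (c * d)); last by ring.
  by rewrite h1 h2; ring.
exact: alg (delta_pow_mulN x ht) (delta_pow_mulN y ht2).
Qed.

End DeltaLaw.

(** * Matrices of SL_2(Z), their relations and generation by S and T *)

Lemma det_mx2 (K : comNzRingType) (A : 'M[K]_2) :
  (\det A = A 0 0 * A 1 1 - A 0 1 * A 1 0)%R.
Proof.
rewrite (expand_det_row _ ord0) !big_ord_recl big_ord0 /cofactor !det_mx11 !mxE /=.
have -> : lift 0 0 = 1 :> 'I_2 by apply: val_inj.
have -> : lift 1 0 = 0 :> 'I_2 by apply: val_inj.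
by rewrite expr0 expr1 mul1r addr0 mulN1r mulrN.
Qed.

Lemma mulmx2E (K : comNzRingType) (A B : 'M[K]_2) i j :
  ((A *m B) i j = A i 0 * B 0 j + A i 1 * B 1 j)%R.
Proof.
rewrite mxE !big_ord_recl big_ord0 addr0.
by have -> : lift 0 0 = 1 :> 'I_2 by apply: val_inj.
Qed.

Lemma ord2P (i : 'I_2) : i = 0%R \/ i = 1%R.
Proof. by case: i => [[|[|n]] // h]; [left|right]; apply: val_inj. Qed.

Lemma mk_sl2_subproof (a b c d : int) : (a * d - b * c = 1)%R ->
  \det (\matrix_(i < 2, j < 2) (if i == 0%R then (if j == 0%R then a else b)
                                else (if j == 0%R then c else d)) : 'M[int]_2) == 1%R.
Proof. by move=> h; rewrite det_mx2 !mxE /= h. Qed.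

Definition mk_sl2 a b c d (h : (a * d - b * c = 1)%R) := MkSL2Z (mk_sl2_subproof h).

Lemma sl2_ext (g h : SL2Z) : g 0%R 0%R = h 0%R 0%R -> g 0%R 1%R = h 0%R 1%R ->
  g 1%R 0%R = h 1%R 0%R -> g 1%R 1%R = h 1%R 1%R -> g = h.
Proof.
move=> h1 h2 h3 h4; apply: val_inj; apply/matrixP => i j /=.
by case: (ord2P i) => ->; case: (ord2P j) => ->.
Qed.

Lemma sl2_det (g : SL2Z) : (g 0 0 * g 1 1 - g 0 1 * g 1 0 = 1)%R.
Proof. by rewrite -det_mx2; exact/eqP/slmx_det. Qed.

Lemma sl2_mulE (g h : SL2Z) i j : ((g * h)%g i j = g i 0 * h 0 j + g i 1 * h 1 j)%R.
Proof. exact: mulmx2E. Qed.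

Lemma mk00 a b c d h : @mk_sl2 a b c d h 0%R 0%R = a. Proof. by rewrite /= mxE. Qed.
Lemma mk01 a b c d h : @mk_sl2 a b c d h 0%R 1%R = b. Proof. by rewrite /= mxE. Qed.
Lemma mk10 a b c d h : @mk_sl2 a b c d h 1%R 0%R = c. Proof. by rewrite /= mxE. Qed.
Lemma mk11 a b c d h : @mk_sl2 a b c d h 1%R 1%R = d. Proof. by rewrite /= mxE. Qed.
Definition mkE := (mk00, mk01, mk10, mk11).

Lemma sl2_1E : [/\ (1 : SL2Z)%g 0%R 0%R = 1%R, (1 : SL2Z)%g 0%R 1%R = 0%R,
  (1 : SL2Z)%g 1%R 0%R = 0%R & (1 : SL2Z)%g 1%R 1%R = 1%R].
Proof. by split; rewrite /= mxE. Qed.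

Lemma sl2_TE : [/\ sl2_T 0%R 0%R = 1%R, sl2_T 0%R 1%R = 1%R,
  sl2_T 1%R 0%R = 0%R & sl2_T 1%R 1%R = 1%R].
Proof. by split; rewrite /= mxE. Qed.

Lemma sl2_S_subproof : (0 * 0 - (-1) * 1 = 1 :> int)%R. Proof. by []. Qed.
Definition sl2_S := mk_sl2 sl2_S_subproof.

Lemma sl2_Tz_subproof (n : int) : (1 * 1 - n * 0 = 1 :> int)%R.
Proof. by rewrite mulr0 subr0. Qed.
Definition sl2_Tz n := mk_sl2 (sl2_Tz_subproof n).

Lemma sl2_TzD m n : (sl2_Tz m * sl2_Tz n = sl2_Tz (m + n)%R)%g.
Proof. apply: sl2_ext; rewrite !sl2_mulE !mkE; lia. Qed.

Lemma sl2_Tz1 : sl2_Tz 1%R = sl2_T.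
Proof. by case: sl2_TE => h1 h2 h3 h4; apply: sl2_ext; rewrite mkE. Qed.

Lemma sl2_Tz0 : sl2_Tz 0%R = 1%g.
Proof. by case: sl2_1E => h1 h2 h3 h4; apply: sl2_ext; rewrite mkE. Qed.

Lemma sl2_TzN m : (sl2_Tz (- m)%R = (sl2_Tz m)^-1)%g.
Proof.
by rewrite -[RHS]mulg1 -sl2_Tz0 -(subrr m) -sl2_TzD mulKg.
Qed.

Lemma sl2_S2 : [/\ (sl2_S * sl2_S)%g 0%R 0%R = (-1)%R, (sl2_S * sl2_S)%g 0%R 1%R = 0%R,
  (sl2_S * sl2_S)%g 1%R 0%R = 0%R & (sl2_S * sl2_S)%g 1%R 1%R = (-1)%R].
Proof. by split; rewrite sl2_mulE !mkE. Qed.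

Lemma sl2_S4 : (sl2_S * sl2_S * (sl2_S * sl2_S) = 1)%g.
Proof.
by case: sl2_1E => h1 h2 h3 h4; case: sl2_S2 => s1 s2 s3 s4;
  apply: sl2_ext; rewrite sl2_mulE ?s1 ?s2 ?s3 ?s4.
Qed.

Lemma sl2_S2_central g : (sl2_S * sl2_S * g = g * (sl2_S * sl2_S))%g.
Proof.
by case: sl2_S2 => s1 s2 s3 s4;
  apply: sl2_ext; rewrite !(sl2_mulE (_ * _)%g) !(sl2_mulE g) ?s1 ?s2 ?s3 ?s4; lia.
Qed.

Lemma sl2_STS : (sl2_S * sl2_T * sl2_S = sl2_T^-1 * sl2_S * sl2_T^-1)%g.
Proof.
rewrite -sl2_Tz1 -sl2_TzN; apply: sl2_ext; rewrite !sl2_mulE !mkE; lia.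
Qed.

(** Euclid's algorithm on the bottom row (c, d): multiplying by T^(-q) S on the right, with q = d
    div c, replaces c by d mod c. Inverses of S come from S^4 = 1. *)
Lemma sl2_ind (P : SL2Z -> Prop) : P sl2_S -> P sl2_T -> P (sl2_T^-1)%g ->
  (forall g h, P g -> P h -> P (g * h)%g) -> forall g, P g.
Proof.
move=> hS hT hT' hM.
have hS3 : P (sl2_S^-1)%g.
  have -> : (sl2_S^-1 = sl2_S * sl2_S * sl2_S)%g.
    by rewrite -[LHS]mulg1 -sl2_S4 -!mulgA mulKg.
  by apply: (hM _ _ _ hS); exact: hM.
have h1 : P 1%g by rewrite -(mulgV sl2_S); exact: hM.
have hTn (n : nat) : P (sl2_Tz n) /\ P (sl2_Tz (- (n : int))%R).
  elim: n => [|n [IH1 IH2]]; first by rewrite oppr0 sl2_Tz0.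
  split.
    have -> : (n.+1 : int) = (n%:Z + 1)%R by lia.
    by rewrite -sl2_TzD sl2_Tz1; exact: hM.
  have -> : (- (n.+1 : int) = - n%:Z + -1)%R by lia.
  by rewrite -sl2_TzD (sl2_TzN 1) sl2_Tz1; exact: hM.
have hTz (n : int) : P (sl2_Tz n).
  by case: n => n; [have [] := hTn n | rewrite NegzE; have [] := hTn n.+1].
move=> g; have [n] := ubnP `|g 1%R 0%R|%N; elim: n g => // n IH g hn.
have dg := sl2_det g.
have [c0|c0] := eqVneq (g 1%R 0%R) 0%R.
  have : (g 0 0 * g 1 1 = 1)%R by move: dg; rewrite c0 mulr0 subr0.
  move=> h; have [[a1 d1]|[a1 d1]] : (g 0 0 = 1 /\ g 1 1 = 1)%R \/ (g 0 0 = -1 /\ g 1 1 = -1)%R.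
    move: h; move: (g 0%R 0%R) (g 1%R 1%R) => x y h.
    have : (`|x| * `|y| == 1)%N by rewrite -abszM h.
    rewrite muln_eq1 => /andP[hx _].
    have [e|e] : x = 1%R \/ x = (-1)%R by lia.
      by left; move: h; rewrite e mul1r.
    by right; move: h; rewrite e mulN1r; lia.
  - have -> : g = sl2_Tz (g 0%R 1%R) by apply: sl2_ext; rewrite mkE.
    exact: hTz.
  - have -> : (g = sl2_S * sl2_S * sl2_Tz (- g 0%R 1%R)%R)%g.
      case: sl2_S2 => s1 s2 s3 s4; apply: sl2_ext; rewrite (sl2_mulE (_ * _)%g) !mkE ?s1 ?s2 ?s3 ?s4; lia.
    by apply: (hM _ _ _ (hTz _)); exact: hM.
pose q := (g 1%R 1%R %/ g 1%R 0%R)%Z.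
pose g' := (g * sl2_Tz (- q)%R * sl2_S)%g.
have e10 : g' 1%R 0%R = (g 1%R 1%R %% g 1%R 0%R)%Z.
  rewrite /g' sl2_mulE !(sl2_mulE g) !mkE /q.
  have := divz_eq (g 1%R 1%R) (g 1%R 0%R); lia.
have hg' : P g'.
  apply: IH; rewrite e10; apply: leq_trans (_ : (_ < `|g 1%R 0%R|)%N) _; last by rewrite -ltnS.
  by rewrite -ltz_nat gez0_abs ?modz_ge0 // ltz_mod.
have -> : (g = g' * sl2_S^-1 * (sl2_Tz (- q)%R)^-1)%g by rewrite /g' !mulgK.
by apply: (hM (g' * sl2_S^-1)%g); [exact: hM | rewrite -sl2_TzN; exact: hTz].
Qed.

Lemma ord3P (i : 'I_3) : [\/ i = 0, i = 1 | i = 2%:R].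
Proof.
case: i => [[|[|[|n]]] // h]; [apply: Or31|apply: Or32|apply: Or33]; exact: val_inj.
Qed.

Lemma sum3E (V : nmodType) (F : 'I_3 -> V) : \sum_i F i = F 0 + F 1 + F 2%:R.
Proof.
rewrite !big_ord_recl big_ord0 addr0 addrA; congr (_ + F _ + F _); exact: val_inj.
Qed.

Lemma mulmx3E (K : comNzRingType) m p (A : 'M[K]_(m, 3)) (B : 'M[K]_(3, p)) i j :
  (A *m B) i j = A i 0 * B 0 j + A i 1 * B 1 j + A i 2%:R * B 2%:R j.
Proof. by rewrite mxE sum3E. Qed.

(* The relations S^2 = e and STS = T^-1 S T^-1 for T = diag(a, b, -b). *)
Lemma trace_zero_entry (K : numFieldType) (a b e x y z p r s s01 s02 s12 s10 s21 : K) :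
  a != 0 -> b != 0 -> a != b -> a != - b -> s01 != 0 -> s02 != 0 -> s12 != 0 ->
  a * a * (a * x ^+ 2 + b * p - b * r) = x -> x ^+ 2 + p + r = e ->
  b * b * (a * p + b * y ^+ 2 - b * s) = y -> p + y ^+ 2 + s = e ->
  b * b * (a * r + b * s - b * z ^+ 2) = z -> r + s + z ^+ 2 = e ->
  a * b * (a * x * s01 + b * s01 * y - b * s02 * s21) = s01 -> x * s01 + s01 * y + s02 * s21 = 0 ->
  - (a * b) * (a * x * s02 + b * s01 * s12 - b * s02 * z) = s02 -> x * s02 + s01 * s12 + s02 * z = 0 ->
  - (b * b) * (a * s10 * s02 + b * y * s12 - b * s12 * z) = s12 -> s10 * s02 + y * s12 + s12 * z = 0 ->
  x = 0 /\ (a * b ^+ 2) ^+ 2 * e = 1.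
Proof.
move=> a0 b0 ab ab' n01 n02 n12 E1 E2 E3 E4 E5 E6 E7 E8 E9 E10 E11 E12.
have D (u v : K) : u = v -> u - v = 0 by move=> ->; rewrite subrr.
have bma : b - a != 0 by rewrite subr_eq0 eq_sym.
have bpa : b + a != 0 by rewrite addrC addr_eq0.
(* Each off-diagonal position has one equation from STS and one from S^2; eliminating the mixed
   product leaves a multiple of a nonzero entry, which cancels. *)
have A : a * b * ((a + b) * x + 2 * b * y) - 1 = 0.
  apply: (mulIf n01); rewrite mul0r -[RHS](addr0 0) -{1}(D _ _ E7) -(mulr0 (a * b * b)) -E8; ring.
have B : - (a * b) * ((a - b) * x - 2 * b * z) - 1 = 0.
  apply: (mulIf n02); rewrite mul0r -[RHS](addr0 0) -{1}(D _ _ E9) -(mulr0 (a * b * b)) -E10; ring.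
have C : - (b * b) * (- a * (y + z) + b * (y - z)) - 1 = 0.
  apply: (mulIf n12); rewrite mul0r -[RHS](addr0 0) -{1}(D _ _ E11) -(mulr0 (a * b * b)) -E12; ring.
have two0 : 2 != 0 :> K by rewrite pnatr_eq0.
have d0 : a * x + b * y - b * z = 0.
  have k0 : 2 * (a * b) != 0 by rewrite !mulf_neq0.
  by apply: (mulfI k0); rewrite mulr0 -(subrr 0) -{1}A -B; ring.
(* The off-diagonal equations fix the trace of rho(S). *)
have E : a * b ^+ 2 * (x + y + z) - 1 = 0.
  by rewrite -(addr0 0) -{1}C -(mulr0 (b ^+ 2)) -d0; ring.
have F : a ^+ 2 * (y + z) - b ^+ 2 * (a ^+ 3 * e - x) = 0.
  rewrite [LHS](_ : _ = - a ^+ 2 * ((b * b * (a * p + b * y ^+ 2 - b * s) - y)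
     + (b * b * (a * r + b * s - b * z ^+ 2) - z))
     + a ^+ 2 * b ^+ 3 * ((p + y ^+ 2 + s - e) - (r + s + z ^+ 2 - e))
     + a ^+ 3 * b ^+ 2 * (x ^+ 2 + p + r - e)
     - b ^+ 2 * (a * a * (a * x ^+ 2 + b * p - b * r) - x)); last by ring.
  by rewrite !(D _ _ E1) !(D _ _ E2) !(D _ _ E3) !(D _ _ E4) !(D _ _ E5) !(D _ _ E6); ring.
have G : b ^+ 2 * ((a + b) * p + 2 * b * y ^+ 2 - b * e) - y = 0.
  rewrite [LHS](_ : _ = (b * b * (a * p + b * y ^+ 2 - b * s) - y)
     + b ^+ 3 * (p + y ^+ 2 + s - e)); last by ring.
  by rewrite !(D _ _ E3) !(D _ _ E4); ring.
(* The defect of the second conclusion. The first is equivalent to m = 0 by [hx], and after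
   substitution [G] is a nonzero multiple of m because a != b. *)
pose m := (a * b ^+ 2) ^+ 2 * e - 1.
have hx : x = a * m / (b ^+ 2 * (b - a) * (b + a)).
  have : x * (b ^+ 2 * (b - a) * (b + a)) - a * m = 0.
    rewrite [LHS](_ : _ = - a * (a * b ^+ 2 * (x + y + z) - 1)
      + b ^+ 2 * (a ^+ 2 * (y + z) - b ^+ 2 * (a ^+ 3 * e - x))); last by rewrite /m; ring.
    by rewrite E F; ring.
  move/eqP; rewrite subr_eq0 => /eqP <-; field; rewrite b0 bma bpa //.
have hy : y = (1 / (a * b) - (a + b) * x) / (2 * b).
  have : y - (1 / (a * b) - (a + b) * x) / (2 * b) =
    (a * b * ((a + b) * x + 2 * b * y) - 1) / (2 * a * b ^+ 2) by field; rewrite a0 b0.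
  by rewrite A mul0r => /eqP; rewrite subr_eq0 => /eqP.
have hp : p = (a ^+ 2 * b * (e - x ^+ 2) + x - a ^+ 3 * x ^+ 2) / (2 * a ^+ 2 * b).
  have : p - (a ^+ 2 * b * (e - x ^+ 2) + x - a ^+ 3 * x ^+ 2) / (2 * a ^+ 2 * b) =
    (a ^+ 2 * b * (x ^+ 2 + p + r - e) + (a * a * (a * x ^+ 2 + b * p - b * r) - x))
      / (2 * a ^+ 2 * b) by field; rewrite a0 b0.
  by rewrite (D _ _ E1) (D _ _ E2) mulr0 addr0 mul0r => /eqP; rewrite subr_eq0 => /eqP.
have m0 : m = 0.
  have : - (b - a) ^+ 2 / (2 * a ^+ 2 * b ^+ 3) * m = 0.
    rewrite -G hp hy hx /m; field; rewrite a0 b0 bma bpa //.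
  have k0 : - (b - a) ^+ 2 / (2 * a ^+ 2 * b ^+ 3) != 0.
    apply: mulf_neq0; first by rewrite oppr_eq0 expf_neq0.
    by rewrite invr_eq0 !mulf_neq0 // expf_neq0.
  by move=> h; apply: (mulfI k0); rewrite h mulr0.
split; first by rewrite hx m0 mulr0 mul0r.
by apply/eqP; rewrite -subr_eq0 -/m m0.
Qed.

(** * The representation is monomial *)
Section RepStructure.
Variables (K : numFieldType) (rho : SL2Z -> 'M[K]_3) (a b : K).
Hypothesis irr : irreducible_representation rho.
Hypothesis rhoT : rho sl2_T = diag_mx (\row_(j < 3) tnth [tuple a; b; - b] j).
Hypotheses (a0 : a != 0) (b0 : b != 0) (ab : a != b) (ab' : a != - b).

Let rho1 : rho 1%g = 1%:M. Proof. by case: irr => -[]. Qed.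
Let rhoM g h : rho (g * h)%g = rho g *m rho h. Proof. by case: irr => -[]. Qed.

Lemma rhoVl g : rho g^-1%g *m rho g = 1%:M.
Proof. by rewrite -rhoM mulVg rho1. Qed.

Lemma rhoVr g : rho g *m rho g^-1%g = 1%:M.
Proof. by rewrite -rhoM mulgV rho1. Qed.

Definition tev (i : 'I_3) : K := tnth [tuple a; b; - b] i.

Lemma tev_neq0 i : tev i != 0.
Proof. by rewrite /tev; case: (ord3P i) => ->; rewrite /tnth /= ?oppr_eq0. Qed.

Lemma rhoTE i j : rho sl2_T i j = tev i *+ (i == j).
Proof. by rewrite rhoT !mxE. Qed.

Lemma rhoT_mul m (A : 'M[K]_(m, 3)) i j : (A *m rho sl2_T) i j = A i j * tev j.
Proof.
rewrite mxE (bigD1 j) //= big1 => [|k kj]; first by rewrite rhoTE eqxx addr0.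
by rewrite rhoTE (negbTE kj) mulr0.
Qed.

Lemma rhoT_mull m (A : 'M[K]_(3, m)) i j : (rho sl2_T *m A) i j = tev i * A i j.
Proof.
rewrite mxE (bigD1 i) //= big1 => [|k kj]; first by rewrite rhoTE eqxx addr0.
by rewrite rhoTE eq_sym (negbTE kj) mul0r.
Qed.

Lemma rhoTVE i j : rho sl2_T^-1%g i j = (tev i)^-1 *+ (i == j).
Proof.
apply: (mulIf (tev_neq0 j)); rewrite -rhoT_mul rhoVl mxE.
by case: eqVneq => [->|_]; rewrite ?mulr0n ?mul0r // !mulr1n mulVf // tev_neq0.
Qed.

(** Otherwise the column vectors with zero i-th entry would form an invariant plane. *)
Lemma rep_row_proper i : ~ (forall j, j != i -> rho sl2_S i j = 0).
Proof.
move=> hS.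
have H g : forall j, j != i -> rho g i j = 0.
  elim/sl2_ind: g => [|||g h Hg Hh] j ji.
  - exact: hS.
  - by rewrite rhoTE eq_sym (negbTE ji).
  - by rewrite rhoTVE eq_sym (negbTE ji).
  - rewrite rhoM mxE big1 // => k _; have [->|ki] := eqVneq k i; first by rewrite Hh // mulr0.
    by rewrite Hg // mul0r.
pose D : 'M[K]_3 := delta_mx i i.
have st g : stablemx (kermx D) (rho g)^T.
  rewrite sub_kermx -mulmxA; apply/eqP.
  have -> : (rho g)^T *m D = D *m (rho g i i)%:M.
    apply/matrixP => k l; rewrite mul_mx_scalar !mxE (bigD1 i) //= big1 => [|m mi].
      rewrite !mxE addr0 eqxx /=; have [->|ki] := eqVneq k i; first by [].
      by rewrite H // mul0r andFb mulr0.
    by rewrite !mxE (negbTE mi) /= mulr0.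
  by rewrite mulmxA mulmx_ker mul0mx.
have [_ _ /(_ _ st)] := irr.
by rewrite mxrank_ker mxrank_delta; case.
Qed.

Lemma rep_col_proper i : ~ (forall j, j != i -> rho sl2_S j i = 0).
Proof.
move=> hS.
have H g : forall j, j != i -> rho g j i = 0.
  elim/sl2_ind: g => [|||g h Hg Hh] j ji.
  - exact: hS.
  - by rewrite rhoTE (negbTE ji).
  - by rewrite rhoTVE (negbTE ji).
  - rewrite rhoM mxE big1 // => k _; have [->|ki] := eqVneq k i; first by rewrite Hg // mul0r.
    by rewrite Hh // mulr0.
pose D : 'M[K]_3 := delta_mx i i.
have st g : stablemx D (rho g)^T.

  have -> : D *m (rho g)^T = (rho g i i)%:M *m D.
    apply/matrixP => k l; rewrite mul_scalar_mx !mxE (bigD1 i) //= big1 => [|m mi].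
      rewrite !mxE addr0 eqxx andbT; have [->|li] := eqVneq l i; first by rewrite andbT mulrC.
      by rewrite H // mulr0 andbF mulr0.
    by rewrite !mxE (negbTE mi) andbF mul0r.
  exact: submxMl.
have [_ _ /(_ _ st)] := irr.
by rewrite mxrank_delta; case.
Qed.

(** Schur's argument for a central involution: its eigenspace for 1 is stable, hence zero or
    everything. *)
Lemma rep_S2 : exists2 e : K, e = 1 \/ e = -1 & rho (sl2_S * sl2_S)%g = e%:M.
Proof.
set Z := rho (sl2_S * sl2_S)%g.
have ZZ : Z *m Z = 1%:M by rewrite -rhoM sl2_S4 rho1.
have Zc g : Z *m rho g = rho g *m Z by rewrite -!rhoM sl2_S2_central.
have st g : stablemx (kermx (Z^T - 1%:M)) (rho g)^T.
  rewrite sub_kermx -mulmxA mulmxBr mulmx1 -trmx_mul Zc trmx_mul.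
  by rewrite -{2}[(rho g)^T]mul1mx -mulmxBl mulmxA mulmx_ker mul0mx.
have [_ _ /(_ _ st)] := irr; rewrite mxrank_ker => hr.
have hle := rank_leq_row (Z^T - 1%:M).
case: hr => hr.
  exists (-1); first by right.
  have full : row_free (Z^T - 1%:M) by rewrite /row_free; apply/eqP; lia.
  have h : (Z^T + 1%:M) *m (Z^T - 1%:M) = 0.
    by rewrite mulmxDl !mulmxBr !mulmx1 !mul1mx -trmx_mul ZZ trmx1 addrA subrK subrr.
  have : Z^T + 1%:M = 0 by apply: (row_free_inj full); rewrite /= mul0mx h.
  move=> /eqP; rewrite addr_eq0 => /eqP /(congr1 trmx).
  by rewrite trmxK linearN /= trmx1 => ->; rewrite raddfN.
exists 1; first by left.
have : \rank (Z^T - 1%:M) = 0%N by lia.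
move=> /eqP; rewrite mxrank_eq0 subr_eq0 => /eqP /(congr1 trmx).
by rewrite trmxK trmx1.
Qed.

Lemma rep_STS i j : tev i * tev j * (rho sl2_S *m rho sl2_T *m rho sl2_S) i j = rho sl2_S i j.
Proof.
rewrite -!rhoM sl2_STS !rhoM.
have -> : rho sl2_S i j = (rho sl2_T *m (rho sl2_T^-1%g *m rho sl2_S *m rho sl2_T^-1%g) *m rho sl2_T) i j.
  by rewrite !mulmxA rhoVr mul1mx -mulmxA rhoVl mulmx1.
by rewrite rhoT_mul rhoT_mull; ring.
Qed.

Lemma rep_structure : exists e : K, [/\ e = 1 \/ e = -1, rho (sl2_S * sl2_S)%g = e%:M,
  rho sl2_S 0 0 = 0, (a * b ^+ 2) ^+ 2 * e = 1 & rho sl2_S 0 1 != 0 /\ rho sl2_S 0 2%:R != 0].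
Proof.
have [e he hZ] := rep_S2; exists e.
have sq i j : (rho sl2_S *m rho sl2_S) i j = e *+ (i == j) by rewrite -rhoM hZ !mxE.
have sts := rep_STS.
have tev0 : tev 0 = a by []. have tev1 : tev 1 = b by []. have tev2 : tev 2%:R = - b by [].
have stsE i j : (rho sl2_S *m rho sl2_T *m rho sl2_S) i j =
    a * rho sl2_S i 0 * rho sl2_S 0 j + b * rho sl2_S i 1 * rho sl2_S 1 j
    - b * rho sl2_S i 2%:R * rho sl2_S 2%:R j.
  by rewrite mulmx3E !rhoT_mul tev0 tev1 tev2; ring.
have row i j k : [/\ i != j, i != k & j != k] -> rho sl2_S i j != 0 \/ rho sl2_S i k != 0.
  move=> [ij ik jk]; apply/orP/negPn; rewrite negb_or !negbK; apply/negP => /andP[/eqP h1 /eqP h2].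
  apply: (@rep_row_proper i) => l li; move: ij ik jk li h1 h2.
  by case: (ord3P i) => ->; case: (ord3P j) => ->; case: (ord3P k) => ->; case: (ord3P l) => ->.
have col i j k : [/\ i != j, i != k & j != k] -> rho sl2_S j i != 0 \/ rho sl2_S k i != 0.
  move=> [ij ik jk]; apply/orP/negPn; rewrite negb_or !negbK; apply/negP => /andP[/eqP h1 /eqP h2].
  apply: (@rep_col_proper i) => l li; move: ij ik jk li h1 h2.
  by case: (ord3P i) => ->; case: (ord3P j) => ->; case: (ord3P k) => ->; case: (ord3P l) => ->.
have zero_or (u v : K) : u * v = 0 -> u = 0 \/ v = 0.
  by move=> /eqP; rewrite mulf_eq0 => /orP[/eqP|/eqP]; [left|right].
(* A zero here makes another product in the same entry of S^2 vanish, and then row 0 or column 1 of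
   rho(S) is diagonal. *)
have n01 : rho sl2_S 0 1 != 0.
  apply/eqP => h; have := sq 0 1; rewrite mulmx3E h mulr0 mul0r !add0r => /zero_or[] h'.
    by have := row 0 1 2%:R; rewrite h h' eqxx => /(_ _)[].
  by have := col 1 0 2%:R; rewrite h h' eqxx => /(_ _)[].
have n02 : rho sl2_S 0 2%:R != 0.
  apply/eqP => h; have := sq 0 2%:R; rewrite mulmx3E h mulr0 mul0r add0r addr0 => /zero_or[] h'.
    by rewrite h' eqxx in n01.
  by have := col 2%:R 0 1; rewrite h h' eqxx => /(_ _)[].
have n12 : rho sl2_S 1 2%:R != 0.
  apply/eqP => h; have := sq 1 2%:R; rewrite mulmx3E h mulr0 mul0r !addr0 => /zero_or[] h'.
    by have := row 1 0 2%:R; rewrite h h' eqxx => /(_ _)[].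
  by rewrite h' eqxx in n02.
have [x0 ebm] : rho sl2_S 0 0 = 0 /\ (a * b ^+ 2) ^+ 2 * e = 1.
  apply: (@trace_zero_entry K a b e _ (rho sl2_S 1 1) (rho sl2_S 2%:R 2%:R)
    (rho sl2_S 0 1 * rho sl2_S 1 0) (rho sl2_S 0 2%:R * rho sl2_S 2%:R 0)
    (rho sl2_S 1 2%:R * rho sl2_S 2%:R 1)
    (rho sl2_S 0 1) (rho sl2_S 0 2%:R) (rho sl2_S 1 2%:R) (rho sl2_S 1 0) (rho sl2_S 2%:R 1)) => //.
  - by rewrite -[RHS]sts stsE tev0; ring.
  - by rewrite -[RHS](sq 0 0) mulmx3E; ring.
  - by rewrite -[RHS]sts stsE tev1; ring.
  - by rewrite -[RHS](sq 1 1) mulmx3E; ring.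
  - by rewrite -[RHS]sts stsE tev2; ring.
  - by rewrite -[RHS](sq 2%:R 2%:R) mulmx3E; ring.
  - by rewrite -[RHS]sts stsE tev0 tev1; ring.
  - by rewrite -[RHS](sq 0 1) mulmx3E.
  - by rewrite -[RHS]sts stsE tev0 tev2; ring.
  - by rewrite -[RHS](sq 0 2%:R) mulmx3E.
  - by rewrite -[RHS]sts stsE tev1 tev2; ring.
  - by rewrite -[RHS](sq 1 2%:R) mulmx3E.
by split.
Qed.

(* A basis of row vectors permuted up to scalars by rho, indexed by the nonzero
   vectors of F_2^2 on which SL_2(Z) acts from the right (see [parity]). *)
Definition vbase (i : 'I_3) : 'rV[K]_3 :=
  tnth [tuple delta_mx 0 0; delta_mx 0 0 *m rho sl2_S;
        delta_mx 0 0 *m rho sl2_S *m rho sl2_T] i.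

Definition parity (i : 'I_3) : int * int :=
  tnth [tuple (0, 1); (1, 0); (1, 1)] i.

Definition parity_act (i : 'I_3) (g : SL2Z) (j : 'I_3) : bool :=
  (2 %| ((parity i).1 * g 0 0 + (parity i).2 * g 1 0 - (parity j).1)%R)%Z &&
  (2 %| ((parity i).1 * g 0 1 + (parity i).2 * g 1 1 - (parity j).2)%R)%Z.

Lemma vbaseE : [/\ vbase 0 = delta_mx 0 0, vbase 1 = delta_mx 0 0 *m rho sl2_S &
  vbase 2%:R = delta_mx 0 0 *m rho sl2_S *m rho sl2_T].
Proof. by []. Qed.

Variable e : K.
Hypothesis rhoS2 : rho (sl2_S * sl2_S)%g = e%:M.
Hypothesis S00 : rho sl2_S 0 0 = 0.

Lemma delta_mul p (A : 'M[K]_(3, p)) j : ((delta_mx 0 0 : 'rV_3) *m A) 0 j = A 0 j.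
Proof. by rewrite mulmx3E !mxE /= mul1r !mul0r !addr0. Qed.

Lemma vbase_S0 : vbase 0 *m rho sl2_S = vbase 1. Proof. by []. Qed.
Lemma vbase_T1 : vbase 1 *m rho sl2_T = vbase 2%:R. Proof. by []. Qed.

Lemma vbase_T0 : vbase 0 *m rho sl2_T = a *: vbase 0.
Proof.
have [-> _ _] := vbaseE; apply/rowP => j; rewrite rhoT_mul !mxE eqxx /=.
by case: eqVneq => [->|_]; rewrite ?mul0r ?mulr0 // mul1r mulr1.
Qed.

(** As [S00] is zero, e S lies in the span of the eigenvectors for b and -b, on which T^2 is the
    scalar b^2. *)
Lemma vbase_T2 : vbase 2%:R *m rho sl2_T = b ^+ 2 *: vbase 1.
Proof.
have [_ v1 v2] := vbaseE; rewrite v1 v2; apply/rowP => j; rewrite !rhoT_mul [RHS]mxE delta_mul.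
rewrite /tev; case: (ord3P j) => ->; rewrite /tnth /= ?S00 ?mul0r ?mulr0 //; ring.
Qed.

Lemma vbase_S1 : vbase 1 *m rho sl2_S = e *: vbase 0.
Proof.
have [-> -> _] := vbaseE; rewrite -mulmxA -rhoM rhoS2 mul_mx_scalar //.
Qed.

Lemma vbase_TV0 : vbase 0 *m rho sl2_T^-1%g = a^-1 *: vbase 0.
Proof.
rewrite -[vbase 0 in LHS]scale1r -(mulVf a0) -scalerA -vbase_T0.
by rewrite -scalemxAl -mulmxA rhoVr mulmx1.
Qed.

Lemma vbase_TV2 : vbase 2%:R *m rho sl2_T^-1%g = vbase 1.
Proof. by rewrite -vbase_T1 -mulmxA rhoVr mulmx1. Qed.

Lemma vbase_TV1 : vbase 1 *m rho sl2_T^-1%g = b ^- 2 *: vbase 2%:R.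
Proof.
have h : b ^+ 2 != 0 by rewrite expf_neq0.
rewrite -[vbase 1]scale1r -(mulVf h) -scalerA -vbase_T2.
by rewrite -scalemxAl -mulmxA rhoVr mulmx1.
Qed.

(** e STS = e T^-1 S T^-1, and T^-1 only scales e. *)
Lemma vbase_S2 : vbase 2%:R *m rho sl2_S = (a * b ^+ 2)^-1 *: vbase 2%:R.
Proof.
have -> : vbase 2%:R *m rho sl2_S = vbase 0 *m rho (sl2_S * sl2_T * sl2_S)%g.
  by rewrite !rhoM !mulmxA.
rewrite sl2_STS !rhoM !mulmxA vbase_TV0 -!scalemxAl vbase_S0 vbase_TV1 scalerA.
by rewrite (invfM a).
Qed.

Variable n : nat.
Hypotheses (an : a ^+ n = 1) (bn : b ^+ n = 1) (en : e ^+ n = 1).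

Definition monomial (g : SL2Z) := forall i, exists j c,
  [/\ c ^+ n = 1, vbase i *m rho g = c *: vbase j & parity_act i g j].

Lemma parity_act_mul i j k g h : parity_act i g j -> parity_act j h k ->
  parity_act i (g * h)%g k.
Proof.
rewrite /parity_act !sl2_mulE => /andP[/dvdzP[x hx] /dvdzP[y hy]] /andP[/dvdzP[z hz] /dvdzP[w hw]].
apply/andP; split; apply/dvdzP.
  exists (x * h 0 0 + y * h 1 0 + z).
  rewrite !mulrDl -hz mulrAC -hx mulrAC -hy; ring.
exists (x * h 0 1 + y * h 1 1 + w).
rewrite !mulrDl -hw mulrAC -hx mulrAC -hy; ring.
Qed.

Lemma monomialM g h : monomial g -> monomial h -> monomial (g * h)%g.
Proof.
move=> hg hh i; have [j [c [hc hv hp]]] := hg i; have [k [d [hd hw hq]]] := hh j.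
exists k, (c * d); split; last exact: parity_act_mul hp hq.
  by rewrite exprMn hc hd mulr1.
by rewrite rhoM mulmxA hv -scalemxAl hw scalerA.
Qed.

Lemma monomial_all g : monomial g.
Proof.
have [t1 t2 t3 t4] := sl2_TE.
have ab2 : (a * b ^+ 2) ^+ n = 1 by rewrite exprMn an exprAC bn expr1n mulr1.
elim/sl2_ind: g => [i|i|i|]; last exact: monomialM.
- case: (ord3P i) => ->.
  + exists 1, 1; rewrite expr1n scale1r; split=> //.
    by rewrite /parity_act /parity /tnth /= !mkE.
  + exists 0, e; rewrite vbase_S1; split=> //.
    by rewrite /parity_act /parity /tnth /= !mkE.
  + exists 2%:R, (a * b ^+ 2)^-1; rewrite vbase_S2 exprVn ab2 invr1; split=> //.
    by rewrite /parity_act /parity /tnth /= !mkE.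
- case: (ord3P i) => ->.
  + exists 0, a; rewrite vbase_T0; split=> //.
    by rewrite /parity_act /parity /tnth /= t1 t2 t3 t4.
  + exists 2%:R, 1; rewrite expr1n scale1r; split=> //.
    by rewrite /parity_act /parity /tnth /= t1 t2 t3 t4.
  + exists 1, (b ^+ 2); rewrite vbase_T2 exprAC bn expr1n; split=> //.
    by rewrite /parity_act /parity /tnth /= t1 t2 t3 t4.
- have e1 : (sl2_T^-1 = sl2_Tz (-1))%g by rewrite (sl2_TzN 1) sl2_Tz1.
  case: (ord3P i) => ->.
  + exists 0, a^-1; rewrite vbase_TV0 exprVn an invr1; split=> //.
    by rewrite e1 /parity_act /parity /tnth /= !mkE.
  + exists 2%:R, (b ^- 2); rewrite vbase_TV1 exprVn exprAC bn expr1n invr1; split=> //.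
    by rewrite e1 /parity_act /parity /tnth /= !mkE.
  + exists 1, 1; rewrite vbase_TV2 expr1n scale1r; split=> //.
    by rewrite e1 /parity_act /parity /tnth /= !mkE.
Qed.

Lemma monomial_even (g : SL2Z) : (2 %| (g 0 0 - 1)%R)%Z -> (2 %| (g 0 1)%R)%Z -> (2 %| (g 1 0)%R)%Z ->
  (2 %| (g 1 1 - 1)%R)%Z -> forall i, exists c, vbase i *m rho g = c *: vbase i.
Proof.
move=> h1 h2 h3 h4 i; have [j [c [_ hv]]] := monomial_all g i.
suff H : parity_act i g j -> i = j by move=> /H ij; exists c; rewrite hv ij.
move: h1 h2 h3 h4 => /dvdzP[x hx] /dvdzP[y hy] /dvdzP[z hz] /dvdzP[w hw].
have hx' : g 0 0 = x * 2 + 1 by lia.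
have hw' : g 1 1 = w * 2 + 1 by lia.
rewrite /parity_act /parity hx' hw' hy hz.
by case: (ord3P i) => ->; case: (ord3P j) => -> //=;
  move=> /andP[/dvdzP[p hp] /dvdzP[q hq]]; exfalso; move: hp hq; rewrite /tnth /=; lia.
Qed.

Hypotheses (s01 : rho sl2_S 0 1 != 0) (s02 : rho sl2_S 0 2%:R != 0).

Definition vmat : 'M[K]_3 := \matrix_(i, j) vbase i 0 j.

Lemma vmat_unit : vmat \in unitmx.
Proof.
set s := rho sl2_S 0 1; set t := rho sl2_S 0 2%:R.
(* The explicit inverse: the rows of [vmat] are (1, 0, 0), (0, s, t) and (0, b s, - b t). *)
pose W : 'M[K]_3 := \matrix_(i, j) tnth [tuple
  tnth [tuple 1; 0; 0] j; tnth [tuple 0; (2 * s)^-1; (2 * b * s)^-1] j;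
  tnth [tuple 0; (2 * t)^-1; - (2 * b * t)^-1] j] i.
have [v0 v1 v2] := vbaseE.
have two0 : 2 != 0 :> K by rewrite pnatr_eq0.
suff : vmat *m W = 1%:M by move/mulmx1_unit => [].
have st1 : s != 0 by []. have st2 : t != 0 by [].
apply/matrixP => i j; rewrite mulmx3E !mxE.
case: (ord3P i) => ->; rewrite ?v0 ?v1 ?v2 ?rhoT_mul ?delta_mul ?S00 /tev -/s -/t ?mxE;
  case: (ord3P j) => ->; rewrite /tnth /=; field; rewrite ?st1 ?st2 ?b0 ?two0 //.
Qed.

Lemma vmat_inj p (A B : 'M[K]_(3, p)) : (forall i, vbase i *m A = vbase i *m B) -> A = B.
Proof.
move=> h; apply: (can_inj (mulKmx vmat_unit)); apply/row_matrixP => i.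
rewrite !row_mul; have -> : row i vmat = vbase i by apply/rowP => j; rewrite !mxE.
exact: h.
Qed.

Lemma even_commute (g h : SL2Z) :
  (2 %| (g 0 0 - 1)%R)%Z -> (2 %| (g 0 1)%R)%Z -> (2 %| (g 1 0)%R)%Z -> (2 %| (g 1 1 - 1)%R)%Z ->
  (2 %| (h 0 0 - 1)%R)%Z -> (2 %| (h 0 1)%R)%Z -> (2 %| (h 1 0)%R)%Z -> (2 %| (h 1 1 - 1)%R)%Z ->
  rho g *m rho h = rho h *m rho g.
Proof.
move=> g1 g2 g3 g4 h1 h2 h3 h4; apply: vmat_inj => i.
have [c hc] := monomial_even g1 g2 g3 g4 i; have [d hd] := monomial_even h1 h2 h3 h4 i.
by rewrite !mulmxA hc hd -!scalemxAl hc hd !scalerA mulrC.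
Qed.

(** rho g is recovered from the images of the three basis vectors, each given by an index and a root
    of unity; [F] decodes this finite data. *)
Lemma rep_finite_range (rs : seq K) : (forall c, c ^+ n = 1 -> c \in rs) ->
  finite_set (range rho).
Proof.
move=> hrs.
pose F (f : {ffun 'I_3 -> 'I_3 * seq_sub rs}) : 'M[K]_3 :=
  invmx vmat *m \matrix_(i, j) (ssval (f i).2 *: vbase (f i).1) 0 j.
apply: (@sub_finite_set _ _ (range F)); last first.
  by apply: finite_image; exact: finite_finset.
move=> _ [g _ <-].
have H i : exists p : 'I_3 * seq_sub rs, vbase i *m rho g == ssval p.2 *: vbase p.1.
  have [j [c [hc hv _]]] := monomial_all g i.
  by exists (j, SeqSub (hrs _ hc)); rewrite hv.
exists [ffun i => xchoose (H i)] => //; rewrite /F.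
apply: (can_inj (mulKmx vmat_unit)); rewrite mulKVmx ?vmat_unit //.
apply/row_matrixP => i; rewrite row_mul.
have -> : row i vmat = vbase i by apply/rowP => j; rewrite !mxE.
rewrite (eqP (xchooseP (H i))); apply/rowP => j.
by rewrite !mxE ffunE.
Qed.

End RepStructure.

(** * Noncongruence *)
Section Noncongruence.
Variables (K : numFieldType) (rho : SL2Z -> 'M[K]_3).
Hypothesis rho_rep : is_representation rho.

Let rho1 : rho 1%g = 1%:M. Proof. by case: rho_rep. Qed.
Let rhoM g h : rho (g * h)%g = rho g *m rho h. Proof. by case: rho_rep. Qed.

Lemma rho_Tz (n : nat) : rho (sl2_Tz n) = rho sl2_T ^+ n.
Proof.
elim: n => [|n IH]; first by rewrite sl2_Tz0 rho1 expr0.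
rewrite exprSr -IH -sl2_Tz1 -[RHS]rhoM sl2_TzD; congr (rho (sl2_Tz _)); lia.
Qed.

Hypothesis even_comm : forall g h : SL2Z,
  (2 %| (g 0 0 - 1)%R)%Z -> (2 %| (g 0 1)%R)%Z -> (2 %| (g 1 0)%R)%Z -> (2 %| (g 1 1 - 1)%R)%Z ->
  (2 %| (h 0 0 - 1)%R)%Z -> (2 %| (h 0 1)%R)%Z -> (2 %| (h 1 0)%R)%Z -> (2 %| (h 1 1 - 1)%R)%Z ->
  rho g *m rho h = rho h *m rho g.

(* Conjugating T^2 by a matrix congruent to diag(u, u^-1) gives T^(2 u^2) modulo
   the level, whereas both commute under rho. *)
Lemma congruence_order (n u : nat) : (0 < n)%N -> (0 < u)%N -> coprime u (2 * n) ->
  principal_congruence n `<=` rep_kernel rho ->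
  rho sl2_T ^+ (2 * (u * u - 1)) = 1.
Proof.
move=> n0 u0 cop hker; set m := (2 * n)%N.
(* Inverting u modulo m^2, not just m, allows both off-diagonal entries of D to be multiples of m =
   2 n. Then D is diagonal modulo n and trivial modulo 2. *)
have copm : coprime u (m ^ 2) by rewrite coprimeXr.
have [d k hd _] := egcdnP (m ^ 2) u0.
rewrite (eqP copm) in hd.
have hdZ : (d%:Z * u%:Z = k%:Z * m%:Z * m%:Z + 1)%R.
  by rewrite -!PoszM -mulnA mulnn hd; lia.
have detD : (u%:Z * d%:Z - m%:Z * (m%:Z * k%:Z) = 1)%R by rewrite mulrC hdZ; ring.
have detD' : (d%:Z * u%:Z - (- m%:Z) * (- (m%:Z * k%:Z)) = 1)%R by rewrite hdZ; ring.
pose D := mk_sl2 detD; pose D' := mk_sl2 detD'.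
have DD' : (D * D' = 1)%g.
  have [i1 i2 i3 i4] := sl2_1E.
  apply: sl2_ext; rewrite sl2_mulE !mkE ?i1 ?i2 ?i3 ?i4; first [by rewrite -detD; ring | ring].
have [w wdef] : exists w : int, w = (2 * (u * u))%N%:Z by exists (2 * (u * u))%N%:Z.
(* An element of Gamma(n), hence trivial under rho. *)
pose X := (D * sl2_Tz 2 * D' * sl2_Tz (- w))%g.
have XE : [/\ X 0 0 = 1 - 2 * u%:Z * (m%:Z * k%:Z),
   X 0 1 = (1 - 2 * u%:Z * (m%:Z * k%:Z)) * - w + w,
   X 1 0 = - 2 * (m%:Z * k%:Z) ^+ 2 &
   X 1 1 = - 2 * (m%:Z * k%:Z) ^+ 2 * - w + (1 + 2 * u%:Z * (m%:Z * k%:Z))].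
  have aux a b c e : (a * e - b * c = 1)%R -> [/\ (a * 1 + b * 0) * e + (a * 2 + b * 1) * - c = 1 - 2 * a * c,
      (a * 1 + b * 0) * - b + (a * 2 + b * 1) * a = 2 * (a * a),
      (c * 1 + e * 0) * e + (c * 2 + e * 1) * - c = - 2 * c ^+ 2 &
      (c * 1 + e * 0) * - b + (c * 2 + e * 1) * a = 1 + 2 * a * c :> int].
    move=> h; split; [|by ring|by ring|].
    - by transitivity ((a * e - b * c) - 2 * a * c); [ring | rewrite h].
    - by transitivity ((a * e - b * c) + 2 * a * c); [ring | rewrite h].
  have [h1 h2 h3 h4] := aux _ _ _ _ detD.
  have wE : w = 2 * (u%:Z * u%:Z) by rewrite wdef; lia.
  rewrite -wE in h2.
  by split; rewrite /X sl2_mulE !(sl2_mulE (_ * _)%g D') !(sl2_mulE D) !mkE ?h1 ?h2 ?h3 ?h4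
       ?mulr1 ?mulr0 ?addr0.
have Xc : principal_congruence n X.
  have [x1 x2 x3 x4] := XE; have mE : m%:Z = 2 * n%:Z by rewrite /m; lia.
  move=> i j; apply/eqP; rewrite eqz_mod_dvd [X in _ - X]mxE.
  case: (ord2P i) => ->; case: (ord2P j) => ->; rewrite ?x1 ?x2 ?x3 ?x4 /= mE; apply/dvdzP.
  - exists (- 4 * u%:Z * k%:Z); ring.
  - exists (4 * u%:Z * k%:Z * w); ring.
  - exists (- 8 * n%:Z * k%:Z ^+ 2); ring.
  - exists (8 * n%:Z * k%:Z ^+ 2 * w + 4 * u%:Z * k%:Z); ring.
have rX : rho X = 1%:M := hker X Xc.
have ou : odd u by move: cop; rewrite coprimeMr coprimen2 => /andP[].
have od : odd d.
  have := congr1 odd hd; rewrite oddD !oddM ou andbT /m => ->.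
  by rewrite /= ?andbF.
have com : rho D *m rho (sl2_Tz 2) = rho (sl2_Tz 2) *m rho D.
  have ev (q : nat) : odd q -> (2 %| (q%:Z - 1)%R)%Z.
    by move=> oq; apply/dvdzP; exists (q./2 : int); have := odd_double_half q; rewrite oq; lia.
  have m2 : (2 %| m%:Z)%Z by apply/dvdzP; exists n%:Z; rewrite /m; lia.
  apply: even_comm; rewrite ?mkE ?subrr ?dvdz0 //; try exact: ev.
  by rewrite dvdz_mulr.
have u2 : (0 < u * u)%N by rewrite muln_gt0 u0.
have : rho (sl2_Tz 2) *m rho (sl2_Tz (- w)) = 1%:M.
  rewrite -rX /X !rhoM com -(mulmxA (rho (sl2_Tz 2))) -(rhoM D D') DD' rho1 mulmx1 //.
rewrite -rhoM sl2_TzD => h.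
have := rho_Tz (2 * (u * u - 1)); have := rhoM (sl2_Tz (2 - w)) (sl2_Tz (w - 2)).
rewrite h mul1mx sl2_TzD => h2.
have -> : ((2 * (u * u - 1))%N : int) = w - 2 by rewrite wdef; lia.
move=> <-; rewrite -h2 (_ : 2 - w + (w - 2) = 0); last by ring.
by rewrite sl2_Tz0 rho1.
Qed.

End Noncongruence.

(** If p^v divides N, the gcd already absorbs it and the quotient supplies one more p. Otherwise the
    gcd absorbs all powers of p in N and the quotient is prime to p. *)
Lemma dvdn_quotient_gcd p v N G : prime p -> (0 < N)%N -> (0 < G)%N -> (p ^ v %| G)%N ->
  (p %| N %/ gcdn N G)%N -> (p ^ v.+1 %| N)%N.
Proof.
move=> pp N0 G0 hv hp; have g0 : (0 < gcdn N G)%N by rewrite gcdn_gt0 N0.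
have hN := divnK (dvdn_gcdl N G).
have [h|h] := leqP v (logn p N); last first.
  have hNG : (p ^ logn p N %| gcdn N G)%N.
    by rewrite dvdn_gcd pfactor_dvdnn (dvdn_trans _ hv) // dvdn_exp2l // ltnW.
  have : (p ^ (logn p N).+1 %| N)%N by rewrite -{2}hN expnS dvdn_mul.
  by rewrite pfactor_dvdn // ltnn.
have : (p ^ v %| gcdn N G)%N by rewrite dvdn_gcd hv pfactor_dvdn ?h.
by move=> h'; rewrite -hN expnS dvdn_mul // hN.
Qed.

(** The Chinese remainder theorem gives an admissible u congruent to r modulo the p-part of 2 n N.
    With r = 2, or r = 3 if p = 2, the number 2 (r^2 - 1) is 6, respectively 16, and is divisible by
    no prime p >= 5, nor by 9, respectively 32. *)
Lemma square_obstruction (p N n : nat) : prime p -> (0 < n)%N -> (0 < N)%N ->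
  (p %| N)%N -> (p = 3%N -> (9 %| N)%N) -> (p = 2%N -> (32 %| N)%N) ->
  ~ (forall u, (0 < u)%N -> coprime u (2 * n) -> (N %| 2 * (u * u - 1))%N).
Proof.
move=> pp n0 N0 pN h3 h2 hu.
set m := (2 * n * N)%N; have m0 : (0 < m)%N by rewrite !muln_gt0 n0 N0.
set P := (p ^ logn p m)%N; set m' := (m %/ P)%N.
have Pm : (P %| m)%N by exact: pfactor_dvdnn.
have mE : m = (m' * P)%N by rewrite /m' divnK.
have cPm : coprime P m'.
  have [q hq hmq] := pfactor_coprime pp m0.
  have -> : m' = q by rewrite /m' /P {1}hmq mulnK // expn_gt0 prime_gt0.
  by rewrite coprimeXl.
pose r := if p == 2%N then 3%N else 2%N.
pose u := chinese P m' r 1.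
have uP : u = r %[mod P] by exact: chinese_modl.
have um : u = 1 %[mod m'] by exact: chinese_modr.
have cr : coprime r P.
  rewrite coprimeXr // /r; case: eqP => [->//|/eqP p2].
  by rewrite coprime_sym coprimen2; case: (even_prime pp) => // /eqP; rewrite (negbTE p2).
have cu : coprime u m.
  rewrite mE coprimeMr -(coprime_modl u m') um coprime_modl coprime1n /=.
  by rewrite -(coprime_modl u P) uP coprime_modl.
have cu2 : coprime u (2 * n) by move: cu; rewrite /m coprimeMr => /andP[].
have u0 : (0 < u)%N.
  by case: (u) cu2 => //; rewrite /coprime gcd0n; case: (n) n0 => // -[].
have dN := hu u u0 cu2.
have key (q : nat) : (q %| N)%N -> (q %| P)%N -> (2 * (r * r - 1) = 0 %[mod q])%N.
  move=> qN qP.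
  have e : (2 * (u * u) = 2 * (r * r) %[mod q])%N.
    have ur : u = r %[mod q] by rewrite -(modn_dvdm u qP) uP modn_dvdm.
    have uur : (u * u = r * r %[mod q])%N by rewrite -modnMm ur modnMm.
    by rewrite -modnMmr uur modnMmr.
  have uu : (0 < u * u)%N by rewrite muln_gt0 u0.
  have rr : (0 < r * r)%N by rewrite /r; case: ifP.
  have e2 : (2 * (u * u - 1) + 2 = 2 * (r * r - 1) + 2 %[mod q])%N.
    by rewrite !mulnBr !subnK // leq_mul2l.
  by move/eqP: e2; rewrite eqn_modDr => /eqP <-; rewrite mod0n; apply/eqP; exact: dvdn_trans dN.
have hq (q l : nat) : q = (p ^ l)%N -> (q %| N)%N -> (q %| P)%N.
  move=> -> h; rewrite dvdn_exp2l // -pfactor_dvdn //.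
  by rewrite /m dvdn_mull.
have [p2|p2] := eqVneq p 2%N.
  have := key 32%N (h2 p2) (hq 32%N 5 _ (h2 p2)); rewrite /r p2 => /(_ erefl).
  by [].
have [p3|p3] := eqVneq p 3%N.
  have := key 9%N (h3 p3) (hq 9%N 2 _ (h3 p3)); rewrite /r p3 => /(_ erefl).
  by [].
have := key p pN (hq p 1%N (esym (expn1 p)) pN); rewrite /r (negbTE p2) mod0n => /eqP h.
have : (p %| 2 * 3)%N by rewrite /dvdn h.
by rewrite Euclid_dvdM // !dvdn_prime2 // (negbTE p2) (negbTE p3).
Qed.

(** Otherwise p would divide A, B, C and N. Subtracting 8 A - 32 B from 8 (A + 2 B) gives 48 B, so p
    >= 5 divides B and then A; for p = 2 and p = 3 the higher powers of p in N pay for the constants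
    48 and 4. *)
Lemma exponent_obstruction (p A B C N M : nat) : prime p -> (0 < N)%N ->
  N = (2 * M)%N -> C = (B + M)%N -> gcdn (gcdn (gcdn A B) C) N = 1%N ->
  (N %| 4 * (A + 2 * B))%N ->
  (p %| N)%N -> (p = 3%N -> (9 %| N)%N) -> (p = 2%N -> (512 %| N)%N) ->
  ~ pint p ((8 * A%:R - 32 * B%:R) / N%:R).
Proof.
move=> pp N0 NM CM hg h4 pN h3 h2 [c hc /intrP[Z hZ]].
have Nnz : N%:R != 0 :> rat by rewrite pnatr_eq0 -lt0n.
have e : (c%:Z * (8 * A%:Z - 32 * B%:Z) = Z * N%:Z)%R.
  apply: (@intr_inj rat); rewrite rmorphM [RHS]rmorphM /= -hZ rmorphB !rmorphM /= -!pmulrn.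
  by rewrite mulrA mulfVK.
have div (q l : nat) : q = (p ^ l)%N -> (q %| N)%N -> (q%:Z %| (8 * A%:Z - 32 * B%:Z)%R)%Z.
  move=> qE qN; have cq : coprimez q%:Z c%:Z.
    by rewrite coprimezE !absz_nat qE coprimeXl // prime_coprime.
  rewrite -(Gauss_dvdzr _ cq) e dvdz_mull //.
have div4 (q : nat) : (q %| N)%N -> (q%:Z %| (4 * (A%:Z + 2 * B%:Z))%R)%Z.
  move=> qN; have : (q %| 4 * (A + 2 * B))%N by exact: dvdn_trans h4.
  by move=> h; rewrite -(_ : (4 * (A + 2 * B))%N%:Z = 4 * (A%:Z + 2 * B%:Z)) //; lia.
have fin : (p %| A)%N -> (p %| B)%N -> (p %| M)%N -> False.
  move=> pA pB pM; have : (p %| 1)%N by rewrite -hg !dvdn_gcd pA pB pN CM dvdn_add.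
  by rewrite dvdn1 => /eqP p1; rewrite p1 in pp.
have [p2|p2] := eqVneq p 2%N.
  subst p; have /dvdzP[x hx] := div 512%N 9%N erefl (h2 erefl); have /dvdzP[y hy] := div4 512%N (h2 erefl).
  have /dvdnP[w hw] := h2 erefl.
  apply: fin; apply/dvdnP; [exists (A %/ 2)%N | exists (B %/ 2)%N | exists (M %/ 2)%N]; lia.
have [p3|p3] := eqVneq p 3%N.
  subst p; have /dvdzP[x hx] := div 9%N 2%N erefl (h3 erefl); have /dvdzP[y hy] := div4 9%N (h3 erefl).
  have /dvdnP[w hw] := h3 erefl.
  apply: fin; apply/dvdnP; [exists (A %/ 3)%N | exists (B %/ 3)%N | exists (M %/ 3)%N]; lia.
have cp2 : coprime p 2 by rewrite prime_coprime // dvdn_prime2.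
have cp3 : coprime p 3 by rewrite prime_coprime // dvdn_prime2.
have pM : (p %| M)%N by rewrite -(Gauss_dvdr _ cp2) -NM.
have d8 := div p 1%N (esym (expn1 p)) pN; have d4 := div4 p pN.
have pB : (p %| B)%N.
  have : (p%:Z %| (2 * (4 * (A%:Z + 2 * B%:Z)) - (8 * A%:Z - 32 * B%:Z))%R)%Z.
    by apply: rpredB => //; exact: dvdz_mull.
  rewrite (_ : _ - _ = (48 * B)%N%:Z); last by lia.
  have c48 : coprime p 48 by rewrite (_ : 48 = 2 ^ 4 * 3)%N // coprimeMr cp3 coprimeXr.
  by rewrite dvdzE !absz_nat Gauss_dvdr.
have pA : (p %| A)%N.
  have : (p %| 4 * (A + 2 * B))%N by exact: dvdn_trans h4.
  have c4 : coprime p 4 by rewrite (_ : 4 = 2 ^ 2)%N // coprimeXr.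
  by rewrite Gauss_dvdr // dvdn_addl // dvdn_mull.
exact: fin.
Qed.

(** * The action on the upper half-plane *)
Section Moebius.
Variable R : realType.
Implicit Types (t u w z : R[i]) (g h : SL2Z) (k m n : int).

Lemma Re_int_affine m n t : complex.Re (m%:~R * t + n%:~R) = m%:~R * complex.Re t + n%:~R.
Proof. by rewrite -!(rmorph_int (real_complex R)); case: t => x y /=; ring. Qed.

Lemma Im_int_affine m n t : complex.Im (m%:~R * t + n%:~R) = m%:~R * complex.Im t.
Proof. by rewrite -!(rmorph_int (real_complex R)); case: t => x y /=; ring. Qed.

Lemma Im_div u w : complex.Im (u / w) =
  (complex.Im u * complex.Re w - complex.Re u * complex.Im w) / cnorm w ^+ 2.
Proof.
rewrite cnorm_sq; case: u w => a b [c d] /=; set D := c ^+ 2 + d ^+ 2; ring.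
Qed.

Lemma autfactor_neq0 g t : upper_half t -> autfactor g t != 0.
Proof.
rewrite /upper_half /= => ht; apply/eqP => h0.
have := congr1 (@complex.Im R) h0; rewrite Im_int_affine /= => /eqP.
rewrite mulf_eq0 (gt_eqF ht) orbF intr_eq0 => /eqP c0.
have := congr1 (@complex.Re R) h0; rewrite Re_int_affine c0 mul0r add0r /= => /eqP.
rewrite intr_eq0 => /eqP d0.
by have := sl2_det g; rewrite c0 d0 !mulr0 subr0.
Qed.

Lemma Im_moebius g t : complex.Im (moebius g t) = complex.Im t / cnorm (autfactor g t) ^+ 2.
Proof.
rewrite /moebius Im_div; congr (_ / _).
rewrite !Re_int_affine !Im_int_affine; set y := complex.Im t; set x := complex.Re t.
have h : (g 0 0)%:~R * (g 1 1)%:~R - (g 0 1)%:~R * (g 1 0)%:~R = 1 :> R.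
  by rewrite -!rmorphM -rmorphB sl2_det.
move: h; set a := _%:~R; set b := _%:~R; set c := _%:~R; set d := _%:~R; move=> h.
by transitivity (y * (a * b - c * d)); [ring | rewrite h mulr1].
Qed.

Lemma upper_moebius g t : upper_half t -> upper_half (moebius g t).
Proof.
move=> ht; rewrite /upper_half /= Im_moebius divr_gt0 // exprn_gt0 // cnorm_gt0.
exact: autfactor_neq0.
Qed.

Lemma autfactorM g h t : upper_half t ->
  autfactor (g * h)%g t = autfactor g (moebius h t) * autfactor h t.
Proof.
move=> ht; have w0 := autfactor_neq0 h ht.
rewrite [autfactor (g * h)%g t]/autfactor [autfactor g _]/autfactor /moebius.
rewrite !sl2_mulE !rmorphD !rmorphM /=.
set w := autfactor h t in w0 *; rewrite [RHS]mulrDl -[X in _ = X + _]mulrA mulfVK // /w /autfactor; ring.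
Qed.

Lemma moebiusM g h t : upper_half t -> moebius (g * h)%g t = moebius g (moebius h t).
Proof.
move=> ht; have h0 := autfactor_neq0 h ht.
have h1 := autfactor_neq0 g (upper_moebius h ht).
rewrite [LHS]/moebius [RHS]/moebius autfactorM //.
have -> : (((g * h)%g 0 0)%:~R * t + ((g * h)%g 0 1)%:~R) =
    ((g 0 0)%:~R * moebius h t + (g 0 1)%:~R) * autfactor h t.
  rewrite /moebius !sl2_mulE !rmorphD !rmorphM /=; set w := autfactor h t in h0 *.
  by rewrite [RHS]mulrDl -[X in _ = X + _]mulrA mulfVK // /w /autfactor; ring.
by rewrite invfM mulrA mulrAC mulfK.
Qed.

Lemma autfactor1 t : autfactor 1%g t = 1.
Proof. by have [_ _ h1 h2] := sl2_1E; rewrite /autfactor h1 h2 mul0r add0r. Qed.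

Lemma moebius1 t : moebius 1%g t = t.
Proof.
by have [h1 h2 _ _] := sl2_1E; rewrite /moebius autfactor1 h1 h2 mul1r addr0 divr1.
Qed.

Lemma autfactor_Tz n t : autfactor (sl2_Tz n) t = 1.
Proof. by rewrite /autfactor !mkE mul0r add0r. Qed.

Lemma moebius_Tz n t : moebius (sl2_Tz n) t = t + n%:~R.
Proof. by rewrite /moebius autfactor_Tz !mkE mul1r divr1. Qed.

Lemma autfactor_T t : autfactor sl2_T t = 1.
Proof. by rewrite -sl2_Tz1 autfactor_Tz. Qed.

Lemma moebius_T t : moebius sl2_T t = t + 1.
Proof. by rewrite -sl2_Tz1 moebius_Tz. Qed.

Lemma autfactor_S t : autfactor sl2_S t = t.
Proof. by rewrite /autfactor !mkE mul1r addr0. Qed.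

Lemma moebius_S t : moebius sl2_S t = - t^-1.
Proof. by rewrite /moebius autfactor_S !mkE mul0r add0r mulN1r. Qed.

(** After translation to |Re t| <= 1/2, a point with Im t < 1/2 has |t|^2 <= 1/2, so S at least
    doubles its height. The induction is on the number of doublings required. *)
Lemma upper_reduce t : upper_half t -> exists g, 2^-1 <= complex.Im (moebius g t).
Proof.
move=> ht; have [n hn] : exists n : nat, 2^-1 <= complex.Im t * 2 ^+ n.
  have y0 : 0 < complex.Im t by [].
  have yV : 0 <= (complex.Im t)^-1 by rewrite invr_ge0 ltW.
  have := archi_boundP yV; set n := Num.bound _ => hn; exists n.
  have h2 : (complex.Im t)^-1 < 2 ^+ n.
    by apply: lt_trans hn _; rewrite -natrX ltr_nat ltn_expl.
  have : 1 <= complex.Im t * 2 ^+ n by rewrite -ler_pdivrMl // mulr1 ltW.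
  by apply: le_trans; lra.
elim: n t ht hn => [|n IH] t ht hn.
  by exists 1%g; rewrite moebius1; move: hn; rewrite expr0 mulr1.
have [h|h] := leP 2^-1 (complex.Im t); first by exists 1%g; rewrite moebius1.
set m := Num.floor (complex.Re t + 2^-1); set s := moebius (sl2_Tz (- m)) t.
have sE : s = t + (- m)%:~R by exact: moebius_Tz.
have hs : upper_half s by exact: upper_moebius.
have Is : complex.Im s = complex.Im t.
  by rewrite sE -[t in LHS]mul1r (Im_int_affine 1) mul1r.
have Rs : complex.Re s = complex.Re t - m%:~R.
  by rewrite sE -[t in LHS]mul1r (Re_int_affine 1) mul1r rmorphN.
have ns : cnorm s ^+ 2 <= 2^-1.
  have y0 : 0 < complex.Im t by [].
  have := floor_itv (complex.Re t + 2^-1); rewrite -/m rmorphD /= => /andP[h1 h2].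
  rewrite cnorm_sq Is Rs; set x := complex.Re t in h1 h2 *; set y := complex.Im t in h y0 *.
  nra.
have ns0 : 0 < cnorm s ^+ 2 by rewrite exprn_gt0 // cnorm_gt0 upper_neq0.
have hS : upper_half (moebius sl2_S s) by exact: upper_moebius.
have [|g hg] := IH (moebius sl2_S s) hS.
  rewrite Im_moebius autfactor_S Is; apply: le_trans hn _.
  rewrite exprS mulrA ler_pM2r ?exprn_gt0 // ler_pM2l //.
  by rewrite -[leLHS]invrK lef_pV2 ?posrE ?invr_gt0.
by exists (g * sl2_S * sl2_Tz (- m))%g; rewrite !moebiusM.
Qed.

Lemma slash_mx_equivariant (d : nat) (rho : SL2Z -> 'M[R[i]]_d) k (F : R[i] -> 'cV[R[i]]_d) :
  is_representation rho ->
  (forall t, upper_half t -> autfactor sl2_S t ^ (- k) *: F (moebius sl2_S t) = rho sl2_S *m F t) ->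
  (forall t, upper_half t -> autfactor sl2_T t ^ (- k) *: F (moebius sl2_T t) = rho sl2_T *m F t) ->
  forall g t, upper_half t -> autfactor g t ^ (- k) *: F (moebius g t) = rho g *m F t.
Proof.
move=> [r1 rM] hS hT.
have cocycle g h t : upper_half t -> autfactor (g * h)%g t ^ (- k) *: F (moebius (g * h)%g t) =
    autfactor h t ^ (- k) *: (autfactor g (moebius h t) ^ (- k) *: F (moebius g (moebius h t))).
  by move=> ht; rewrite autfactorM // moebiusM // expfzMl scalerA mulrC.
apply: (@sl2_ind (fun g => forall t, upper_half t -> autfactor g t ^ (- k) *: F (moebius g t) = rho g *m F t)) => //.
  move=> t ht; have ht' := upper_moebius (sl2_T^-1)%g ht.
  have := cocycle sl2_T (sl2_T^-1)%g t ht; rewrite mulgV autfactor1 moebius1 exp1rz scale1r.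
  rewrite hT // scalemxAr => h; have := congr1 (mulmx (rho (sl2_T^-1)%g)) h.
  by rewrite mulmxA -rM mulVg r1 mul1mx => <-.
move=> g h hg hh t ht; rewrite cocycle // hg; last exact: upper_moebius.
by rewrite scalemxAr hh // mulmxA -rM.
Qed.

Lemma qexp_qev (f : R[i] -> R[i]) (r : rat) (a : nat -> R[i]) : has_qexp f r a ->
  disc_conv a /\ forall t, upper_half t -> f t = qpow r t * qev a t.
Proof.
move=> hf.
have hs t : upper_half t -> hsum (fun n : nat => a n * e2pi t ^+ n) ((qpow r t)^-1 * f t).
  move=> ht; apply: (@hsum_ext R (fun n : nat => (qpow r t)^-1 * (a n * qpow (r + n%:R) t))) => [n|].
    rewrite /qpow rmorphD /= ratr_nat mulrDl e2piD e2piM.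
    by rewrite mulrCA [X in _ * X]mulrA mulVf ?mul1r // e2pi_neq0.
  apply: hsumZ; apply/cvCP; have := hf t ht.
  set u := series _; set v := psum _; suff -> : u = v by [].
  by apply/funext => n; rewrite /u /v /psum /series /= big_mkord.
have ha : disc_conv a.
  (* The height at which |q| = r'; convergence there bounds the terms. *)
  move=> r' /andP[r0 r1]; pose y := - ln r' / (2 * pi).
  have p0 : 0 < 2 * pi :> R by rewrite mulr_gt0 // pi_gt0.
  have ht : upper_half (0 +i* y).
    by rewrite /upper_half /= divr_gt0 // oppr_gt0 ln_lt0 // r0.
  have rE : cnorm (e2pi (0 +i* y)) = r'.
    by rewrite cnorm_e2pi /= mulrC divfK ?gt_eqF // opprK lnK // posrE.
  have [n0 hn0] := hsum_term (hs _ ht) (ltr01 : 0 < 1 :> R).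
  exists (1 + \sum_(i < n0) cnorm (a i) * r' ^+ i) => n.
  have pos i : 0 <= cnorm (a i) * r' ^+ i by rewrite mulr_ge0 ?cnorm_ge0 // exprn_ge0 // ltW.
  have [h|h] := leqP n0 n.
    have := hn0 n h; rewrite subr0 cnormM cnormX rE => h'.
    by rewrite (le_trans (ltW h')) // lerDl sumr_ge0.
  rewrite (bigD1 (Ordinal h)) //= addrCA lerDl addr_ge0 // sumr_ge0 //.
split=> // t ht; have := hsum_unique (qevP ha ht) (hs t ht) => ->.
by rewrite mulrA mulfV ?mul1r // e2pi_neq0.
Qed.

End Moebius.

(** * The vector-valued form of Delta(t)^x Delta(2t)^y *)
Section EtaVector.
Variable R : realType.
Variables (rho : SL2Z -> 'M[R[i]]_3) (a b e : R[i]) (n : nat).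
Hypothesis irr : irreducible_representation rho.
Hypothesis rhoT : rho sl2_T = diag_mx (\row_(j < 3) tnth [tuple a; b; - b] j).
Hypotheses (a0 : a != 0) (b0 : b != 0).
Hypothesis rhoS2 : rho (sl2_S * sl2_S)%g = e%:M.
Hypothesis S00 : rho sl2_S 0 0 = 0.
Hypotheses (s01 : rho sl2_S 0 1 != 0) (s02 : rho sl2_S 0 2%:R != 0).

(** Coordinates in which rho permutes the entries up to scalars. *)
Definition vcoord i (X : 'cV[R[i]]_3) : R[i] := (vbase rho i *m X) 0 0.

Lemma vcoord_inj X Y : (forall i, vcoord i X = vcoord i Y) -> X = Y.
Proof.
move=> h; apply: (vmat_inj rhoT b0 S00 s01 s02) => i.
by apply/matrixP => x y; rewrite !ord1; exact: h.
Qed.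

Lemma vcoordZ i c X : vcoord i (c *: X) = c * vcoord i X.
Proof. by rewrite /vcoord -scalemxAr mxE. Qed.

Lemma vcoord_mul i j c A X : vbase rho i *m A = c *: vbase rho j ->
  vcoord i (A *m X) = c * vcoord j X.
Proof. by move=> h; rewrite /vcoord mulmxA h -scalemxAl mxE. Qed.

Lemma vcoord0 X : vcoord 0 X = X 0 0.
Proof. by rewrite /vcoord; have [-> _ _] := vbaseE rho; rewrite delta_mul. Qed.

Variables (k : int) (x y : rat) (c : R[i]).
Hypothesis ek : e = (-1) ^ k.
Hypothesis ax : a = e2pi (ratr (x + 2 * y)).
Hypothesis bx : b ^+ 2 = e2pi (ratr (2 * x + y)).

Definition etaE t : R[i] := delta_pow x t * delta_pow y (2 * t).
Definition etaD t : R[i] := delta_pow x t * delta_pow y (t / 2).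

Hypothesis c0 : c != 0.
Hypothesis eta_inv : forall t, upper_half t -> t ^ (- k) * etaE (- t^-1) = c * etaD t.

(** E, its transform under S and its transform under ST, in the order of [vbase]. *)
Definition etav t : 'cV[R[i]]_3 :=
  \col_i tnth [tuple etaE t; c * etaD t; c * etaD (t + 1)] i.

Definition etaF t : 'cV[R[i]]_3 := invmx (vmat rho) *m etav t.

Lemma etavE t : [/\ etav t 0 0 = etaE t, etav t 1 0 = c * etaD t &
  etav t 2%:R 0 = c * etaD (t + 1)].
Proof. by split; rewrite mxE. Qed.

Lemma vcoord_etaF i t : vcoord i (etaF t) = etav t i 0.
Proof.
have -> : vcoord i (etaF t) = (row i (vmat rho) *m etaF t) 0 0.
  by rewrite /vcoord; congr ((_ *m _) _ _); apply/rowP => j; rewrite !mxE.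
by rewrite -row_mul mulKVmx ?mxE // (vmat_unit rhoT b0 S00 s01 s02).
Qed.

Lemma etaE_T t : etaE (t + 1) = a * etaE t.
Proof.
rewrite /etaE mulrDr mulr1 (delta_pow_addn x t 1) (delta_pow_addn y (2 * t) 2) ax mulr1.
rewrite mulrACA -e2piD; congr (e2pi _ * _).
by rewrite rmorphD rmorphM /= ratr_nat mulrC [X in _ + X]mulrC addrC.
Qed.

Lemma etaD_T2 t : etaD (t + 1 + 1) = b ^+ 2 * etaD t.
Proof.
have -> : t + 1 + 1 = t + 2%:R by rewrite -addrA.
rewrite /etaD (delta_pow_addn x t 2) bx (_ : (t + 2%:R) / 2 = t / 2 + 1%:R); last first.
  by rewrite mulrDl divff ?pnatr_eq0.
rewrite (delta_pow_addn y (t / 2) 1) mulr1 mulrACA -e2piD; congr (e2pi _ * _).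
by rewrite rmorphD rmorphM /= ratr_nat [X in X + _]mulrC.
Qed.

Lemma exprzK (z w : R[i]) m : z != 0 -> z ^ (- m) * (z ^ m * w) = w.
Proof. by move=> z0; rewrite mulrA -expfzDr // addNr expr0z mul1r. Qed.

Lemma etaE_inv t : upper_half t -> etaE (- t^-1) = t ^ k * (c * etaD t).
Proof.
move=> ht; rewrite -eta_inv //.
by have := exprzK (etaE (- t^-1)) (- k) (upper_neq0 ht); rewrite opprK => ->.
Qed.

Lemma etaD_inv t : upper_half t -> t ^ (- k) * (c * etaD (- t^-1)) = e * etaE t.
Proof.
move=> ht; have t0 := upper_neq0 ht; rewrite -eta_inv; last exact: upper_inv.
rewrite invrN invrK opprK mulrA -expfzMl mulrN mulfV // ek; congr (_ * _).
by rewrite -exprz_inv invrN invr1.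
Qed.

(** The relation STS = T^-1 S T^-1 read on functions, with w = (t - 1) / t. *)
Lemma etaD_T_inv t : upper_half t ->
  t ^ (- k) * (c * etaD (- t^-1 + 1)) = (a * b ^+ 2)^-1 * (c * etaD (t + 1)).
Proof.
move=> ht; have t0 := upper_neq0 ht.
have hs : upper_half (t - 1) by move: ht; rewrite /upper_half /=; case: (t) => p q /=; rewrite subr0.
have s0 := upper_neq0 hs.
set w := - t^-1 + 1.
have hw : upper_half w.
  by have := upper_inv ht; rewrite /upper_half /w /=; case: (- t^-1) => p q /=; rewrite addr0.
have wE : w = (t - 1) / t by rewrite /w mulrBl divff // mul1r addrC.
have tw : t * w = t - 1 by rewrite wE mulrC divfK.
have h1 := esym (eta_inv hw).
have h2 : etaE (- w^-1) = a^-1 * etaE (- (t - 1)^-1).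
  have -> : - (t - 1)^-1 = - w^-1 + 1.
    by rewrite wE invf_div; apply: (mulIf s0); rewrite mulrDl !mulNr divfK // mulVf // mul1r; ring.
  by rewrite etaE_T mulKf.
have h3 := etaE_inv hs.
have h4 : etaD (t - 1) = b ^- 2 * etaD (t + 1).
  by rewrite -[t in RHS](subrK 1) etaD_T2 mulKf // expf_neq0.
move: h1 h2 h3 h4; generalize (etaD w) (etaE (- w^-1)) (etaE (- (t - 1)^-1)) (etaD (t - 1)).
move=> D E E' D' -> -> -> ->; generalize (etaD (t + 1)) => {}D.
rewrite mulrA -expfzMl tw; set B := b ^+ 2; rewrite [(a * B)^-1]invfM.
by rewrite [a^-1 * (_ ^ k * _)]mulrCA exprzK // -[RHS]mulrA; congr (_ * _); rewrite mulrCA.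
Qed.

Lemma etaF_equivariant g t : upper_half t ->
  autfactor g t ^ (- k) *: etaF (moebius g t) = rho g *m etaF t.
Proof.
have hrep : is_representation rho by case: irr.
have vS0 : vbase rho 0 *m rho sl2_S = 1 *: vbase rho 1 by rewrite scale1r vbase_S0.
have vT1 : vbase rho 1 *m rho sl2_T = 1 *: vbase rho 2%:R by rewrite scale1r vbase_T1.
move: g t; apply: slash_mx_equivariant => // t ht; apply: vcoord_inj => i;
    rewrite ?autfactor_S ?moebius_S ?autfactor_T ?moebius_T ?exp1rz ?scale1r ?vcoordZ vcoord_etaF.
  have [p0 p1 p2] := etavE (- t^-1); have [q0 q1 q2] := etavE t.
  case: (ord3P i) => ->.
  - rewrite p0 (eta_inv ht) (vcoord_mul _ vS0) vcoord_etaF q1 mul1r; reflexivity.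
  - rewrite p1 (etaD_inv ht) (vcoord_mul _ (vbase_S1 irr rhoS2)) vcoord_etaF q0; reflexivity.
  - rewrite p2 (etaD_T_inv ht) (vcoord_mul _ (vbase_S2 irr rhoT a0 b0 S00)) vcoord_etaF q2.
    reflexivity.
have [p0 p1 p2] := etavE (t + 1); have [q0 q1 q2] := etavE t.
case: (ord3P i) => ->.
- rewrite p0 etaE_T (vcoord_mul _ (vbase_T0 rhoT)) vcoord_etaF q0; reflexivity.
- rewrite p1 (vcoord_mul _ vT1) vcoord_etaF q2 mul1r; reflexivity.
- rewrite p2 etaD_T2 (vcoord_mul _ (vbase_T2 rhoT S00)) vcoord_etaF q1 mulrCA; reflexivity.
Qed.

Lemma cder_etav i t : upper_half t -> exists d, cder (fun t => etav t i 0) t d.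
Proof.
move=> ht.
have cE z : upper_half z -> exists d, cder etaE z d.
  move=> hz; eexists; apply: (cderM (cder_delta_pow x hz)).
  exact: (cder_comp (cder_scale 2 z) (cder_delta_pow y (upper_natM 1 hz))).
have cD z : upper_half z -> exists d, cder etaD z d.
  move=> hz; eexists; apply: (cderM (cder_delta_pow x hz)).
  exact: (cder_comp (cder_half z) (cder_delta_pow y (upper_half2 hz))).
have ht1 : upper_half (t + 1).
  by move: ht; rewrite /upper_half /=; case: (t) => p q /=; rewrite addr0.
case: (ord3P i) => ->.
- have [d hd] := cE _ ht; exists d; apply: cder_upper_eq hd => // z _.
  by have [-> _ _] := etavE z.
- have [d hd] := cD _ ht; exists (c * d); apply: cder_upper_eq (cderZ c hd) => // z _.
  by have [_ -> _] := etavE z.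
have [d hd] := cD _ ht1; eexists.
have := cderZ c (cder_comp (cderD (cder_id t) (cder_cst 1 t)) hd).
by apply: cder_upper_eq => // z _; have [_ _ ->] := etavE z.
Qed.

Lemma holomorphic_etaF j : holomorphic_upper (fun t => etaF t j 0).
Proof.
move=> t ht; have [d0 h0] := cder_etav 0 ht; have [d1 h1] := cder_etav 1 ht.
have [d2 h2] := cder_etav 2%:R ht.
have h := cderD (cderD (cderZ (invmx (vmat rho) j 0) h0) (cderZ (invmx (vmat rho) j 1) h1))
  (cderZ (invmx (vmat rho) j 2%:R) h2).
by apply: cder_derivable (cder_upper_eq _ _ h) => // z _; rewrite [RHS]mulmx3E.
Qed.

End EtaVector.

(** * Comparison of functions on Im t >= 1/2 *)

Section Bounds.
Variable R : realType.
Implicit Types (t z w : R[i]) (f g : R[i] -> R[i]) (x y r : rat).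

(* The half-plane Im t >= 1/2 meets every orbit of SL_2(Z). *)
Definition dominated f g := exists2 B : R, 0 <= B &
  forall t, 2^-1 <= complex.Im t -> cnorm (f t) <= B * cnorm (g t).

Lemma half_upper t : 2^-1 <= complex.Im t -> upper_half t.
Proof. by rewrite /upper_half /=; apply: lt_le_trans. Qed.

Lemma dominated_ext f f' g g' : (forall t, upper_half t -> f t = f' t) ->
  (forall t, upper_half t -> g t = g' t) -> dominated f g -> dominated f' g'.
Proof.
move=> h h' [B B0 hB]; exists B => // t ht; have hu := half_upper ht.
by rewrite -h // -h' //; exact: hB.
Qed.

Lemma dominatedM f f' g g' : dominated f g -> dominated f' g' ->
  dominated (fun t => f t * f' t) (fun t => g t * g' t).
Proof.
move=> [B B0 hB] [B' B0' hB']; exists (B * B'); first exact: mulr_ge0.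
move=> t ht; rewrite cnormM (cnormM (g t)) mulrACA.
by apply: ler_pM; rewrite ?cnorm_ge0 //; [exact: hB | exact: hB'].
Qed.

Lemma dominatedD f f' g : dominated f g -> dominated f' g ->
  dominated (fun t => f t + f' t) g.
Proof.
move=> [B B0 hB] [B' B0' hB']; exists (B + B'); first exact: addr_ge0.
move=> t ht; apply: le_trans (cnormD _ _) _; rewrite mulrDl.
by apply: lerD; [exact: hB | exact: hB'].
Qed.

Lemma dominated_refl f : dominated f f.
Proof. by exists 1 => // t _; rewrite mul1r. Qed.

Lemma dominated_cst c : dominated (fun=> c) (fun=> 1).
Proof. by exists (cnorm c); rewrite ?cnorm_ge0 // => t _; rewrite cnorm1 mulr1. Qed.

Lemma dominated_divl c f g : c != 0 -> dominated f g -> dominated f (fun t => c * g t).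
Proof.
move=> c0 [B B0 hB]; exists (B / cnorm c); first by rewrite divr_ge0 // cnorm_ge0.
move=> t ht; rewrite cnormM mulrA divfK; first exact: hB.
by rewrite cnorm_eq0.
Qed.

Lemma dominated_translate f g : dominated f g ->
  dominated (fun t => f (t + 1)) (fun t => g (t + 1)).
Proof.
move=> [B B0 hB]; exists B => // t ht; apply: hB; move: ht.
by case: t => p q /=; rewrite addr0.
Qed.

Lemma dominated_qev (s : nat) a : disc_conv a ->
  dominated (fun t => qev a (s.+1%:R * t)) (fun=> 1 : R[i]).
Proof.
move=> ha.
have h0 : 0 < 2^-1 :> R by [].
have [B B0 hB] := qev_bound h0 ha.
exists B => // t ht; rewrite cnorm1 mulr1; apply: hB.
have y0 : 0 < complex.Im t := half_upper ht.
by rewrite Im_natM; apply: le_trans ht _; rewrite ler_peMl ?ler1n // ltW.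
Qed.

Lemma dominated_qev_half a : disc_conv a -> dominated (fun t => qev a (t / 2)) (fun=> 1 : R[i]).
Proof.
move=> ha.
have h0 : 0 < 2^-1 / 2 :> R by rewrite divr_gt0.
have [B B0 hB] := qev_bound h0 ha.
exists B => // t ht; rewrite cnorm1 mulr1; apply: hB.
by rewrite Im_divn ler_pM2r // invr_gt0.
Qed.

Lemma Im_ratr r t : complex.Im (ratr r * t) = ratr r * complex.Im t.
Proof.
have -> : ratr r = (ratr r : R)%:C :> R[i] by exact: esym (fmorph_rat (real_complex R) r).
by case: t => p q /=; rewrite mul0r addr0.
Qed.

Lemma dominated_qpow r : 0 <= r -> dominated (fun t => e2pi (ratr r * t)) (fun=> 1).
Proof.
move=> r0; exists 1 => // t ht; rewrite cnorm1 mulr1 cnorm_e2pi -expR0 ler_expR Im_ratr.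
rewrite oppr_le0; apply: mulr_ge0; first by rewrite ltW // mulr_gt0 // pi_gt0.
have y0 : 0 < complex.Im t := half_upper ht.
by apply: mulr_ge0; rewrite ?ler0q // ltW.
Qed.

Lemma growth_dominated f : dominated f (fun=> 1) -> growth_le 1 f.
Proof.
move=> [B B0 hB] u v; exists (1 + B) => p q _ hq; rewrite cnormE ltcR expr1z.
have h : 2^-1 <= q by lra.
by have := hB (p +i* q) h; rewrite cnorm1 mulr1; lra.
Qed.

(** A bounded inverse keeps g away from 0, so bounded functions are dominated by g. *)
Lemma dominated_inv (f g h : R[i] -> R[i]) : (forall t, upper_half t -> g t * h t = 1) ->
  dominated h (fun=> 1) -> dominated f (fun=> 1) -> dominated f g.
Proof.
move=> gh dh df; have : dominated (fun t => f t * h t) (fun=> 1).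
  by have := dominatedM df dh; apply: dominated_ext => // t _; rewrite mulr1.
move=> d; have := dominatedM d (dominated_refl g); apply: dominated_ext => t ht.
  by rewrite -mulrA [h t * _]mulrC gh // mulr1.
by rewrite mul1r.
Qed.

Lemma etaEE x y t : etaE x y t =
  e2pi (ratr (x + 2 * y) * t) * (qev (delta_coef R x) t * qev (delta_coef R y) (2 * t)).
Proof.
rewrite /etaE /delta_pow mulrACA -e2piD; congr (e2pi _ * _).
by rewrite rmorphD rmorphM /= ratr_nat [RHS]mulrDl mulrCA mulrA.
Qed.

Lemma etaDE x y t : etaD x y t =
  e2pi (ratr (x + y / 2) * t) * (qev (delta_coef R x) t * qev (delta_coef R y) (t / 2)).
Proof.
rewrite /etaD /delta_pow mulrACA -e2piD; congr (e2pi _ * _).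
by rewrite rmorphD fmorph_div /= ratr_nat [RHS]mulrDl [X in _ = _ + X]mulrAC mulrA.
Qed.

Lemma dominated_delta_2 x y :
  dominated (fun t => qev (delta_coef R x) t * qev (delta_coef R y) (2 * t)) (fun=> 1).
Proof.
have := dominatedM (dominated_qev 0 (@disc_conv_delta R x)) (dominated_qev 1 (@disc_conv_delta R y)).
by apply: dominated_ext => t _; rewrite ?mul1r.
Qed.

Lemma dominated_delta_half x y :
  dominated (fun t => qev (delta_coef R x) t * qev (delta_coef R y) (t / 2)) (fun=> 1).
Proof.
have := dominatedM (dominated_qev 0 (@disc_conv_delta R x)) (dominated_qev_half (@disc_conv_delta R y)).
by apply: dominated_ext => t _; rewrite ?mul1r.
Qed.

Lemma mul2_eq1 (u u' v v' : R[i]) : u * u' = 1 -> v * v' = 1 -> (u * v) * (u' * v') = 1.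
Proof. by move=> h h'; rewrite mulrACA h h' mulr1. Qed.

Lemma dominated_etaE x y f : dominated f (fun=> 1) ->
  dominated (fun t => e2pi (ratr (x + 2 * y) * t) * f t) (etaE x y).
Proof.
move=> hf; have h2 t : upper_half t -> upper_half (2 * t) by move=> h; exact: (upper_natM 1 h).
have : dominated f (fun t => qev (delta_coef R x) t * qev (delta_coef R y) (2 * t)).
  apply: dominated_inv (dominated_delta_2 (- x) (- y)) hf => t ht.
  exact: mul2_eq1 (delta_coefN x ht) (delta_coefN y (h2 t ht)).
move=> h; have := dominatedM (dominated_refl (fun t => e2pi (ratr (x + 2 * y) * t))) h.
by apply: dominated_ext => t _ //; rewrite etaEE.
Qed.

Lemma dominated_etaD x y f : dominated f (fun=> 1) ->
  dominated (fun t => e2pi (ratr (x + y / 2) * t) * f t) (etaD x y).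
Proof.
move=> hf.
have : dominated f (fun t => qev (delta_coef R x) t * qev (delta_coef R y) (t / 2)).
  apply: dominated_inv (dominated_delta_half (- x) (- y)) hf => t ht.
  exact: mul2_eq1 (delta_coefN x ht) (delta_coefN y (upper_half2 ht)).
move=> h; have := dominatedM (dominated_refl (fun t => e2pi (ratr (x + y / 2) * t))) h.
by apply: dominated_ext => t _ //; rewrite etaDE.
Qed.

Lemma etav_dominated x y c i : 0 <= x + 2 * y -> 0 <= x + y / 2 ->
  dominated (fun t => etav x y c t i 0) (fun=> 1).
Proof.
move=> h1 h2.
have dE : dominated (etaE x y) (fun=> 1).
  have := dominatedM (dominated_qpow h1) (dominated_delta_2 x y).
  by apply: dominated_ext => t _; rewrite ?mulr1 // etaEE.
have dD : dominated (fun t => c * etaD x y t) (fun=> 1).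
  have := dominatedM (dominated_cst c) (dominatedM (dominated_qpow h2) (dominated_delta_half x y)).
  by apply: dominated_ext => t _; rewrite ?mulr1 // etaDE.
case: (ord3P i) => ->.
- by apply: dominated_ext dE => // t _; have [-> _ _] := etavE x y c t.
- by apply: dominated_ext dD => // t _; have [_ -> _] := etavE x y c t.
by apply: dominated_ext (dominated_translate dD) => // t _; have [_ _ ->] := etavE x y c t.
Qed.

Lemma etaF_dominated rho x y c j : 0 <= x + 2 * y -> 0 <= x + y / 2 ->
  dominated (fun t => etaF rho x y c t j 0) (fun=> 1).
Proof.
move=> h1 h2; have d i := etav_dominated c i h1 h2.
have dZ i : dominated (fun t => invmx (vmat rho) j i * etav x y c t i 0) (fun=> 1).
  by have := dominatedM (dominated_cst (invmx (vmat rho) j i)) (d i);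
    apply: dominated_ext => // t _; rewrite mulr1.
have := dominatedD (dominatedD (dZ 0) (dZ 1)) (dZ 2%:R).
by apply: dominated_ext => // t _; rewrite [RHS]mulmx3E.
Qed.

End Bounds.

(** * Comparison with the minimal weight vector *)
Section Comparison.
Variable R : realType.
Variables (rho : SL2Z -> 'M[R[i]]_3) (a b e : R[i]) (n : nat).
Hypothesis irr : irreducible_representation rho.
Hypothesis rhoT : rho sl2_T = diag_mx (\row_(j < 3) tnth [tuple a; b; - b] j).
Hypotheses (a0 : a != 0) (b0 : b != 0).
Hypothesis rhoS2 : rho (sl2_S * sl2_S)%g = e%:M.
Hypothesis S00 : rho sl2_S 0 0 = 0.
Hypotheses (s01 : rho sl2_S 0 1 != 0) (s02 : rho sl2_S 0 2%:R != 0).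
Hypotheses (n0 : (0 < n)%N) (an : a ^+ n = 1) (bn : b ^+ n = 1) (en : e ^+ n = 1).
Variables (k : int) (x y : rat) (c : R[i]).
Hypothesis ek : e = (-1) ^ k.
Hypothesis ax : a = e2pi (ratr (x + 2 * y)).
Hypothesis bx : b ^+ 2 = e2pi (ratr (2 * x + y)).
Hypothesis c0 : c != 0.
Hypothesis eta_inv : forall t, upper_half t ->
  t ^ (- k) * etaE x y (- t^-1) = c * etaD x y t.
Hypotheses (xy1 : 0 <= x + 2 * y) (xy2 : 0 <= x + y / 2).

Definition equivariant (l : int) (X : R[i] -> 'cV[R[i]]_3) := forall g t, upper_half t ->
  autfactor g t ^ (- l) *: X (moebius g t) = rho g *m X t.

Lemma equivariant_etaF : equivariant k (etaF rho x y c).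
Proof. exact: (etaF_equivariant irr rhoT a0 b0 rhoS2 S00 s01 s02 ek ax bx eta_inv). Qed.

Lemma vvmf_etaF : vvmf k rho (etaF rho x y c).
Proof.
split=> [j|g t ht j|]; first exact: holomorphic_etaF.
  by rewrite -equivariant_etaF // [RHS]mxE.
by exists 1 => j; apply: growth_dominated; exact: etaF_dominated.
Qed.

Lemma etaF0 t : etaF rho x y c t 0 0 = etaE x y t.
Proof.
rewrite -(vcoord0 rho) (vcoord_etaF rhoT b0 S00 s01 s02).
by have [-> _ _] := etavE x y c t.
Qed.

Lemma etaE_neq0 (t : R[i]) : upper_half t -> etaE x y t != 0.
Proof.
move=> ht; have h2 : upper_half (2 * t) by exact: (upper_natM 1 ht).
by rewrite /etaE mulf_neq0 ?delta_pow_neq0.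
Qed.

Lemma vvmf_nonzero_etaF : vvmf_nonzero k rho.
Proof.
exists (etaF rho x y c); first exact: vvmf_etaF.
have hi : upper_half ('i : R[i]) by rewrite /upper_half /=.
exists 'i => //; apply/eqP => h; have := etaE_neq0 hi.
by rewrite -etaF0 h mxE eqxx.
Qed.

Lemma vvmf_equivariant l X : vvmf l rho X -> equivariant l X.
Proof.
by move=> [_ h _] g t ht; apply/colP => j; rewrite -h // mxE.
Qed.

Lemma cnormXz (z : R[i]) (m : int) : cnorm (z ^ m) = cnorm z ^ m.
Proof. by case: m => m; rewrite ?NegzE -?exprnN ?cnormV -?exprnP cnormX. Qed.

(** Write t = g^-1 s with Im s >= 1/2 and J the modulus of the automorphy factor, so J^2 = Im s / Im
    t >= 1. In monomial coordinates the scalars have modulus 1, hence |X_0 / E| at t is at most B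
    J^(l - k) <= B / J, and J^-2 <= 2 Im t. Squaring avoids a root of Im t. *)
Lemma equivariant_growth l X : equivariant l X -> l < k ->
  (forall i, dominated (fun t => vcoord rho i (X t)) (fun t => etav x y c t i 0)) ->
  exists2 B, 0 <= B & forall t, upper_half t -> complex.Im t <= 2^-1 ->
    cnorm (X t 0 0) ^+ 2 <= B * complex.Im t * cnorm (etaE x y t) ^+ 2.
Proof.
move=> hX lk dX; have [B B0 hB] : exists2 B : R, 0 <= B & forall i t, 2^-1 <= complex.Im t ->
    cnorm (vcoord rho i (X t)) <= B * cnorm (etav x y c t i 0).
  have [B1 p1 h1] := dX 0; have [B2 p2 h2] := dX 1; have [B3 p3 h3] := dX 2%:R.
  have q1 : B1 <= B1 + B2 + B3 by lra.
  have q2 : B2 <= B1 + B2 + B3 by lra.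
  have q3 : B3 <= B1 + B2 + B3 by lra.
  exists (B1 + B2 + B3) => [|i t ht]; first by lra.
  case: (ord3P i) => ->.
  - by apply: le_trans (h1 t ht) _; rewrite ler_wpM2r // cnorm_ge0.
  - by apply: le_trans (h2 t ht) _; rewrite ler_wpM2r // cnorm_ge0.
  by apply: le_trans (h3 t ht) _; rewrite ler_wpM2r // cnorm_ge0.
exists (2 * B ^+ 2); first by rewrite mulr_ge0 // sqr_ge0.
move=> t ht ht2; have [g hg] := upper_reduce ht; set s := moebius g t in hg.
have hs : upper_half s by exact: upper_moebius.
have ts : moebius g^-1%g s = t by rewrite -moebiusM // mulVg moebius1.
have [j [d [dn hd _]]] := monomial_all irr rhoT a0 b0 rhoS2 S00 an bn en g^-1%g 0.
have d1 : cnorm d = 1.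
  have := congr1 (@cnorm R) dn; rewrite cnormX cnorm1 => /eqP.
  by rewrite pexpr_eq1 ?cnorm_ge0 // => /eqP.
set J := cnorm (autfactor g^-1%g s).
have J0 : 0 < J by rewrite cnorm_gt0 autfactor_neq0.
have IJ : complex.Im t = complex.Im s / J ^+ 2 by rewrite -{1}ts Im_moebius.
have tr m Y : equivariant m Y -> J ^ (- m) * cnorm (vcoord rho 0 (Y t)) = cnorm (vcoord rho j (Y s)).
  move=> hY; rewrite -cnormXz -cnormM -vcoordZ -{1}ts hY // (vcoord_mul _ hd).
  by rewrite cnormM d1 mul1r.
have := hB j s hg; rewrite -(tr _ _ hX) -(vcoord_etaF rhoT b0 S00 s01 s02 x y c).
rewrite -(tr _ _ equivariant_etaF) (vcoord_etaF rhoT b0 S00 s01 s02).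
have [-> _ _] := etavE x y c t; rewrite vcoord0.
set u := cnorm _; set v := cnorm _ => huv.
have u0 : 0 <= u := cnorm_ge0 _; have v0 : 0 <= v := cnorm_ge0 _.
have y0 : 0 < complex.Im t := ht.
have J2 : complex.Im s = complex.Im t * J ^+ 2.
  by rewrite IJ divfK // expf_neq0 // gt_eqF.
have J1 : 1 <= J.
  rewrite -(@ler_pXn2r _ 2) ?nnegrE ?(ltW J0) // expr1n.
  have : 2^-1 <= 2^-1 * J ^+ 2 by apply: le_trans hg _; rewrite J2 ler_wpM2r // sqr_ge0.
  by set J' := J ^+ 2 => h; lra.
have huv2 : J * u <= B * v.
  have : J ^ l * (J ^ (- l) * u) <= J ^ l * (B * (J ^ (- k) * v)).
    by rewrite ler_wpM2l // exprz_ge0 // ltW.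
  have Jn : J != 0 by rewrite gt_eqF.
  rewrite mulrA -expfzDr // subrr expr0z mul1r => h.
  have e1 : J ^ l * (B * (J ^ (- k) * v)) = B * v * J ^ (l - k).
    by rewrite expfzDr //; ring.
  rewrite e1 in h.
  have h2 : J ^ (l - k) <= J^-1.
    have lk' : l - k <= -1 by move: lk; clear; lia.
    by rewrite -exprN1; exact: ler_weXz2l.
  have h3 : u <= B * v * J^-1 by apply: le_trans h _; rewrite ler_wpM2l // mulr_ge0.
  by rewrite mulrC -ler_pdivlMr.
have h4 : (J * u) ^+ 2 <= (B * v) ^+ 2.
  by rewrite ler_pXn2r ?nnegrE ?mulr_ge0 // (ltW J0).
have h5 : 1 <= 2 * (complex.Im t * J ^+ 2).
  by rewrite -J2 -ler_pdivrMl // mulr1.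
have h6 : u ^+ 2 * 1 <= u ^+ 2 * (2 * (complex.Im t * J ^+ 2)) by rewrite ler_wpM2l // sqr_ge0.
have h7 : complex.Im t * (J * u) ^+ 2 <= complex.Im t * (B * v) ^+ 2 by rewrite ler_pM2l.
have e2 : u ^+ 2 * (2 * (complex.Im t * J ^+ 2)) = 2 * (complex.Im t * (J * u) ^+ 2) by ring.
have e3 : 2 * B ^+ 2 * complex.Im t * v ^+ 2 = 2 * (complex.Im t * (B * v) ^+ 2) by ring.
rewrite e3; rewrite e2 mulr1 in h6; apply: le_trans h6 _.
by rewrite ler_pM2l.
Qed.

(** The quotient X_0 / E is small on a low horizontal line, and so is its mean there, which is q
    0. *)
Lemma equivariant_weight l X (q : nat -> R[i]) : equivariant l X -> l < k ->
  (forall i, dominated (fun t => vcoord rho i (X t)) (fun t => etav x y c t i 0)) ->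
  disc_conv q -> (forall t, upper_half t -> X t 0 0 = etaE x y t * qev q t) -> q 0%N != 1.
Proof.
move=> hX lk dX hq Xq; have [B B0 hB] := equivariant_growth hX lk dX.
(* At this height B h <= 1/4, so the quotient has modulus at most 1/2, and h <= 1/2 as the growth
   bound requires. *)
pose h := (4 * B + 2)^-1; have h0 : 0 < h by rewrite invr_gt0; lra.
have hh : h * (4 * B + 2) = 1 by rewrite mulVf //; apply/eqP; lra.
have h2 : h <= 2^-1 by nra.
have hBh : B * h <= 4^-1 by nra.
apply/eqP => q1; have : cnorm (q 0%N) <= 2^-1.
  apply: (mean_value hq h0) => r; set t := r +i* h.
  have ht : upper_half t by exact: h0.
  have := hB t ht h2; rewrite Xq // cnormM exprMn mulrC /=.
  rewrite ler_pM2r; last by rewrite exprn_gt0 // cnorm_gt0 etaE_neq0.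
  move=> hle; rewrite -(@ler_pXn2r _ 2) ?nnegrE ?cnorm_ge0 ?invr_ge0 //.
  by apply: le_trans hle (le_trans hBh _); rewrite expr2; lra.
by rewrite q1 cnorm1; lra.
Qed.

Lemma vcoord1 X : vcoord rho 1 X = rho sl2_S 0 1 * X 1 0 + rho sl2_S 0 2%:R * X 2%:R 0.
Proof.
rewrite /vcoord; have [_ -> _] := vbaseE rho.
by rewrite -mulmxA delta_mul mulmx3E S00 mul0r add0r.
Qed.

(** Coordinate 1 mixes the last two components, whose exponents are at least the leading exponent x
    + y / 2 of [etaD]; coordinate 2 is its translate by T. *)
Lemma vcoord_dominated l X (qa qb qc : nat -> R[i]) : equivariant l X ->
  disc_conv qa -> disc_conv qb -> disc_conv qc ->
  (forall t, upper_half t -> X t 0 0 = qpow (x + 2 * y) t * qev qa t) ->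
  (forall t, upper_half t -> X t 1 0 = qpow (x + y / 2) t * qev qb t) ->
  (forall t, upper_half t -> X t 2%:R 0 = qpow (x + y / 2 + 2^-1) t * qev qc t) ->
  forall i, dominated (fun t => vcoord rho i (X t)) (fun t => etav x y c t i 0).
Proof.
move=> hX ha hb hc Xa Xb Xc.
have dq (q : nat -> R[i]) : disc_conv q -> dominated (qev q) (fun=> 1).
  by move=> h; have := dominated_qev 0 h; apply: dominated_ext => t _; rewrite ?mul1r.
have d0 : dominated (fun t => vcoord rho 0 (X t)) (etaE x y).
  have := dominated_etaE x y (dq _ ha).
  by apply: dominated_ext => // t ht; rewrite vcoord0 Xa.
have d1 : dominated (fun t => vcoord rho 1 (X t)) (fun t => c * etaD x y t).
  apply: (dominated_divl c0).
  have h1 := dominatedM (dominated_cst (rho sl2_S 0 1)) (dq _ hb).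
  have half0 : 0 <= 2^-1 :> rat by [].
  have h2 := dominatedM (dominated_cst (rho sl2_S 0 2%:R))
    (dominatedM (dominated_qpow R half0) (dq _ hc)).
  have h1' : dominated (fun t => rho sl2_S 0 1 * qev qb t) (fun=> 1).
    by apply: dominated_ext h1 => // t _; rewrite mulr1.
  have h2' : dominated (fun t => rho sl2_S 0 2%:R * (e2pi (ratr 2^-1 * t) * qev qc t)) (fun=> 1).
    by apply: dominated_ext h2 => // t _; rewrite !mulr1.
  have := dominated_etaD x y (dominatedD h1' h2'); apply: dominated_ext => // t ht.
  rewrite vcoord1 Xb // Xc // /qpow [ratr (_ + 2^-1)]rmorphD /= mulrDl e2piD.
  by rewrite mulrDr mulrCA; congr (_ + _); rewrite mulrCA; congr (_ * _); rewrite mulrA.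
move=> i; case: (ord3P i) => ->.
- by apply: dominated_ext d0 => // t _; have [-> _ _] := etavE x y c t.
- by apply: dominated_ext d1 => // t _; have [_ -> _] := etavE x y c t.
apply: dominated_ext (dominated_translate d1) => t ht; last by have [_ _ ->] := etavE x y c t.
have := hX sl2_T t ht; rewrite autfactor_T moebius_T exp1rz scale1r => ->.
rewrite (@vcoord_mul _ _ _ 2%:R 1) ?mul1r // scale1r; exact: vbase_T1.
Qed.

Definition eta_coef (x y : rat) : nat -> R[i] := conv (delta_coef R x) (stride 2 (delta_coef R y)).

Lemma disc_conv_eta (u v : rat) : disc_conv (eta_coef u v).
Proof. by apply: disc_conv_conv; [|apply: disc_conv_stride]; exact: disc_conv_delta. Qed.

Lemma eta_coef0 (u v : rat) : eta_coef u v 0 = 1.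
Proof. by rewrite /eta_coef /conv big_ord_recl big_ord0 addr0 /stride /= mulr1. Qed.

Lemma qev_eta (u v : rat) t : upper_half t ->
  qev (eta_coef u v) t = qev (delta_coef R u) t * qev (delta_coef R v) (2 * t).
Proof.
move=> ht; have hu := @disc_conv_delta R u; have hv := disc_conv_stride 1 (@disc_conv_delta R v).
apply: etrans (qev_conv hu hv ht) (congr1 _ _).
exact: qev_stride (@disc_conv_delta R v) ht.
Qed.

Lemma minimal_eta k0 F (q : 'I_3 -> nat -> R[i]) :
  minimal_weight rho k0 -> spans_vvmf k0 rho F ->
  (forall j, q j 0%N = 1) ->
  has_qexp (fun t => F t 0 0) (x + 2 * y) (q 0) ->
  has_qexp (fun t => F t 1 0) (x + y / 2) (q 1) ->
  has_qexp (fun t => F t 2%:R 0) (x + y / 2 + 2^-1) (q 2%:R) ->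
  forall m, q 0 m = eta_coef x y m.
Proof.
move=> [_ hmin] [hF hspan] q0 h0 h1 h2.
have [d0 F0E] := qexp_qev h0; have [d1 F1E] := qexp_qev h1; have [d2 F2E] := qexp_qev h2.
have hle := hmin _ vvmf_nonzero_etaF; have hX := vvmf_equivariant hF.
have hE := disc_conv_eta x y.
(* If k0 < k, the quotient of the first component by E has the expansion
   [conv (q 0) (eta_coef (- x) (- y))], whose constant coefficient 1 contradicts
   [equivariant_weight]. *)
have kk : k0 = k.
  apply/eqP; rewrite eq_le hle /= leNgt; apply/negP => lk.
  have hV := disc_conv_eta (- x) (- y).
  have := equivariant_weight hX lk (vcoord_dominated hX d0 d1 d2 F0E F1E F2E)
    (disc_conv_conv d0 hV).
  have -> : conv (q 0) (eta_coef (- x) (- y)) 0 = 1.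
    by rewrite /conv big_ord_recl big_ord0 addr0 q0 mul1r eta_coef0.
  rewrite eqxx => H; suff : false by []; apply: H => t ht.
  have h2t : upper_half (2 * t) by exact: (upper_natM 1 ht).
  rewrite F0E // qev_conv // qev_eta // etaEE.
  have := mul2_eq1 (delta_coefN x ht) (delta_coefN y h2t).
  rewrite /qpow; generalize (e2pi (ratr (x + 2 * y) * t)) (qev (q 0) t) => U V.
  generalize (qev (delta_coef R x) t * qev (delta_coef R y) (2 * t)) => W.
  by generalize (qev (delta_coef R (- x)) t * qev (delta_coef R (- y)) (2 * t)) => W' h;
    rewrite -mulrA [W * _]mulrCA h mulr1.
(* In equal weights the eta vector is d times F, and the constant coefficients force d = 1. *)
subst k0; have [d hd] := hspan _ vvmf_etaF.
have key t : upper_half t -> qev (eta_coef x y) t = qev (fun m => d * q 0 m) t.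
  move=> ht; apply: etrans (qev_eta x y ht) _; apply: etrans _ (esym (qevZ d d0 ht)).
  have := congr1 (fun X : 'cV[R[i]]_3 => X 0 0) (hd t ht).
  rewrite etaF0 mxE (F0E t ht) etaEE /qpow [d * _]mulrCA.
  exact: (mulfI (e2pi_neq0 _)).
have coef := qev_inj hE (disc_convZ d d0) key.
have d1' : d = 1 by have := coef 0%N; rewrite eta_coef0 q0 mulr1.
by move=> m; rewrite coef d1' mul1r.
Qed.

End Comparison.

(** * Unbounded denominators of the coefficients *)
Section FormalStride.
Variable F : numFieldType.
Implicit Types a b d : nat -> F.

Lemma conv_stride a b M n : conv (stride M.+1 a) (stride M.+1 b) n = stride M.+1 (conv a b) n.
Proof.
rewrite {1}/conv [RHS]/stride; case: ifP => [/dvdnP[m ->]|nM]; last first.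
  rewrite big1 // => i _; rewrite /stride; case: ifP => hi; last by rewrite mul0r.
  case: ifP => hj; last by rewrite mulr0.
  have : (M.+1 %| i + (n - i))%N by rewrite dvdn_add.
  by rewrite subnKC ?nM // -ltnS.
rewrite mulnK //; set T := 'I_(m * M.+1).+1.
have hb (j : 'I_m.+1) : (j * M.+1 < (m * M.+1).+1)%N by rewrite ltnS leq_mul2r -ltnS ltn_ord orbT.
have hd (i : T) : (i %/ M.+1 < m.+1)%N.
  have hi : (i <= m * M.+1)%N by rewrite -ltnS.
  by have := leq_div2r M.+1 hi; rewrite mulnK.
rewrite (bigID (fun i : T => M.+1 %| i)%N) /= [X in _ + X]big1 ?addr0; last first.
  by move=> i /negbTE hi; rewrite /stride hi mul0r.
rewrite (reindex_onto (fun j : 'I_m.+1 => Ordinal (hb j)) (fun i : T => Ordinal (hd i))) /=; last first.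
  by move=> i hi; apply: val_inj; rewrite /= divnK.
apply: eq_big => [j|j _]; first by apply/andP; split; [exact: dvdn_mull | apply/eqP/val_inj; rewrite /= mulnK].
by rewrite /stride -mulnBl !dvdn_mull // !mulnK.
Qed.

(** For m = M + 1, theta applied to a(X^m) is m times (theta a)(X^m). *)
Lemma fexp_stride d M n : d 0%N = 0 ->
  stride M.+1 (fexp d) n = fexp (fun k => M.+1%:R * stride M.+1 d k) n.
Proof.
move=> d0; apply: (@fexp_uniq _ _ _ n) => //; first by rewrite /stride dvdn0 div0n d0 mulr0.
move=> m _; have -> : conv (fun k => M.+1%:R * stride M.+1 d k) (stride M.+1 (fexp d)) m =
    M.+1%:R * stride M.+1 (conv d (fexp d)) m.
  by rewrite -conv_stride /conv mulr_sumr; apply: eq_bigr => i _; rewrite mulrA.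
rewrite /stride; case: ifP => h; last by rewrite !mulr0.
by rewrite -fexp_theta // mulrA -natrM mulnC divnK.
Qed.

End FormalStride.

Lemma int_stride (a : nat -> rat) M : int_series a -> int_series (stride M a).
Proof. by move=> h n; rewrite /stride; case: ifP. Qed.

(** [dsigma] is 24 times the logarithmic derivative of the product of the 1 - X^m, so the N-th power
    has integral coefficients once 24 N x and 24 N y are integers. The stride 2 leaves
    [d 1 = - 24 x] untouched by y. *)
Lemma eta_coef_unbounded (R : realType) (p : nat) (x y : rat) (N : nat) (P Q : int) :
  prime p -> (0 < N)%N -> 24 * (N%:R * x) = P%:~R -> 24 * (N%:R * y) = Q%:~R ->
  ~ pint p (- 24 * x) -> p_unbounded p (eta_coef R x y).
Proof.
move=> pp N0 hx hy hp.
pose d k : rat := x * dsigma k + 2 * stride 2 (fun k => y * dsigma k) k.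
have s0 := dsigma0.
have int_dsigma (z : rat) (Z : int) : 24 * z = Z%:~R -> int_series (fexp (fun k => z * dsigma k)).
  move=> hz; have h1 := fexp_dlog_product_int (fun=> 1).
  have h0 : dlog_product (fun=> 1%:~R) 0 = 0 by rewrite /dlog_product big_ord0.
  apply: eq_int_fexp (fexp_int_mulz Z h0 h1) => k.
  by rewrite -hz /dsigma; ring.
have d0 : d 0%N = 0 by rewrite /d /stride /= s0 !mulr0 addr0.
have dN : int_series (fexp (fun k => N%:R * d k)).
  have h1 := int_dsigma _ _ hx; have h2 := int_stride 2 (int_dsigma _ _ hy).
  move=> n; suff <- : conv (fexp (fun k => N%:R * x * dsigma k))
      (stride 2 (fexp (fun k => N%:R * y * dsigma k))) n = fexp (fun k => N%:R * d k) n.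
    exact: conv_int.
  have hst := @fexp_stride _ (fun k => N%:R * y * dsigma k) 1.
  rewrite (eq_conv (a' := fexp (fun k => N%:R * x * dsigma k))
    (b' := fexp (fun k => 2 * stride 2 (fun k => N%:R * y * dsigma k) k))) // => [|i _]; last first.
    by rewrite hst // s0 mulr0.
  rewrite fexpD ?s0 ?mulr0 //; last by rewrite /stride /= s0 !mulr0.
  apply: (@eq_fexp _ _ _ n) => // [|k _]; first by rewrite /stride /= s0 !mulr0 addr0.
  by rewrite /d /stride; case: ifP => _; ring.
exists (fexp d); last first.
  apply: (fexp_unbounded pp N0 d0 dN).
  suff -> : d 1%N = - 24 * x by [].
  by rewrite /d /stride /= dsigmaE big_mkcond big_ord_recl big_ord0 /= divn1 !addr0; ring.
move=> n; rewrite /eta_coef.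
have hdc (z : rat) m : delta_coef R z m = ratr (fexp (fun k => z * dsigma k) m).
  rewrite fexp_rmorph; apply: (@eq_fexp _ _ _ m) => // [|k _]; first exact: dsigmaCx0.
  by rewrite rmorphM.
transitivity (ratr (conv (fexp (fun k => x * dsigma k)) (stride 2 (fexp (fun k => y * dsigma k))) n) : R[i]).
  rewrite /conv rmorph_sum; apply: eq_bigr => i _; rewrite rmorphM hdc; congr (_ * _).
  by rewrite /stride; case: ifP => _; rewrite ?hdc ?rmorph0.
congr (ratr _).
have hst := @fexp_stride _ (fun k => y * dsigma k) 1.
rewrite (eq_conv (a' := fexp (fun k => x * dsigma k))
  (b' := fexp (fun k => 2 * stride 2 (fun k => y * dsigma k) k))) // => [|i _]; last first.
  by rewrite hst // s0 mulr0.
by rewrite fexpD ?s0 ?mulr0 // /stride /= s0 !mulr0.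
Qed.

Lemma growth_lincomb (R : realType) (K : int) (f0 f1 f2 : R[i] -> R[i]) (u v w : R[i]) :
  growth_le K f0 -> growth_le K f1 -> growth_le K f2 ->
  growth_le (K + 1) (fun t => u * f0 t + v * f1 t + w * f2 t).
Proof.
move=> h0 h1 h2 l r; have [Y0 hY0] := h0 l r; have [Y1 hY1] := h1 l r; have [Y2 hY2] := h2 l r.
set S := cnorm u + cnorm v + cnorm w.
have S0 : 0 <= S by rewrite !addr_ge0 ?cnorm_ge0.
exists (1 + `|Y0| + `|Y1| + `|Y2| + S) => p q hp hq.
have n0 := normr_ge0 Y0; have n1 := normr_ge0 Y1; have n2 := normr_ge0 Y2.
have a0 := ler_norm Y0; have a1 := ler_norm Y1; have a2 := ler_norm Y2.
have q0 : 0 < q by lra.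
have qS : S < q by lra.
have b0 : Y0 < q by lra. have b1 : Y1 < q by lra. have b2 : Y2 < q by lra.
have := hY0 p q hp b0; have := hY1 p q hp b1; have := hY2 p q hp b2.
rewrite !cnormE !ltcR; set t := p +i* q => c2 c1 c0.
have Q0 : 0 < q ^ K by rewrite exprz_gt0.
have e1 : q ^ (K + 1) = q ^ K * q by rewrite expfzDr ?expr1z // gt_eqF.
rewrite e1; apply: (@le_lt_trans _ _ (q ^ K * S)); last by rewrite ltr_pM2l.
have tri : cnorm (u * f0 t + v * f1 t + w * f2 t) <=
    cnorm u * cnorm (f0 t) + cnorm v * cnorm (f1 t) + cnorm w * cnorm (f2 t).
  rewrite -(cnormM u) -(cnormM v) -(cnormM w).
  by apply: le_trans (cnormD _ _) _; rewrite lerD2r cnormD.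
apply: le_trans tri _; rewrite /S !mulrDr.
by apply: lerD; [apply: lerD|]; rewrite [leRHS]mulrC; apply: ler_wpM2l;
  rewrite ?cnorm_ge0 // ltW.
Qed.

(** Growth at the other cusps is automatic: a component slashed by g is a linear combination of the
    components. The extra power of y absorbs the coefficients. *)
Lemma vvmf_modular_form (R : realType) (rho : SL2Z -> 'M[R[i]]_3) (k : int) F :
  vvmf k rho F -> forall j, modular_form (rep_kernel rho) k (fun t => F t j 0).
Proof.
move=> [hol eqv [K hK]] j; split=> [|g t hg ht|g]; first exact: hol.
  by rewrite eqv // hg mul1mx.
exists (K + 1); have := growth_lincomb (rho g j 0) (rho g j 1) (rho g j 2%:R) (hK 0) (hK 1) (hK 2%:R).
move=> h l r; have [Y hY] := h l r; exists (Num.max Y 0) => p q hp.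
rewrite gt_max => /andP[hq q0]; rewrite eqv; last exact: q0.
by rewrite mulmx3E; exact: hY.
Qed.

Lemma quotient_valuations (p N : nat) : prime p -> (0 < N)%N ->
  (p %| N %/ gcdn N (2 ^ 8 * 3 ^ 4 * 5 ^ 2 * 7 ^ 2))%N ->
  [/\ (p %| N)%N, p = 3%N -> (9 %| N)%N & p = 2%N -> (512 %| N)%N].
Proof.
move=> pp N0.
have [G [G0 G2 G3 ->]] : exists G, [/\ (0 < G)%N, (2 ^ 8 %| G)%N, (3 ^ 4 %| G)%N &
    (2 ^ 8 * 3 ^ 4 * 5 ^ 2 * 7 ^ 2)%N = G].
  eexists; split; last reflexivity; first by rewrite 3!muln_gt0 4!expn_gt0.
    by rewrite -2!mulnA dvdn_mulr.
  by rewrite -2!mulnA dvdn_mull // dvdn_mulr.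
move=> h; split.
- by rewrite -(expn1 p); apply: (dvdn_quotient_gcd pp N0 G0 _ h); rewrite expn0 dvd1n.
- move=> p3; rewrite p3 in pp h; have := dvdn_quotient_gcd pp N0 G0 G3 h.
  by apply: dvdn_trans.
- move=> p2; rewrite p2 in pp h; exact: (dvdn_quotient_gcd pp N0 G0 G2 h).
Qed.

Lemma e2pi_frac_inj (R : realType) (m l N : nat) : (m < N)%N -> (l < N)%N -> m != l ->
  e2pi (m%:R / N%:R : R[i]) != e2pi (l%:R / N%:R).
Proof.
wlog ml : m l / (m < l)%N.
  move=> H mN lN; rewrite neq_ltn => /orP[h|h]; first by apply: H; rewrite ?ltn_eqF.
  by rewrite eq_sym; apply: H; rewrite ?ltn_eqF.
move=> mN lN _; have := @e2pi_frac_neq1 R (l - m) N.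
have -> : (0 < l - m < N)%N by rewrite subn_gt0 ml (leq_ltn_trans (leq_subr _ _)).
move=> /(_ isT); apply: contra => /eqP h.
rewrite -(inj_eq (mulfI (e2pi_neq0 (m%:R / N%:R)))) -e2piD mulr1 h -mulrDl -natrD.
by rewrite subnKC // ltnW.
Qed.

Lemma e2pi_frac_dvd (R : realType) (m N : nat) : (0 < N)%N -> e2pi (m%:R / N%:R : R[i]) = 1 ->
  (N %| m)%N.
Proof.
move=> N0 h; have Nn : N%:R != 0 :> R[i] by rewrite pnatr_eq0 -lt0n.
rewrite {1}(divn_eq m N) natrD mulrDl e2piD natrM mulfK // e2pi_nat mul1r in h.
rewrite /dvdn -leqn0 leqNgt; apply/negP => m0.
have := @e2pi_frac_neq1 R (m %% N) N; rewrite m0 ltn_pmod // h eqxx.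
by move=> /(_ isT).
Qed.

Lemma unity_roots_seq (F : closedFieldType) (n : nat) : (0 < n)%N ->
  exists rs : seq F, forall c, c ^+ n = 1 -> c \in rs.
Proof.
move=> n0; have [rs hrs] := closed_field_poly_normal ('X^n - 1 : {poly F}).
exists rs => c hc; have : root ('X^n - 1) c by rewrite /root !hornerE hc subrr.
rewrite hrs rootZ ?root_prod_XsubC // lead_coef_eq0.
by rewrite -size_poly_eq0 size_XnsubC.
Qed.

Theorem proposition5p1 (R : realType) (rho : SL2Z -> 'M[R[i]]_3)
    (A B C N M : nat) (k0 : int) (F0 : R[i] -> 'cV[R[i]]_3)
    (a : 'I_3 -> nat -> R[i]) :
  irreducible_representation rho ->
  rho sl2_T = diag_mx (\row_(j < 3) e2pi ((tnth [tuple A; B; C] j)%:R / N%:R)) ->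
  N.-primitive_root (rho sl2_T) ->
  [/\ A != B, A != C & B != C] ->
  [/\ (A <= N - 1)%N, (B <= N - 1)%N & (C <= N - 1)%N] ->
  gcdn (gcdn (gcdn A B) C) N = 1%N ->
  minimal_weight rho k0 ->
  spans_vvmf k0 rho F0 ->
  (forall j : 'I_3, a j 0%N = 1 /\
     has_qexp (fun t => F0 t j 0) ((tnth [tuple A; B; C] j)%:Q / N%:Q) (a j)) ->
  (2 <= M)%N -> N = (2 * M)%N -> C = (B + M)%N ->
  finite_set (range rho) /\
  (forall p : nat, prime p ->
     (p %| N %/ gcdn N (2 ^ 8 * 3 ^ 4 * 5 ^ 2 * 7 ^ 2))%N ->
     noncongruence (rep_kernel rho) /\
     exists j : 'I_3, modular_form (rep_kernel rho) k0 (fun t => F0 t j 0) /\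
                      p_unbounded p (a j)).
Proof.
move=> irr rhoT0 prim [AB AC BC] [AN BN CN] hgcd hmin hspan hq M2 NM CM.
have N0 : (0 < N)%N by rewrite NM muln_gt0 /=; exact: leq_trans M2.
have AltN : (A < N)%N by lia.
have BltN : (B < N)%N by lia.
have CltN : (C < N)%N by lia.
have Nn : N%:R != 0 :> R[i] by rewrite pnatr_eq0 -lt0n.
have NQ : N%:R != 0 :> rat by rewrite pnatr_eq0 -lt0n.
have MQ : M%:R != 0 :> rat by rewrite pnatr_eq0 -lt0n; exact: leq_trans M2.
pose al : R[i] := e2pi (A%:R / N%:R); pose be : R[i] := e2pi (B%:R / N%:R).
have CE : e2pi (C%:R / N%:R) = - be.
  have -> : C%:R / N%:R = B%:R / N%:R + 2^-1 :> R[i].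
    rewrite CM natrD mulrDl; congr (_ + _).
    have MC : M%:R != 0 :> R[i] by rewrite pnatr_eq0 -lt0n; exact: leq_trans M2.
    by rewrite NM natrM invfM mulrCA mulfV // mulr1.
  by rewrite e2piD e2pi_half mulrN1.
have rhoT : rho sl2_T = diag_mx (\row_(j < 3) tnth [tuple al; be; - be] j).
  rewrite rhoT0; congr diag_mx; apply/rowP => j; rewrite !mxE.
  by case: (ord3P j) => ->; rewrite /tnth //= CE.
have a0 : al != 0 by exact: e2pi_neq0.
have b0 : be != 0 by exact: e2pi_neq0.
have ab : al != be by exact: e2pi_frac_inj.
have ab' : al != - be by rewrite -CE; exact: e2pi_frac_inj.
have [e [he rhoS2 S00 abe [s01 s02]]] := rep_structure irr rhoT a0 b0 ab ab'.
have aN : al ^+ N = 1 by rewrite -e2piM mulrC divfK // e2pi_nat.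
have bN : be ^+ N = 1 by rewrite -e2piM mulrC divfK // e2pi_nat.
have eN : e ^+ N = 1.
  by case: he => ->; rewrite ?expr1n // NM exprM sqrrN expr1n expr1n.
have ee : e * e = 1 by case: he => ->; rewrite ?mulr1 // mulrNN mulr1.
have abE m : (al * be ^+ 2) ^+ m = e2pi ((m * (A + 2 * B))%:R / N%:R).
  rewrite -e2piM -e2piD -e2piM; congr e2pi.
  rewrite natrM natrD natrM -[RHS]mulrA; congr (_ * _); by rewrite [RHS]mulrDl -[X in _ = _ + X]mulrA.
(* (a b^2)^2 equals e, so (a b^2)^4 = 1; the quotient k will be the weight of E. *)
have /dvdnP[k hk] : (N %| 4 * (A + 2 * B))%N.
  apply: (@e2pi_frac_dvd R) => //; rewrite -abE (exprM _ 2 2).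
  have -> : (al * be ^+ 2) ^+ 2 = e by rewrite -[LHS]mulr1 -ee mulrA abe mul1r.
  by rewrite expr2.
(* e is e2pi of 2 (A + 2 B) / N = k / 2: the parity of the weight agrees with rho(S^2). *)
have ek : e = (-1) ^ k%:Z.
  have -> : e = (al * be ^+ 2) ^+ 2 by rewrite -[RHS]mulr1 -ee mulrA abe mul1r.
  rewrite abE -exprnP -e2pi_half -e2piM; congr e2pi.
  have h : (4 * (A + 2 * B))%:R = (k * N)%:R :> R[i] by rewrite hk.
  apply: (mulIf Nn); rewrite divfK // mulrAC; apply: (mulIf (_ : 2 != 0 :> R[i])).
    by rewrite pnatr_eq0.
  rewrite mulfVK ?pnatr_eq0 // -!natrM -hk; congr _%:R; lia.
(* Written over 24 N, so that 24 N x and 24 N y are visibly integers. *)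
pose x : rat := (32 * B%:R - 8 * A%:R) / (24 * N%:R).
pose y : rat := (16 * (A%:R - B%:R)) / (24 * N%:R).
have xy1 : x + 2 * y = A%:Q / N%:Q by rewrite /x /y -!pmulrn; field.
have xy2 : x + y / 2 = B%:Q / N%:Q by rewrite /x /y -!pmulrn; field.
have xy2' : 2 * x + y = 2 * (B%:Q / N%:Q) by rewrite /x /y -!pmulrn; field.
have xy3 : x + y / 2 + 2^-1 = C%:Q / N%:Q.
  by rewrite xy2 -!pmulrn CM NM [(B + M)%:R]natrD natrM; field.
have xyk : (k%:Z)%:~R = 12 * (x + y) :> rat.
  have h : 4 * (A%:R + 2 * B%:R) = k%:R * N%:R :> rat.
    by rewrite -!natrM -natrD -!natrM hk.
  rewrite -pmulrn; apply: (mulIf NQ); rewrite -h /x /y; field.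
  exact: NQ.
have [c c0 hc] := @delta_pow_inv R x y k xyk.
have ratrQ (m : nat) : ratr (m%:Q / N%:Q) = m%:R / N%:R :> R[i].
  by rewrite -!pmulrn fmorph_div /= !ratr_nat.
have ax : al = e2pi (ratr (x + 2 * y)) by rewrite xy1 ratrQ.
have bx : be ^+ 2 = e2pi (ratr (2 * x + y)).
  by rewrite xy2' rmorphM /= ratrQ ratr_nat e2piM.
have frac0 (m : nat) : 0 <= m%:Q / N%:Q by rewrite -!pmulrn divr_ge0.
have aE m : a 0 m = eta_coef R x y m.
  have p1 : 0 <= x + 2 * y by rewrite xy1.
  have p2 : 0 <= x + y / 2 by rewrite xy2.
  apply: (minimal_eta irr rhoT a0 b0 rhoS2 S00 s01 s02 N0 aN bN eN ek ax bx c0 hc p1 p2 hmin hspan).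
  - by move=> j; have [] := hq j.
  - by rewrite xy1; have [_] := hq 0.
  - by rewrite xy2; have [_] := hq 1.
  - by rewrite xy3; have [_] := hq 2%:R.
split.
  have [rs hrs] := unity_roots_seq R[i] N0.
  exact: (rep_finite_range irr rhoT a0 b0 rhoS2 S00 aN bN eN s01 s02 hrs).
move=> p pp hp; have [pN p3 p2] := quotient_valuations pp N0 hp.
split.
  move=> [n [n0 hn]]; apply: (square_obstruction pp n0 N0 pN p3) => [/p2|u u0 cu].
    by apply: dvdn_trans.
  have hrep : is_representation rho by case: irr.
  rewrite (prim_order_dvd prim); apply/eqP.
  apply: (congruence_order hrep _ n0 u0 cu hn) => g h.
  exact: (even_commute irr rhoT a0 b0 ab ab' rhoS2 S00 aN bN eN s01 s02).
exists 0; split; first by apply: vvmf_modular_form; case: hspan.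
have [r hr hun] : p_unbounded p (eta_coef R x y).
  apply: (@eta_coef_unbounded R p x y N (32 * B%:Z - 8 * A%:Z) (16 * (A%:Z - B%:Z)) pp N0).
  - by rewrite rmorphB !rmorphM /= /x -!pmulrn; field; exact: NQ.
  - by rewrite rmorphM rmorphB /= /y -!pmulrn; field; exact: NQ.
  have -> : - 24 * x = (8 * A%:R - 32 * B%:R) / N%:R by rewrite /x; field; exact: NQ.
  by apply: (exponent_obstruction pp N0 NM CM hgcd _ pN p3 p2); rewrite hk dvdn_mull.
by exists r; [move=> m; rewrite aE; exact: hr | exact: hun].
Qed.
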